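(* Let $(R,\mathfrak{m}_R,k)$, $(S,\mathfrak{m}_S,k)$ and $(T,\mathfrak{m}_T,k)$ be local rings with the same residue field $k$, where $R$ and $S$ have the same prime characteristic $p>0$, and let $\epsilon_R:R\to T$ and $\epsilon_S:S\to T$ be surjective ring homomorphisms. Assume $\dim R>0$. Let $\mathfrak{m}$ be the maximal ideal of $P=R\times_T S$, let $I$ and $J$ be $\mathfrak{m}$-primary ideals of $P$, and let $s>0$ be a real number. Regard $R$, $S$, $T$ as $P$-modules. Then: (i) if $\dim(R)=\dim(S)=\dim(T)$, then $h_s(I,J;R\times_T S)=h_s(I,J;R)+h_s(I,J;S)-h_s(I,J;T)$; (ii) if $\dim(R)=\dim(S)>\dim(T)$, then $h_s(I,J;R\times_T S)=h_s(I,J;R)+h_s(I,J;S)$; (iii) if $\dim(R)>\dim(S)>\dim(T)$, then $h_s(I,J;R\times_T S)=h_s(I,J;R)$. Here all $h$-functions are taken over the local ring $P$.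
   Context: All rings are commutative, Noetherian, local, with identity. The fiber product is $R\times_T S=\{(r,s)\in R\times S:\epsilon_R(r)=\epsilon_S(s)\}$; it is a Noetherian local ring with maximal ideal $\mathfrak{m}=\mathfrak{m}_R\times_{\mathfrak{m}_T}\mathfrak{m}_S$ and residue field $k$, of characteristic $p$, with $\dim(R\times_T S)=\max\{\dim R,\dim S\}$. It acts on $R$ and $S$ via the two projections and on $T$ via the common composite $R\times_T S\to T$. $h$-function: let $(A,\mathfrak{n})$ be a local ring of prime characteristic $p>0$ and dimension $d>0$, let $I,J$ be $\mathfrak{n}$-primary ideals, $N$ a finitely generated $A$-module, $s>0$ real. Put $$h_s(I,J;N)=h_s^A(I,J;N)=\lim_{e\to\infty}\frac{\ell_A\big(N/(I^{\lceil sp^e\rceil}+J^{[p^e]})N\big)}{p^{ed}},\qquad d=\dim A,$$ where $\ell_A$ is length and $J^{[p^e]}$ is the ideal generated by the $p^e$-th powers of elements of $J$ (the limit is known to exist). *)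

(* Defs.v *)
From HB Require Import structures.
From mathcomp Require Import all_boot all_order all_algebra.
From mathcomp Require Import all_classical all_reals all_analysis.

Set Implicit Arguments.
Unset Strict Implicit.
Unset Printing Implicit Defensive.

Import Order.TTheory GRing.Theory Num.Theory numFieldNormedType.Exports.

Local Open Scope classical_set_scope.
Local Open Scope ring_scope.

(* The greatest element of X, and 0 if X has none.  It is only meant for sets
   of lengths of chains, which are bounded for the Krull dimension of a
   Noetherian local ring and for a module of finite length. *)
Definition nat_max (X : set nat) : nat :=
  xget 0%N [set n | X n /\ forall m, X m -> (m <= n)%N].

Section Submodules.
Variables (A : comNzRingType) (V : lmodType A).

Definition submodule (N : set V) : Prop := submod_closed [in N].

Definition span (X : set V) : set V := smallest submodule X.

Lemma span_submodule (X : set V) : submodule (span X).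
Proof.
split; first by apply/mem_set => N [[/set_mem N0 _] _].
move=> a u v /set_mem hu /set_mem hv; apply/mem_set => N [subN sXN].
have [_ linN] := subN.
by apply/set_mem/linN; apply/mem_set; [apply: hu | apply: hv].
Qed.

Definition span_pred (X : set V) : {pred V} := [in span X].

HB.instance Definition _ (X : set V) :=
  GRing.isSubmodClosed.Build A V (span_pred X)
    (GRing.submod_closed_semi (span_submodule X)).

Definition length : nat :=
  nat_max [set n | exists N : nat -> set V,
    (forall i, (i <= n)%N -> submodule (N i)) /\
    (forall i, (i < n)%N -> N i `<` N i.+1)].

End Submodules.

Section QuotientModule.
Variables (A : comNzRingType) (V : lmodType A) (X : set V).
Local Open Scope quotient_scope.

(* The quotient of V by the submodule span X: the additive group is the one of
   ring_quotient, to which the action of A is added. *)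
Definition quot_mod : Type := Quotient.quot (span_pred X).

HB.instance Definition _ := GRing.Zmodule.on quot_mod.

Local Notation Q := (Quotient.quot (span_pred X)).

Definition quot_scale (a : A) (x : quot_mod) : quot_mod :=
  \pi_Q (a *: repr (x : Q)).

Lemma quot_scale_pi a (v : V) :
  quot_scale a (\pi_Q v) = \pi_Q (a *: v).
Proof.
apply/eqP; rewrite /quot_scale -Quotient.idealrBE -scalerBr rpredZ //.
by rewrite Quotient.idealrBE reprK.
Qed.

Fact quot_scaleA a b x : quot_scale a (quot_scale b x) = quot_scale (a * b) x.
Proof. by rewrite {2}/quot_scale quot_scale_pi scalerA. Qed.

Fact quot_scale1 : left_id 1 quot_scale.
Proof. by move=> x; rewrite /quot_scale scale1r reprK. Qed.

Fact quot_scaleDr : right_distributive quot_scale +%R.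
Proof.
move=> a x y; rewrite -[x](@reprK _ Q) -[y](@reprK _ Q).
by rewrite -[_ + _]raddfD !quot_scale_pi scalerDr raddfD.
Qed.

Fact quot_scaleDl x : {morph quot_scale^~ x : a b / a + b}.
Proof. by move=> a b; rewrite /quot_scale scalerDl raddfD. Qed.

HB.instance Definition _ := GRing.Zmodule_isLmodule.Build A quot_mod
  quot_scaleA quot_scale1 quot_scaleDr quot_scaleDl.

End QuotientModule.

Section Ideals.
Variable A : comNzRingType.
Implicit Types I J Q M : set A.

Definition ideal I : Prop := submodule (I : set A^o).

Definition ideal_span (X : set A) : set A := span (X : set A^o).

Definition ideal_add I J : set A := [set x + y | x in I & y in J].

Definition ideal_pow I (n : nat) : set A :=
  ideal_span [set x | exists2 f : 'I_n -> A,
                        (forall i, I (f i)) & x = \prod_(i < n) f i].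

(* I^[q], for q a power of the characteristic *)
Definition frobenius_pow I (q : nat) : set A :=
  ideal_span [set x ^+ q | x in I].

(* In idealr_closed, ideals are proper. *)
Definition prime_ideal Q : Prop :=
  idealr_closed [in Q] /\ prime_idealr_closed [in Q].

Definition maximal_ideal M : Prop :=
  idealr_closed [in M] /\
  forall J, ideal J -> M `<=` J -> J = M \/ J = setT.

Definition radical I : set A := [set x | exists n, I (x ^+ n)].

Definition primary_to M Q : Prop :=
  [/\ idealr_closed [in Q],
      forall x y, Q (x * y) -> Q x \/ exists n, Q (y ^+ n)
    & radical Q = M].

Definition noetherian : Prop :=
  forall I, ideal I -> exists s : seq A, I = ideal_span [set` s].

Definition krull_dim : nat :=
  nat_max [set n | exists Q : nat -> set A,
    (forall i, (i <= n)%N -> prime_ideal (Q i)) /\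
    (forall i, (i < n)%N -> Q i `<` Q i.+1)].

(* "(A, m, k) is a Noetherian local ring": k is the residue field up to
   isomorphism, i.e. the target of a surjection of kernel m. *)
Definition noetherian_local (m : set A) (k : fieldType) : Prop :=
  [/\ noetherian,
      maximal_ideal m,
      forall M, maximal_ideal M -> M = m
    & exists f : {rmorphism A -> k},
        (forall y, exists x, f x = y) /\ (forall x, m x <-> f x = 0)].

End Ideals.

(* B as an A-module through f *)
Definition restrict_scalars (A B : comNzRingType) (f : {rmorphism A -> B}) :
  Type := B.

Section RestrictionOfScalars.
Variables (A B : comNzRingType) (f : {rmorphism A -> B}).
Local Notation V := (restrict_scalars f).

HB.instance Definition _ := GRing.Zmodule.on V.

Definition restrict_scale (a : A) (b : V) : V :=
  f a * (b : B).

Fact restrict_scaleA a b x :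
  restrict_scale a (restrict_scale b x) = restrict_scale (a * b) x.
Proof. by rewrite /restrict_scale rmorphM mulrA. Qed.

Fact restrict_scale1 : left_id 1 restrict_scale.
Proof. by move=> x; rewrite /restrict_scale rmorph1 mul1r. Qed.

Fact restrict_scaleDr : right_distributive restrict_scale +%R.
Proof. by move=> a x y; rewrite /restrict_scale mulrDr. Qed.

Fact restrict_scaleDl x : {morph restrict_scale^~ x : a b / a + b}.
Proof. by move=> a b; rewrite /restrict_scale rmorphD mulrDl. Qed.

HB.instance Definition _ := GRing.Zmodule_isLmodule.Build A V
  restrict_scaleA restrict_scale1 restrict_scaleDr restrict_scaleDl.

End RestrictionOfScalars.

Section FiberProduct.
Variables (R S T : comNzRingType).
Variables (eR : {rmorphism R -> T}) (eS : {rmorphism S -> T}).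

Definition fiber_pred : {pred R * S} := [pred x | eR x.1 == eS x.2].

Fact fiber_subring : subring_closed fiber_pred.
Proof.
split=> [|x y|x y]; rewrite !inE ?rmorph1 // => /eqP hx /eqP hy /=.
  by rewrite !rmorphB hx hy.
by rewrite !rmorphM hx hy.
Qed.

HB.instance Definition _ :=
  GRing.isSubringClosed.Build (R * S)%type fiber_pred fiber_subring.

Record fiber_prod : Type :=
  FiberProd { fiber_val :> R * S; _ : fiber_val \in fiber_pred }.

HB.instance Definition _ := [isSub for fiber_val].
HB.instance Definition _ := [Choice of fiber_prod by <:].
HB.instance Definition _ := [SubChoice_isSubComNzRing of fiber_prod by <:].

Definition fiber_fst : {rmorphism fiber_prod -> R} := fst \o val.
Definition fiber_snd : {rmorphism fiber_prod -> S} := snd \o val.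
Definition fiber_base : {rmorphism fiber_prod -> T} := eR \o fiber_fst.

End FiberProduct.

Section HFunction.
Variables (K : realType) (A : comNzRingType) (p : nat) (s : K) (I J : set A).

(* The ideal I^{ceil (s p^e)} + J^[p^e] *)
Definition h_ideal (e : nat) : set A :=
  ideal_add (ideal_pow I `|Num.ceil (s * p%:R ^+ e)|%N)
            (frobenius_pow J (p ^ e)).

(* N / a N *)
Definition mod_quot (a : set A) (N : lmodType A) : lmodType A :=
  quot_mod [set x *: v | x in a & v in [set: N]].

Definition h_function (N : lmodType A) : K :=
  limn (fun e => (length (mod_quot (h_ideal e) N))%:R
                   / p%:R ^+ (e * krull_dim A) : K).

End HFunction.

(* Main.v *)
From HB Require Import structures.
Require Import Defs.
From mathcomp Require Import all_boot all_order all_algebra.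
From mathcomp Require Import all_classical all_reals all_analysis.
From mathcomp Require Import perm ring zify.

Set Implicit Arguments.
Unset Strict Implicit.
Unset Printing Implicit Defensive.

Import Order.TTheory GRing.Theory Num.Theory numFieldNormedType.Exports.

Local Open Scope classical_set_scope.
Local Open Scope ring_scope.

(* Write P for the fiber product, d for its dimension, a and b for the kernels of
   P -> R and P -> S, and a_e for I^{ceil(s p^e)} + J^{[p^e]}.  Since a /\ b = 0 and
   P / (a + b) = T, modularity of length gives
     l(P / a_e) + l(T / a_e T) = l(R / a_e R) + l(S / a_e S) + D_e,
   where D_e is the length of ((a_e + a) /\ (a_e + b)) / a_e.  So it is enough that
   all these lengths divided by p^{ed} converge, that D_e = O(p^{e(d-1)}), and that a
   quotient ring of dimension < d contributes O(p^{e(d-1)}).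

   The completion L of P is module-finite over a power series ring B = k[[x_1, ..., x_d]],
   and a subquotient of L / a_e L killed by a fixed nonzero element of B has length
   O(p^{e(d-1)}): everything only matters generically over B.  Let K = Frac B.  For n
   large the K-algebra E spanned by the p^n-th powers of L, acting on the generic module
   K^r, is equal to the span of its own p-th powers; hence it is reduced, and K^r is a
   semisimple E-module.  An E-linear projection separating a and b bounds D_e.  An
   E-compatible p-semilinear endomorphism u of K^r whose image spans K^r gives
   l(L / b_{e+1}) <= p^d l(L / b_e) + O(p^{e(d-1)}) for the ideals b_e generated by the
   p^n-th powers of I^{ceil(s p^e)} and of J^{[p^e]}.  So l(L / b_e) / p^{ed} converges,
   and b_e differs from a_{e+n} only by a subquotient killed by a fixed element. *)

(** * Lengths of chains *)

(** The map u takes their place: K^r is finite-dimensional over K whatever k is. The completion is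
    taken because it contains a coefficient field and hence a domain B over which it is finite;
    every nonzero element of B is then an admissible multiplier. In case (i) the ideal a + b lies in
    a prime with quotient of dimension d, so no element of a + b can serve to bound D_e; a
    projection is needed instead. Since P may be generically nonreduced, K^r cannot in general be
    split over L itself. High Frobenius powers remove the generic nilpotents, at the price that the
    projection and u are compatible only with E. Hence only ideals generated by p^n-th powers can be
    treated directly, and b_e has to be compared with a_{e+n}. Convergence is part of the work:
    [limn] is additive only on convergent sequences. *)

Lemma nat_maxP (X : set nat) (n : nat) : (exists m, X m) ->
  (forall m, X m -> (m <= n)%N) ->
  X (nat_max X) /\ forall m, X m -> (m <= nat_max X)%N.
Proof.
move=> [m0 Xm0] bX.
have ex : exists m, `[< X m >] by exists m0; apply/asboolP.
have ub m : `[< X m >] -> (m <= n)%N by move/asboolP; apply: bX.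
case: (ex_maxnP ex ub) => i /asboolP Xi maxi.
have := @xgetPex nat 0%N [set n | X n /\ forall m, X m -> (m <= n)%N].
apply; exists i; split=> // m Xm; apply: maxi; exact/asboolP.
Qed.

Section Chains.
Variables (V : Type) (S : set (set V)).
Implicit Types X Y Z W : set V.

(** Only the top is fixed; the bottom is any member of [S] containing [X]. Thus [X] need not be a
    member, and chains are widened or concatenated without adjusting their lower end. *)
Inductive lchain X : nat -> set V -> Prop :=
| Lchain0 Y : S Y -> X `<=` Y -> lchain X 0 Y
| LchainS n Y Z : lchain X n Y -> S Z -> Y `<=` Z -> Y <> Z ->
    lchain X n.+1 Z.

(** Carries finiteness of length: [len] takes the default value 0 of [nat_max] when chains are
    unbounded, so [len] alone proves no estimate. *)
Definition bnd X Y (n : nat) := forall m, lchain X m Y -> (m <= n)%N.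

Definition len X Y : nat := nat_max [set n | lchain X n Y].

Lemma lchain_top X n Y : lchain X n Y -> S Y /\ X `<=` Y.
Proof.
elim=> {n Y} [Y sY XY|n Y Z _ [sY XY] sZ YZ _]; split=> //.
exact: subset_trans YZ.
Qed.

Lemma lchain_widen X n Y Z : lchain X n Y -> S Z -> Y `<=` Z -> lchain X n Z.
Proof.
move=> h; case: h Z => {n Y} [Y sY XY|n Y W h sW YW nYW] Z sZ YZ.
  by apply: Lchain0 => //; exact: subset_trans YZ.
apply: LchainS h sZ _ _; first exact: subset_trans YZ.
by move=> E; apply: nYW; apply/seteqP; split=> //; rewrite E.
Qed.

Lemma lchain_cat X m Y n Z : lchain X m Y -> lchain Y n Z ->
  lchain X (m + n) Z.
Proof.
move=> h; elim=> {n Z} [Z sZ YZ|n Z W _ IH sW ZW nZW].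
  by rewrite addn0; exact: lchain_widen h sZ YZ.
by rewrite addnS; exact: LchainS IH sW ZW nZW.
Qed.

Lemma lchain_sub X n X' Y : lchain X n Y -> X' `<=` X -> lchain X' n Y.
Proof.
move=> h XX'; elim: h => {n Y} [Y sY XY|n Y Z _ IH sZ YZ nYZ].
  by apply: Lchain0 => //; exact: subset_trans XY.
exact: LchainS IH sZ YZ nYZ.
Qed.

Lemma lchain_leq X n Y m : lchain X n Y -> (m <= n)%N -> lchain X m Y.
Proof.
move=> h; elim: h m => {n Y} [Y sY XY|n Y Z h IH sZ YZ nYZ] m.
  by rewrite leqn0 => /eqP ->; exact: Lchain0.
rewrite leq_eqVlt => /orP[/eqP->|]; first exact: LchainS h sZ YZ nYZ.
by rewrite ltnS => /IH h'; exact: lchain_widen h' sZ YZ.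
Qed.

Lemma lchain_seq X n Y : lchain X n Y -> exists N : nat -> set V,
  [/\ forall i, (i <= n)%N -> S (N i), forall i, (i < n)%N -> N i `<` N i.+1,
      X `<=` N 0%N & N n = Y].
Proof.
elim=> {n Y} [Y sY XY|n Y Z _ [N [N1 N2 N3 N4]] sZ YZ nYZ].
  by exists (fun=> Y).
exists (fun i => if (i <= n)%N then N i else Z); split=> //.
- by move=> i _; case: ifP => // /N1.
- move=> i; rewrite ltnS => le_in; case: (ltngtP i n) le_in => // [lt_in|->] _.
    exact: N2.
  by rewrite N4; split=> // ZY; apply: nYZ; apply/seteqP; split.
- by rewrite ltnn.
Qed.

Lemma seq_lchain X n (N : nat -> set V) :
  (forall i, (i <= n)%N -> S (N i)) -> (forall i, (i < n)%N -> N i `<` N i.+1) ->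
  X `<=` N 0%N -> lchain X n (N n).
Proof.
elim: n => [|n IH] h1 h2 h3; first by apply: Lchain0 => //; exact: h1.
apply: LchainS (h1 _ (leqnn _)) _ _.
- by apply: IH => // i hi; [apply: h1; exact: leqW|apply: h2; exact: leqW].
- by have [] := h2 n (leqnn _).
- by have [_ h] := h2 n (leqnn _); move=> E; apply: h; rewrite E.
Qed.

Lemma bndW X Y m n : bnd X Y m -> (m <= n)%N -> bnd X Y n.
Proof. by move=> h mn k /h km; exact: leq_trans mn. Qed.

Lemma bnd_sub X Y X' Y' n : bnd X Y n -> X `<=` X' -> Y' `<=` Y -> S Y ->
  bnd X' Y' n.
Proof.
move=> h XX' YY' sY m hm; apply: h; apply: lchain_sub XX'.
exact: lchain_widen hm sY YY'.
Qed.

Lemma bnd0 X Y : Y `<=` X -> bnd X Y 0.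
Proof.
move=> YX m h; case: h YX => {m Y} // m W Z hW sZ WZ nWZ ZX; exfalso.
have [_ XW] := lchain_top hW; apply: nWZ.
by apply/seteqP; split=> //; exact: subset_trans XW.
Qed.

Lemma lenP X Y n : bnd X Y n -> S Y -> X `<=` Y ->
  lchain X (len X Y) Y /\ bnd X Y (len X Y).
Proof.
move=> b sY XY; have := @nat_maxP [set n | lchain X n Y] n.
by move=> h; apply: h => //; exists 0%N; exact: Lchain0.
Qed.

Lemma len_le X Y n : bnd X Y n -> S Y -> X `<=` Y -> (len X Y <= n)%N.
Proof. by move=> b sY XY; have [h _] := lenP b sY XY; exact: b h. Qed.

Lemma len_sub X Y X' Y' n : bnd X Y n -> X `<=` X' -> Y' `<=` Y ->
  S Y -> S Y' -> X' `<=` Y' -> (len X' Y' <= len X Y)%N.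
Proof.
move=> b XX' YY' sY sY' XY'.
have XY : X `<=` Y by apply: subset_trans YY'; exact: subset_trans XY'.
have [_ h] := lenP b sY XY.
by apply: len_le => //; exact: bnd_sub h XX' YY' sY.
Qed.

(* [J] is a join operation; only the stated form of modularity is used. *)
Lemma bnd_trans (J : set V -> set V -> set V) X Y Z a b :
  (forall W W', S W -> S W' -> S (W `&` W')) ->
  (forall W W', S W -> S W' -> S (J W W')) ->
  (forall W W', S W -> S W' -> W `<=` J W W' /\ W' `<=` J W W') ->
  (forall W W' U, S W -> S W' -> S U -> W `<=` U -> W' `<=` U ->
    J W W' `<=` U) ->
  (forall W W' U, S W -> S W' -> S U -> W `<=` W' -> W `&` U = W' `&` U ->
    J W U = J W' U -> W = W') ->
  S Y -> X `<=` Y -> S Z -> Y `<=` Z -> bnd X Y a -> bnd Y Z b -> bnd X Z (a + b).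
Proof.
move=> SI SJ Ju Jl Jm sY XY sZ YZ ba bb m hm.
(* Projecting a chain to the intervals below and above [Y] is monotone, and by modularity each
   strict step stays strict in at least one projection. *)
have claim W n : lchain X n W -> exists i j, [/\ (n <= i + j)%N,
    lchain X i (W `&` Y) & lchain Y j (J W Y)].
  elim=> {n W} [W sW XW|n W W' hW [i [j [nij hi hj]]] sW' WW' nWW'].
    exists 0%N, 0%N; split=> //; apply: Lchain0.
    - exact: SI.
    - by move=> x Xx; split; [exact: XW|exact: XY].
    - exact: SJ.
    - by have [] := Ju _ _ sW sY.
  have [sW _] := lchain_top hW.
  have IW : W `&` Y `<=` W' `&` Y by move=> x [Wx Yx]; split=> //; exact: WW'.
  have [J1 J2] := Ju _ _ sW' sY.
  have JW : J W Y `<=` J W' Y.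
    apply: Jl => //; first exact: SJ.
    exact: subset_trans J1.
  have [E|nE] := pselect (W `&` Y = W' `&` Y).
    exists i, j.+1; split; first by rewrite addnS.
      by rewrite -E.
    apply: LchainS hj (SJ _ _ sW' sY) JW _ => E'.
    exact: nWW' (Jm _ _ _ sW sW' sY WW' E E').
  exists i.+1, j; split; first by rewrite addSn.
    exact: LchainS hi (SI _ _ sW' sY) IW nE.
  exact: lchain_widen hj (SJ _ _ sW' sY) JW.
have [i [j [mij hi hj]]] := claim _ _ hm.
apply: leq_trans mij _; apply: leq_add.
  by apply: ba; apply: lchain_widen hi sY _; exact: subIsetr.
by apply: bb; apply: (lchain_widen hj sZ); exact: (Jl _ _ _ sZ sY sZ).
Qed.

End Chains.

(** A map that is monotone, and injective on nested members of the interval, keeps chains strict.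
    Comparisons of lengths, also between different rings, go through this. *)
Lemma lchain_map V V' (S : set (set V)) (S' : set (set V')) (f : set V -> set V')
    X Y X' : (forall W, S W -> X `<=` W -> W `<=` Y -> S' (f W)) ->
  (forall W, S W -> X `<=` W -> W `<=` Y -> X' `<=` f W) ->
  (forall W W', S W -> S W' -> X `<=` W -> W `<=` W' -> W' `<=` Y ->
    f W `<=` f W' /\ (f W = f W' -> W = W')) ->
  forall n W, W `<=` Y -> lchain S X n W -> lchain S' X' n (f W).
Proof.
move=> h1 h2 h3 n W WY h; elim: h WY => {n W} [W sW XW|n W W' hW IH sW' WW' nWW'] WY.
  by apply: Lchain0; [exact: h1|exact: h2].
have [sW XW] := lchain_top hW.
have [f1 f2] := h3 _ _ sW sW' XW WW' WY.
apply: LchainS (IH _) _ f1 _; first exact: subset_trans WY.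
  by apply: h1 => //; exact: subset_trans WW'.
by move/f2.
Qed.

Section GroupFamily.
Variables (V : zmodType) (S : set (set V)).

Definition sgrp (X : set V) := X 0 /\ forall x y, X x -> X y -> X (x - y).

Lemma sgrpN X x : sgrp X -> X x -> X (- x).
Proof. by move=> [X0 Xs] Xx; rewrite -sub0r; exact: Xs. Qed.

Lemma sgrpD X x y : sgrp X -> X x -> X y -> X (x + y).
Proof.
by move=> gX Xx Xy; rewrite -[y]opprK; apply: gX.2 => //; exact: sgrpN.
Qed.

Definition addset (X Y : set V) : set V := [set x + y | x in X & y in Y].

Hypothesis Sg : forall X, S X -> sgrp X.
Hypothesis SI : forall X Y, S X -> S Y -> S (X `&` Y).
Hypothesis SA : forall X Y, S X -> S Y -> S (addset X Y).
Implicit Types X Y Z W : set V.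

Lemma addset_subl X Y : Y 0 -> X `<=` addset X Y.
Proof. by move=> Y0 x Xx; exists x => //; exists 0 => //; rewrite addr0. Qed.

Lemma addset_subr X Y : X 0 -> Y `<=` addset X Y.
Proof. by move=> X0 y Yy; exists 0 => //; exists y => //; rewrite add0r. Qed.

Lemma addset_least X Y Z : sgrp Z -> X `<=` Z -> Y `<=` Z -> addset X Y `<=` Z.
Proof.
move=> gZ XZ YZ _ [x Xx [y Yy <-]]; apply: sgrpD => //; [exact: XZ|exact: YZ].
Qed.

Lemma addset_mono X Y X' Y' : X `<=` X' -> Y `<=` Y' ->
  addset X Y `<=` addset X' Y'.
Proof.
move=> XX YY _ [x Xx [y Yy <-]].
by exists x; [exact: XX|exists y => //; exact: YY].
Qed.

Lemma bndD X Y Z a b : S Y -> X `<=` Y -> S Z -> Y `<=` Z ->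
  bnd S X Y a -> bnd S Y Z b -> bnd S X Z (a + b).
Proof.
apply: (@bnd_trans _ _ addset) => //.
- move=> W W' /Sg[W0 _] /Sg[W'0 _].
  by split; [exact: addset_subl|exact: addset_subr].
- by move=> W W' U _ _ /Sg; exact: addset_least.
- move=> W W' U sW sW' sU WW' EI EA; apply/seteqP; split=> // x W'x.
  have [U0 _] := Sg sU.
  have : addset W U x by rewrite EA; exact: addset_subl.
  case=> w Ww [u Uu E].
  have : (W' `&` U) u.
    split=> //; rewrite (_ : u = x - w); last by rewrite -E addrC addKr.
    by apply: (Sg sW').2 => //; exact: WW'.
  by rewrite -EI -E => -[Wu _]; apply: sgrpD => //; exact: Sg.
Qed.

Lemma lenD X Y Z n : S X -> S Y -> X `<=` Y -> S Z -> Y `<=` Z -> bnd S X Z n ->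
  len S X Z = (len S X Y + len S Y Z)%N.
Proof.
move=> sX sY XY sZ YZ b.
have XZ := subset_trans XY YZ.
have bXY : bnd S X Y n by exact: bnd_sub b _ YZ sZ.
have bYZ : bnd S Y Z n by exact: bnd_sub b XY _ sZ.
have [h1 b1] := lenP bXY sY XY; have [h2 b2] := lenP bYZ sZ YZ.
have [h3 b3] := lenP b sZ XZ.
apply/eqP; rewrite eqn_leq; apply/andP; split.
  exact: (bndD sY XY sZ YZ b1 b2).
exact: b3 (lchain_cat h1 h2).
Qed.

(** Second isomorphism theorem: intersecting with [Y] and adding [X] are strict maps between the
    intervals from [X] to [X + Y] and from the intersection to [Y]. *)
Lemma len_modular X Y n : S X -> S Y -> S setT -> bnd S (X `&` Y) setT n ->
  (len S X setT + len S Y setT =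
   len S (X `&` Y) setT + len S (addset X Y) setT)%N.
Proof.
move=> sX sY sT b.
have sI := SI sX sY; have sA := SA sX sY.
have [X0 _] := Sg sX; have [Y0 _] := Sg sY.
have XA := @addset_subl X Y Y0; have YA := @addset_subr X Y X0.
have IX : X `&` Y `<=` X by move=> x [].
have IY : X `&` Y `<=` Y by move=> x [].
have bX : bnd S X setT n by exact: bnd_sub b _ _ sT.
have bY : bnd S Y setT n by exact: bnd_sub b _ _ sT.
rewrite (lenD sX sA XA sT _ bX) // (lenD sI sY IY sT _ b) //.
suff -> : len S X (addset X Y) = len S (X `&` Y) Y by lia.
have b1 : bnd S X (addset X Y) n by exact: bnd_sub b _ _ sT.
have b2 : bnd S (X `&` Y) Y n by exact: bnd_sub b _ _ sT.
have [h1 m1] := lenP b1 sA XA; have [h2 m2] := lenP b2 sY IY.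
apply/eqP; rewrite eqn_leq; apply/andP; split.
  apply: m2.
  have : addset X Y `&` Y = Y by apply/seteqP; split=> [x []|x Yx] //; split=> //; exact: YA.
  move=> EY.
  suff : lchain S (X `&` Y) (len S X (addset X Y)) (addset X Y `&` Y) by rewrite EY.
  apply: (@lchain_map _ _ S S (fun W => W `&` Y) X (addset X Y)) => //.
  - by move=> W sW _ _; exact: SI.
  - by move=> W _ XW _ x [Xx Yx]; split=> //; exact: XW.
  - move=> W W' sW sW' XW WW' W'A; split=> [x [Wx Yx]|E].
      by split=> //; exact: WW'.
    apply/seteqP; split=> // z W'z; have [x Xx [y Yy Ez]] := W'A _ W'z.
    have : (W' `&` Y) y.
      split=> //; rewrite (_ : y = z - x); last by rewrite -Ez addrC addKr.
      by apply: (Sg sW').2 => //; apply: WW'; exact: XW.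
    rewrite -E => -[Wy _]; rewrite -Ez; apply: sgrpD => //; first exact: Sg.
    exact: XW.
apply: m1.
apply: (@lchain_map _ _ S S (fun W => addset X W) (X `&` Y) Y) => //.
- by move=> W sW _ _; exact: SA.
- by move=> W sW _ _; apply: addset_subl; have [] := Sg sW.
- move=> W W' sW sW' IW WW' W'Y; split; first exact: addset_mono.
  move=> E; apply/seteqP; split=> // w W'w.
  have : addset X W w by rewrite E; exact: addset_subr.
  case=> x Xx [v Wv Ew]; rewrite -Ew; apply: sgrpD => //; first exact: Sg.
  apply: IW; split=> //; rewrite (_ : x = w - v); last by rewrite -Ew addrK.
  by apply: (Sg sY).2; [exact: W'Y|apply: W'Y; exact: WW'].
Qed.

End GroupFamily.

Section Transport.
Variables (V V' : zmodType) (S : set (set V)) (S' : set (set V')).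
Variable (f : {additive V -> V'}).
Hypothesis Sg : forall X, S X -> sgrp X.
Hypothesis Sg' : forall X, S' X -> sgrp X.

(** Every element of [Y'] is an element of [X'] plus a value of [f], so a submodule between [X'] and
    [Y'] is recovered from its preimage. *)
Lemma bnd_preim (X' Y' : set V') n : (forall W, S' W -> S (f @^-1` W)) ->
  (forall y, Y' y -> exists2 x, X' x & exists v, y = x + f v) ->
  bnd S (f @^-1` X') (f @^-1` Y') n -> bnd S' X' Y' n.
Proof.
move=> Sf YX b m hm; apply: b.
apply: (@lchain_map _ _ S' S (fun W => f @^-1` W) X' Y') => //.
- by move=> W sW _ _; exact: Sf.
- by move=> W _ XW _ v; exact: XW.
- move=> W W' sW sW' XW WW' W'Y; split=> [v|E]; first exact: WW'.
  apply/seteqP; split=> // y W'y; have [x Xx [v Ey]] := YX _ (W'Y _ W'y).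
  have : (f @^-1` W') v.
    rewrite /= (_ : f v = y - x); last by rewrite Ey addrC addKr.
    by apply: (Sg' sW').2 => //; apply: WW'; exact: XW.
  by rewrite -E /= => Wv; rewrite Ey; apply: sgrpD => //; [exact: Sg'|exact: XW].
Qed.

(** The kernel of [f] lies in [X], so submodules above [X] are recovered from their images. *)
Lemma bnd_img (X Y : set V) n : (forall W, S W -> S' (f @` W)) ->
  (forall x, f x = 0 -> X x) ->
  bnd S' (f @` X) (f @` Y) n -> bnd S X Y n.
Proof.
move=> Sf fX b m hm; apply: b.
apply: (@lchain_map _ _ S S' (fun W => f @` W) X Y) => //.
- by move=> W sW _ _; exact: Sf.
- by move=> W _ XW _ _ [x Xx <-]; exists x => //; exact: XW.
- move=> W W' sW sW' XW WW' W'Y; split=> [|E]; first exact: image_subset.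
  apply/seteqP; split=> // y W'y.
  have : (f @` W) (f y) by rewrite E; exists y.
  case=> x Wx fxy; rewrite -(subrK x y) addrC; apply: sgrpD => //; first exact: Sg.
  by apply/XW/fX; rewrite raddfB /= fxy subrr.
Qed.

End Transport.

(** * Submodules and ideals *)

Section Submodules.
Variables (B L : comNzRingType) (beta : {rmorphism B -> L}).
Implicit Types X Y Z : set L.

(** One notion for the [B]-submodules of [L] and, with [idfun] for [beta], for ideals; lengths over
    [B] and over [L] then obey the same lemmas. *)
Definition subm X := [/\ X 0, forall x y, X x -> X y -> X (x + y)
                       & forall b x, X x -> X (beta b * x)].

Lemma subm_sgrp X : subm X -> sgrp X.
Proof.
move=> [X0 Xd Xm]; split=> // x y Xx Xy; apply: Xd => //.
by rewrite -mulN1r -(rmorph1 beta) -rmorphN; exact: Xm.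
Qed.

Lemma submI X Y : subm X -> subm Y -> subm (X `&` Y).
Proof.
move=> [X0 Xd Xm] [Y0 Yd Ym]; split=> //.
- by move=> x y [? ?] [? ?]; split; [exact: Xd|exact: Yd].
- by move=> b x [? ?]; split; [exact: Xm|exact: Ym].
Qed.

Lemma submA X Y : subm X -> subm Y -> subm (addset X Y).
Proof.
move=> [X0 Xd Xm] [Y0 Yd Ym]; split.
- by exists 0 => //; exists 0 => //; rewrite addr0.
- move=> _ _ [x Xx [y Yy <-]] [x' Xx' [y' Yy' <-]].
  by exists (x + x'); [exact: Xd|exists (y + y'); [exact: Yd|rewrite addrACA]].
- move=> b _ [x Xx [y Yy <-]].
  by exists (beta b * x); [exact: Xm|exists (beta b * y); [exact: Ym|rewrite mulrDr]].
Qed.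

Lemma submT : subm setT. Proof. by []. Qed.

Definition sspan X : set L := [set z | forall Y, subm Y -> X `<=` Y -> Y z].

Lemma sspan_subm X : subm (sspan X).
Proof.
split.
- by move=> Y [].
- by move=> x y hx hy Y sY XY; have [_ Yd _] := sY; apply: Yd; [exact: hx|exact: hy].
- by move=> b x hx Y sY XY; have [_ _ Ym] := sY; apply: Ym; exact: hx.
Qed.

Lemma sub_sspan X : X `<=` sspan X. Proof. by move=> x Xx Y _; exact. Qed.

Lemma sspan_least X Y : subm Y -> X `<=` Y -> sspan X `<=` Y.
Proof. by move=> sY XY z; exact. Qed.

Lemma sspan_mono X Y : X `<=` Y -> sspan X `<=` sspan Y.
Proof.
move=> XY; apply: sspan_least; first exact: sspan_subm.
exact: subset_trans (@sub_sspan Y).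
Qed.

Lemma subm_sum X (I : Type) (r : seq I) (P : pred I) (F : I -> L) :
  subm X -> (forall i, P i -> X (F i)) -> X (\sum_(i <- r | P i) F i).
Proof. by move=> [X0 Xd _] h; elim/big_ind: _ => //. Qed.

Lemma subm_lin X (I : Type) (r : seq I) (P : pred I) (c : I -> B) (F : I -> L) :
  subm X -> (forall i, P i -> X (F i)) ->
  X (\sum_(i <- r | P i) beta (c i) * F i).
Proof.
by move=> sX h; apply: subm_sum => // i Pi; have [_ _ Xm] := sX; apply: Xm; exact: h.
Qed.

Lemma sspan_seqP (s : seq L) z : sspan [set` s] z <->
  exists c : nat -> B, z = \sum_(i < size s) beta (c i) * s`_i.
Proof.
split=> [|[c ->]]; last first.
  apply: subm_lin; first exact: sspan_subm.
  by move=> i _; apply: sub_sspan => /=; exact: mem_nth.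
move=> h; apply: (h [set z | exists c : nat -> B, z = \sum_(i < size s) beta (c i) * s`_i]).
- split.
  + by exists (fun=> 0); rewrite big1 // => i _; rewrite rmorph0 mul0r.
  + move=> _ _ [c ->] [d ->]; exists (fun i => c i + d i).
    by rewrite -big_split; apply: eq_bigr => i _; rewrite rmorphD mulrDl.
  + move=> b _ [c ->]; exists (fun i => b * c i).
    by rewrite mulr_sumr; apply: eq_bigr => i _; rewrite rmorphM mulrA.
- move=> x /= xs; exists (fun i => (i == index x s)%:R).
  have lt : (index x s < size s)%N by rewrite index_mem.
  rewrite (bigD1 (Ordinal lt)) //= eqxx rmorph1 mul1r nth_index // big1 ?addr0 //.
  move=> i; rewrite -val_eqE /= => /negbTE ->; by rewrite rmorph0 mul0r.
Qed.

Definition cyc (z : L) : set L := [set beta b * z | b in setT].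

Lemma cyc_subm z : subm (cyc z).
Proof.
split.
- by exists 0 => //; rewrite rmorph0 mul0r.
- by move=> _ _ [b _ <-] [b' _ <-]; exists (b + b') => //; rewrite rmorphD mulrDl.
- by move=> b _ [b' _ <-]; exists (b * b') => //; rewrite rmorphM mulrA.
Qed.

Lemma cyc_id z : cyc z z.
Proof. by exists 1 => //; rewrite rmorph1 mul1r. Qed.

Lemma sspan_cons X z : subm X -> sspan (X `|` [set z]) `<=` addset X (cyc z).
Proof.
move=> sX; apply: sspan_least; first by apply: submA => //; exact: cyc_subm.
move=> x [Xx|->].
  by apply: addset_subl => //; have [] := cyc_subm z.
by apply: addset_subr; [have [] := sX|exact: cyc_id].
Qed.

(** Modulo [X], a scalar either kills [z] or can be undone on it, so every nonzero submodule of
    [(X + B z) / X] contains [z]: the quotient is simple or zero. *)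
Lemma bnd_cyc X z : subm X ->
  (forall b, X (beta b * z) \/ exists b', X (beta (b' * b) * z - z)) ->
  bnd subm X (addset X (cyc z)) 1.
Proof.
move=> sX h m hm; rewrite leqNgt; apply/negP => /(lchain_leq hm) {hm}.
move E : (addset X (cyc z)) => C; move E2 : 2%N => n h2.
case: n C / h2 E E2 => // n W1 W2 h1 sW2 W12 nW12 E [] E2.
case: n W1 / h1 E2 W12 nW12 => // n W0 W1 h0 sW1 W01 nW01 _ W12 nW12.
have [sW0 XW0] := lchain_top h0.
have [w W1w nW0w] : exists2 w, W1 w & ~ W0 w.
  apply: contrapT => nh; apply: nW01; apply/seteqP; split=> // w W1w.
  by apply: contrapT => nw; apply: nh; exists w.
have XW1 := subset_trans XW0 W01.
have : addset X (cyc z) w by rewrite E; exact: W12.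
case=> x Xx [_ [b _ <-] Ew].
have [Xbz|[b' Xbz]] := h b.
  apply: nW0w; rewrite -Ew; have [_ Wd _] := sW0.
  by apply: Wd; exact: XW0.
apply: nW12; apply/seteqP; split=> //; rewrite -E.
apply: addset_least => //; first exact: subm_sgrp.
have [W10 W1d W1m] := sW1; have gW1 := subm_sgrp sW1.
suff W1z : W1 z by move=> _ [c _ <-]; exact: W1m.
have W1bz : W1 (beta b * z).
  by rewrite (_ : _ * z = w - x); [apply: gW1.2 => //; exact: XW1|rewrite -Ew addrC addKr].
rewrite (_ : z = beta (b' * b) * z - (beta (b' * b) * z - z)); last first.
  by rewrite opprB addrCA subrr addr0.
by apply: gW1.2; [rewrite rmorphM -mulrA; exact: W1m|exact: XW1].
Qed.

Lemma subm_bndD X Y Z a b : subm Y -> X `<=` Y -> subm Z -> Y `<=` Z ->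
  bnd subm X Y a -> bnd subm Y Z b -> bnd subm X Z (a + b).
Proof. by apply: bndD; [exact: subm_sgrp|exact: submI|exact: submA]. Qed.

Lemma subm_lenD X Y Z n : subm X -> subm Y -> X `<=` Y -> subm Z -> Y `<=` Z ->
  bnd subm X Z n -> len subm X Z = (len subm X Y + len subm Y Z)%N.
Proof. by apply: lenD; [exact: subm_sgrp|exact: submI|exact: submA]. Qed.

Lemma bnd_addset X Y n : subm X -> subm Y -> bnd subm (X `&` Y) Y n ->
  bnd subm X (addset X Y) n.
Proof.
move=> sX sY b m hm; apply: b.
have EY : addset X Y `&` Y = Y.
  apply/seteqP; split=> [x []|x Yx] //; split=> //.
  by apply: addset_subr => //; have [] := sX.
suff : lchain subm (X `&` Y) m (addset X Y `&` Y) by rewrite EY.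
apply: (@lchain_map _ _ subm subm (fun W => W `&` Y) X (addset X Y)) => //.
- by move=> W sW _ _; exact: submI.
- by move=> W _ XW _ x [Xx Yx]; split=> //; exact: XW.
- move=> W W' sW sW' XW WW' W'A; split=> [x [Wx Yx]|E]; first by split=> //; exact: WW'.
  apply/seteqP; split=> // z W'z; have [x Xx [y Yy Ez]] := W'A _ W'z.
  have : (W' `&` Y) y.
    split=> //; rewrite (_ : y = z - x); last by rewrite -Ez addrC addKr.
    by apply: (subm_sgrp sW').2 => //; apply: WW'; exact: XW.
  rewrite -E => -[Wy _]; rewrite -Ez; have [_ Wd _] := sW; apply: Wd => //.
  exact: XW.
Qed.

End Submodules.

Notation idl A := (@subm A A idfun).
Notation isp := (@sspan _ _ idfun).
Notation lam X := (len (@subm _ _ idfun) X setT).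

Section Ideals.
Variable A : comNzRingType.
Implicit Types X Y Z : set A.

Lemma idlP X : ideal X <-> idl A X.
Proof.
split=> [[/set_mem X0 Xl]|[X0 Xd Xm]].
  split=> //.
    by move=> x y /mem_set hx /mem_set hy; rewrite -[x]mul1r; exact/set_mem/(Xl 1).
  move=> a x /mem_set hx /=; rewrite -[_ * _]addr0.
  by apply/set_mem/(Xl a x 0) => //; exact: mem_set.
split; first exact: mem_set.
by move=> a x y /set_mem hx /set_mem hy; apply/mem_set/Xd => //; exact: Xm.
Qed.

Lemma ideal_spanE X : ideal_span X = isp X.
Proof.
apply/seteqP; split=> z hz.
  by move=> Y sY XY; apply: (hz Y); split=> //; exact/idlP.
by move=> Y [/idlP sY XY]; exact: hz.
Qed.

Lemma ideal_addE X Y : ideal_add X Y = addset X Y. Proof. by []. Qed.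

Lemma idlM X a x : idl A X -> X x -> X (a * x).
Proof. by move=> [_ _ Xm]; exact: Xm. Qed.

Lemma idlMr X a x : idl A X -> X x -> X (x * a).
Proof. by rewrite mulrC; exact: idlM. Qed.

Lemma idlT X : idl A X -> X 1 -> X = setT.
Proof. by move=> iX X1; apply/seteqP; split=> // a _; rewrite -[a]mulr1; exact: idlM. Qed.

Definition colon X g : set A := [set y | X (g * y)].

Lemma colon_idl X g : idl A X -> idl A (colon X g).
Proof.
move=> [X0 Xd Xm]; split; rewrite /colon /=; first by rewrite mulr0.
- by move=> x y; rewrite mulrDr; exact: Xd.
- by move=> a x Xx; rewrite mulrCA; exact: Xm.
Qed.

(* Multiplication by [g] on [A / X] has kernel [(X : g) / X] and cokernel
   [A / (X + g A)], which have the same length. *)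
Lemma len_killed X Y g n : idl A X -> idl A Y -> X `<=` Y ->
  (forall y, Y y -> X (g * y)) -> bnd (idl A) X setT n ->
  (len (idl A) X Y <= lam (addset X (cyc idfun g)))%N.
Proof.
move=> iX iY XY gY b.
have iC := colon_idl g iX; set C := colon X g in iC.
have iG := cyc_subm idfun g; set G := cyc _ _ in iG *.
have iXG := submA iX iG.
have XC : X `<=` C by move=> x; exact: idlM.
have XXG : X `<=` addset X G by apply: addset_subl; have [] := iG.
have YC : Y `<=` C by exact: gY.
have iT := submT (@idfun A).
have bC : bnd (idl A) X C n by exact: bnd_sub b _ _ iT.
apply: leq_trans (len_sub bC _ YC iC iY XY) _ => //.
have E1 := subm_lenD iX iC XC iT (@subsetT _ _) b.
have E2 := subm_lenD iX iXG XXG iT (@subsetT _ _) b.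
suff : (len (idl A) X (addset X G) <= lam C)%N by move: E1 E2; lia.
apply: len_le => //.
have bCT : bnd (idl A) C setT n by exact: bnd_sub b _ _ iT.
have [_ h] := lenP bCT iT (@subsetT _ _).
apply: (@bnd_preim _ _ (idl A) (idl A) (GRing.mull_fun g (idfun : {additive A -> A}))).
- exact: subm_sgrp.
- by move=> W; exact: colon_idl.
- by move=> _ [x Xx [_ [a _ <-] <-]]; exists x => //; exists a; rewrite /= mulrC.
- apply: bnd_sub h _ _ iT => //.
Qed.

(** Multiplication by [x^i] maps [A / (Z + x A)] onto [(Z + x^i A) / (Z + x^(i+1) A)]; there are [N]
    such layers. *)
Lemma bnd_pow Z x n N : idl A Z -> bnd (idl A) (isp (Z `|` [set x])) setT n ->
  bnd (idl A) (isp (Z `|` [set x ^+ N])) setT (N * n).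
Proof.
move=> iZ b; elim: N => [|N IH].
  rewrite expr0 mul0n; apply: bnd0; rewrite (@idlT (isp _)) //.
    exact: sspan_subm.
  by apply: sub_sspan; right.
rewrite mulSn; apply: (@subm_bndD _ _ idfun _ (isp (Z `|` [set x ^+ N]))) => //.
- exact: sspan_subm.
- apply: sspan_least; first exact: sspan_subm.
  move=> y [Zy|->]; first by apply: sub_sspan; left.
  rewrite exprS; apply: (@idlM (isp _)); first exact: sspan_subm.
  by apply: sub_sspan; right.
apply: (@bnd_preim _ _ (idl A) (idl A) (GRing.mull_fun (x ^+ N) (idfun : {additive A -> A}))).
- exact: subm_sgrp.
- by move=> W; exact: colon_idl.
- move=> y /(sspan_cons iZ)[z Zz [_ [a _ <-] <-]]; exists z; last first.
    by exists a; rewrite /= mulrC.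
  by apply: sub_sspan; left.
- apply: bnd_sub b _ _ _ => //.
  apply: sspan_least; first by apply: colon_idl; exact: sspan_subm.
  move=> y [Zy|->] /=.
    by apply: (@idlM (isp _)); [exact: sspan_subm|apply: sub_sspan; left].
  by rewrite -exprSr; apply: sub_sspan; right.
Qed.

(** The generators are replaced by their powers one at a time, each at the cost of a factor [N]. *)
Lemma bnd_pows Z (s : seq A) n N : idl A Z ->
  bnd (idl A) (isp (Z `|` [set` s])) setT n ->
  bnd (idl A) (isp (Z `|` [set x ^+ N | x in [set` s]])) setT (N ^ size s * n).
Proof.
elim: s Z n => [|x s IH] Z n iZ b.
  rewrite expn0 mul1n; apply: bnd_sub b _ _ _ => //.
  by apply: sspan_mono => y [Zy|//]; left.
rewrite /= expnS -mulnA.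
set Z1 := isp (Z `|` [set x]).
have b1 : bnd (idl A) (isp (Z1 `|` [set` s])) setT n.
  apply: bnd_sub b _ _ _ => //; apply: sspan_mono.
  move=> y [Zy|]; first by left; apply: sub_sspan; left.
  rewrite /= inE => /orP[/eqP->|ys]; last by right.
  by left; apply: sub_sspan; right.
have {b1} := IH _ _ (sspan_subm _ _) b1.
set Z2 := isp (Z `|` [set x ^+ N | x in [set` s]]) => b2.
have b3 : bnd (idl A) (isp (Z2 `|` [set x])) setT (N ^ size s * n).
  apply: bnd_sub b2 _ _ _ => //; apply: sspan_least; first exact: sspan_subm.
  move=> y [].
    apply: sspan_least; first exact: sspan_subm.
    move=> w [Zw|->]; last by apply: sub_sspan; right.
    by apply: sub_sspan; left; apply: sub_sspan; left.
  by move=> sy; apply: sub_sspan; left; apply: sub_sspan; right.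
have iZ2 : idl A Z2 by exact: sspan_subm.
have b4 := @bnd_pow Z2 x _ N iZ2 b3.
apply: bnd_sub b4 _ _ _ => //.
apply: sspan_least; first exact: sspan_subm.
move=> y [|->].
  apply: sspan_mono => w [Zw|[v sv <-]]; first by left.
  by right; exists v => //=; rewrite inE; apply/orP; right.
by apply: sub_sspan; right; exists x => //=; rewrite inE eqxx.
Qed.

Definition imul X Y := isp [set x * y | x in X & y in Y].

Fixpoint ipow X n : set A := if n is n'.+1 then imul X (ipow X n') else setT.

Lemma imul_idl X Y : idl A (imul X Y). Proof. exact: sspan_subm. Qed.

Lemma ipow_idl X n : idl A (ipow X n).
Proof. by case: n => [|n] //=; exact: imul_idl. Qed.

Lemma imul_in X Y x y : X x -> Y y -> imul X Y (x * y).
Proof. by move=> Xx Yy; apply: sub_sspan; exists x => //; exists y. Qed.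

Lemma imul_sub X Y : idl A Y -> imul X Y `<=` Y.
Proof. by move=> iY; apply: sspan_least => // _ [x _ [y Yy <-]]; exact: idlM. Qed.

Lemma ipowS_sub X n : ipow X n.+1 `<=` ipow X n.
Proof. by apply: imul_sub; exact: ipow_idl. Qed.

Lemma ipow_anti X m n : (m <= n)%N -> ipow X n `<=` ipow X m.
Proof.
move=> /subnK <-; elim: (n - m)%N => [|k IH] //=.
by apply: subset_trans IH; exact: ipowS_sub.
Qed.

Lemma ipowM X m n x y : ipow X m x -> ipow X n y -> ipow X (m + n) (x * y).
Proof.
elim: m x y => [|m IH] x y; first by move=> _; apply: (@idlM (ipow _ _)); exact: ipow_idl.
move=> hx hy; rewrite addSn /=.
have [i0 id im] := imul_idl X (ipow X (m + n)).
have : [set z | imul X (ipow X (m + n)) (z * y)] x.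
  apply: hx; first split=> /=.
  - by rewrite mul0r.
  - by move=> u v hu hv; rewrite mulrDl; exact: id.
  - by move=> a u hu; rewrite -mulrA; exact: im.
  - by move=> _ [u Xu [v Xv <-]] /=; rewrite -mulrA; apply: imul_in => //; exact: IH.
by [].
Qed.

Lemma ipowX X n x : X x -> ipow X n (x ^+ n).
Proof. by move=> Xx; elim: n => [|n IH] //; rewrite exprS /=; exact: imul_in. Qed.

Lemma ipow1 X : idl A X -> ipow X 1 = X.
Proof.
move=> iX; apply/seteqP; split=> [|x Xx] /=.
  by apply: sspan_least => // _ [x Xx [y _ <-]]; exact: idlMr.
by rewrite -[x]mulr1; exact: imul_in.
Qed.

Lemma ideal_powE X n : ideal_pow X n = ipow X n.
Proof.
rewrite /ideal_pow ideal_spanE; apply/seteqP; split.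
  apply: sspan_least; first exact: ipow_idl.
  move=> _ [f fX ->]; elim: n f fX => [|n IH] f fX; first by rewrite big_ord0.
  by rewrite big_ord_recl /=; apply: imul_in => //; apply: IH.
elim: n => [|n IH].
  move=> z _; rewrite -[z]mulr1; apply: (@idlM (isp _)); first exact: sspan_subm.
  by apply: sub_sspan; exists (fun=> 0) => [[]|] //; rewrite big_ord0.
apply: sspan_least; first exact: sspan_subm.
move=> _ [x Xx [y Yy <-]].
set Z := isp _.
have iZ : idl A Z by exact: sspan_subm.
have : [set z | Z (x * z)] y.
  apply: (sspan_least _ _ (IH _ Yy)); first exact: (colon_idl x iZ).
  move=> _ [f fX ->] /=; apply: sub_sspan.
  exists (fun i => oapp f x (unlift ord0 i)).
    by move=> i; case: unliftP => [j|] _ //=.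
  rewrite big_ord_recl unlift_none /=; congr (_ * _).
  by apply: eq_bigr => i _; rewrite liftK.
by [].
Qed.

End Ideals.

(** * Noetherian rings and Krull dimension *)

Section Noetherian.
Variable A : comNzRingType.
Implicit Types (X Y Z M Q : set A).

Definition fin_gen := forall X, idl A X -> exists s : seq A, X = isp [set` s].

Lemma noetherianP : noetherian A -> fin_gen.
Proof.
by move=> nA X /idlP /nA [s ->]; exists s; rewrite ideal_spanE.
Qed.

Hypothesis nA : fin_gen.

Lemma noeth_max (P : set (set A)) X0 : idl A X0 -> P X0 ->
  exists X, [/\ idl A X, P X & forall Y, idl A Y -> P Y -> X `<=` Y -> Y `<=` X].
Proof.
move=> iX0 PX0; apply: contrapT => nmax.
have step (U : {X | idl A X /\ P X}) : exists U' : {X | idl A X /\ P X},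
    sval U `<=` sval U' /\ ~ (sval U' `<=` sval U).
  case: U => X [iX PX] /=; apply: contrapT => nU; apply: nmax.
  exists X; split=> // Y iY PY XY; apply: contrapT => nYX; apply: nU.
  by exists (exist _ Y (conj iY PY)).
have [f fP] := choice step.
pose U n := iter n f (exist _ X0 (conj iX0 PX0)).
have Umono m n : (m <= n)%N -> sval (U m) `<=` sval (U n).
  move=> /subnK <-; elim: (n - m)%N => [|k IH] //.
  by apply: subset_trans IH _; have [] := fP (U (k + m)%N).
(* The union of the increasing sequence has finitely many generators, all lying in one [U n]; so
   [U n.+1] cannot be larger. *)
pose W := [set z | exists n, sval (U n) z].
have iW : idl A W.
  split.
  - by exists 0%N; have [] := iX0.
  - move=> x y [m hm] [n hn]; exists (maxn m n).
    have [_ Ud _] := (svalP (U (maxn m n))).1.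
    by apply: Ud; [exact: (Umono _ _ (leq_maxl m n))|exact: (Umono _ _ (leq_maxr m n))].
  - by move=> a x [n hn]; exists n; have [_ _ Um] := (svalP (U n)).1; exact: Um.
have [s Es] := nA iW.
have [n hn] : exists n, forall x, x \in s -> sval (U n) x.
  have : forall x, x \in s -> W x by move=> x xs; rewrite Es; exact: sub_sspan.
  elim: (s) => [|y t IH] ht; first by exists 0%N.
  have [n hn] := IH (fun x hx => ht x (@mem_behead _ (y :: t) x hx)).
  have [m hm] := ht y (mem_head _ _).
  exists (maxn m n) => x; rewrite inE => /orP[/eqP->|/hn].
    exact: (Umono _ _ (leq_maxl m n)).
  exact: (Umono _ _ (leq_maxr m n)).
have [_] := fP (U n); apply.
move=> z hz; have : W z by exists n.+1.
rewrite Es => /(sspan_least (svalP (U n)).1); apply.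
by move=> x /= /hn.
Qed.

Definition pidl Q := [/\ idl A Q, ~ Q 1 & forall x y, Q (x * y) -> Q x \/ Q y].

Lemma prime_idealP Q : prime_ideal Q <-> pidl Q.
Proof.
split=> [[[/set_mem Q0 Q1 Ql] Qp]|[iQ Q1 Qp]].
  have Ql' a x y : Q x -> Q y -> Q (a * x + y).
    by move=> hx hy; apply/set_mem/Ql; exact: mem_set.
  split.
  - split=> // [x y hx hy|a x hx /=]; first by rewrite -[x]mul1r; exact: Ql'.
    by rewrite -[a * x]addr0; exact: Ql'.
  - by move=> h; move: Q1; rewrite mem_set.
  - by move=> x y /mem_set /Qp /orP[] /set_mem; [left|right].
have [Q0 Qd Qm] := iQ; split.
  split; first exact: mem_set.
    by apply/negP => /set_mem.
  by move=> a x y /set_mem hx /set_mem hy; apply/mem_set/Qd => //; exact: Qm.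
by move=> x y /set_mem /Qp [] /mem_set -> //; rewrite orbT.
Qed.

(** An ideal maximal among those above [X] and disjoint from [S] is prime: for [x] and [y] outside
    it, [S] contains some [a + b x] and [c + d y] with [a], [c] in [Q], and [x y] in [Q] would put
    their product in [Q]. *)
Lemma prime_avoiding (S : set A) X : S 1 ->
  (forall x y, S x -> S y -> S (x * y)) -> idl A X -> (forall x, X x -> ~ S x) ->
  exists Q, [/\ pidl Q, X `<=` Q & forall x, Q x -> ~ S x].
Proof.
move=> S1 SM iX XS.
have [Q [iQ [XQ QS] Qmax]] :=
  @noeth_max [set Y | X `<=` Y /\ forall x, Y x -> ~ S x] X iX (conj (fun _ => id) XS).
exists Q; split=> //; split=> //; first by move=> /QS.
move=> x y Qxy.
have inS z : ~ Q z -> exists2 a, Q a & exists b, S (a + b * z).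
  move=> nQz; apply: contrapT => nS; apply: nQz.
  have iQz := sspan_subm idfun (Q `|` [set z]).
  apply: (Qmax (isp (Q `|` [set z])) iQz); last by apply: sub_sspan; right.
    split; first by move=> w Xw; apply: sub_sspan; left; exact: XQ.
    move=> w /(sspan_cons iQ)[a Qa [_ [b _ <-] <-]] Sw; apply: nS.
    by exists a => //; exists b.
  by move=> w Qw; apply: sub_sspan; left.
apply: contrapT => /not_orP [/inS [a Qa [b Sb]] /inS [c Qc [d Sd]]].
have [_ Qd Qm] := iQ.
apply: (QS _ _ (SM _ _ Sb Sd)); rewrite mulrDl; apply: (Qd _ _); first exact: (idlMr _ iQ).
rewrite mulrDr; apply: Qd; first exact: Qm.
by rewrite mulrACA; exact: Qm.
Qed.

(** Noetherian induction: a maximal counterexample is proper and not prime, so it contains some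
    [x y] with neither factor in it, and the primes over its enlargements by [x] and by [y] together
    serve for it. *)
Lemma primes_over X : idl A X -> exists n (q : nat -> set A),
  (forall i, (i < n)%N -> pidl (q i) /\ X `<=` q i) /\
  (forall Q, pidl Q -> X `<=` Q -> exists2 i, (i < n)%N & q i `<=` Q).
Proof.
move=> iX; apply: contrapT => nX.
have [Y [iY nY Ymax]] := noeth_max (P := fun X => ~ exists n (q : nat -> set A),
  (forall i, (i < n)%N -> pidl (q i) /\ X `<=` q i) /\
  (forall Q, pidl Q -> X `<=` Q -> exists2 i, (i < n)%N & q i `<=` Q)) iX nX.
have [Y1|nY1] := pselect (Y 1).
  apply: nY; exists 0%N, (fun=> setT); split=> // Q [_ Q1 _] YQ.
  by case: Q1; exact: YQ.
have [Yp|nYp] := pselect (forall x y, Y (x * y) -> Y x \/ Y y).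
  apply: nY; exists 1%N, (fun=> Y); split=> [i _|Q _ YQ]; last by exists 0%N.
  by split=> //; split.
have [x [y [Yxy nYx nYy]]] : exists x y, [/\ Y (x * y), ~ Y x & ~ Y y].
  apply: contrapT => nxy; apply: nYp => x y Yxy; apply: contrapT => /not_orP[nx ny].
  by apply: nxy; exists x, y.
have big z : ~ Y z -> exists n (q : nat -> set A),
  (forall i, (i < n)%N -> pidl (q i) /\ isp (Y `|` [set z]) `<=` q i) /\
  (forall Q, pidl Q -> isp (Y `|` [set z]) `<=` Q -> exists2 i, (i < n)%N & q i `<=` Q).
  move=> nYz; apply: contrapT => nz; apply: nYz.
  apply: (Ymax _ (sspan_subm _ _) nz); last by apply: sub_sspan; right.
  by move=> w Yw; apply: sub_sspan; left.
have YS z : Y `<=` isp (Y `|` [set z]) by move=> w Yw; apply: sub_sspan; left.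
have [n [q [q1 q2]]] := big x nYx; have [m [r [r1 r2]]] := big y nYy.
apply: nY; exists (n + m)%N, (fun i => if (i < n)%N then q i else r (i - n)%N); split.
  move=> i hi; case: ifP => hin.
    by have [? h] := q1 i hin; split=> //; exact: subset_trans h.
  have hm : (i - n < m)%N by lia.
  by have [? h] := r1 _ hm; split=> //; exact: subset_trans h.
move=> Q pQ YQ; have [iQ _ Qp] := pQ.
have [Qx|Qy] := Qp _ _ (YQ _ Yxy).
  have [|i hi qQ] := q2 Q pQ.
    by apply: sspan_least => // w [/YQ|->].
  by exists i; [lia|rewrite hi].
have [|i hi qQ] := r2 Q pQ.
  by apply: sspan_least => // w [/YQ|->].
exists (n + i)%N; first lia.
by rewrite ltnNge leq_addr /= addKn.
Qed.

Lemma prime_prod Q (I : Type) (r : seq I) (P : pred I) (F : I -> A) : pidl Q ->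
  (forall i, P i -> ~ Q (F i)) -> ~ Q (\prod_(i <- r | P i) F i).
Proof.
move=> [_ Q1 Qp] h; elim/big_ind: _ => // x y nx ny /Qp[]//.
Qed.

Lemma prime_avoidance M n (q : nat -> set A) : idl A M ->
  (forall i, (i < n)%N -> pidl (q i) /\ ~ (M `<=` q i)) ->
  exists2 x, M x & forall i, (i < n)%N -> ~ q i x.
Proof.
move=> iM; elim: n q => [|n IH] q hq; first by exists 0 => //; have [] := iM.
have [pn nMn] := hq n (leqnn _).
have [[i hi qin]|nsub] := pselect (exists2 i, (i < n)%N & q i `<=` q n).
  (* When [q i] lies inside [q n], avoiding [q n] at position [i] is enough, which leaves only [n]
     primes. *)
  have [j hj|x Mx hx] := IH (fun j => if j == i then q n else q j).
    by case: ifP => _ //; apply: hq; exact: leqW.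
  exists x => // j; rewrite ltnS leq_eqVlt => /orP[/eqP->|hj].
    by have := hx _ hi; rewrite eqxx.
  have := hx _ hj; case: ifP => // /eqP -> nqx /qin //.
have [x Mx hx] : exists2 x, M x & forall i, (i < n)%N -> ~ q i x.
  by apply: IH => j hj; apply: hq; exact: leqW.
have [qnx|nqnx] := pselect (q n x); last first.
  exists x => // i; rewrite ltnS leq_eqVlt => /orP[/eqP->//|]; exact: hx.
have [m Mm nqm] : exists2 m, M m & ~ q n m.
  apply: contrapT => h; apply: nMn => m Mm; apply: contrapT => nm; apply: h.
  by exists m.
have hy (i : 'I_n) : exists y, q i y /\ ~ q n y.
  apply: contrapT => h; apply: nsub; exists i => // y qy.
  by apply: contrapT => nq; apply: h; exists y.
have [y yP] := choice hy.
have iqn : idl A (q n) by case: pn.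
(* Lies in [M] and in every [q i] with [i < n], but not in [q n]; adding it to [x] repairs [x] at
   [q n] only. *)
pose z := m * \prod_i y i.
have nqz : ~ q n z.
  case: (pn) => _ _ pp /pp [//|]; apply: prime_prod => // i _.
  by have [] := yP i.
exists (x + z).
  by have [_ Md _] := iM; apply: Md => //; exact: (idlMr _ iM).
move=> i; rewrite ltnS leq_eqVlt => /orP[/eqP->|hi].
  move=> qxz; apply: nqz; rewrite (_ : z = (x + z) - x); last by rewrite addrC addKr.
  exact: (subm_sgrp iqn).2.
have [[iqi _ _] _] := hq i (leqW hi).
move=> qxz; apply: (hx i hi); rewrite (_ : x = (x + z) - z); last by rewrite addrK.
apply: (subm_sgrp iqi).2 => //; rewrite /z (bigD1 (Ordinal hi)) //= mulrCA.
by apply: (idlMr _ iqi); have [] := yP (Ordinal hi).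
Qed.

Lemma imul_seqP X (s : seq A) z : idl A X -> imul X (isp [set` s]) z ->
  exists c : nat -> A, (forall i, X (c i)) /\ z = \sum_(i < size s) c i * s`_i.
Proof.
move=> iX; have [X0 Xd Xm] := iX.
move=> h; apply: (h [set z | exists c : nat -> A, (forall i, X (c i)) /\
  z = \sum_(i < size s) c i * s`_i]); first split.
- by exists (fun=> 0); split=> //; rewrite big1 // => i _; rewrite mul0r.
- move=> _ _ [c [hc ->]] [d [hd ->]]; exists (fun i => c i + d i); split.
    by move=> i; exact: Xd.
  by rewrite -big_split; apply: eq_bigr => i _; rewrite mulrDl.
- move=> b _ [c [hc ->]]; exists (fun i => b * c i); split; first by move=> i; exact: Xm.
  by rewrite mulr_sumr; apply: eq_bigr => i _; rewrite mulrA.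
- move=> _ [x Xx [y /sspan_seqP [c ->] <-]]; exists (fun i => x * c i); split.
    by move=> i; exact: (idlMr _ iX).
  by rewrite mulr_sumr; apply: eq_bigr => i _; rewrite mulrA.
Qed.

(* Nakayama's lemma in the localization at [Q], without localizing: the
   determinant of the system is congruent to a product of elements outside [Q]. *)
Lemma nakayama_at Q X Y : pidl Q -> idl A X -> idl A Y ->
  (forall a, X a -> exists2 s, ~ Q s & addset Y (imul Q X) (s * a)) ->
  exists2 s, ~ Q s & forall a, X a -> Y (s * a).
Proof.
move=> pQ iX iY h; have [iQ Q1 Qp] := pQ.
have [g Eg] := nA iX.
have hg (i : 'I_(size g)) : exists sc : A * (nat -> A), [/\ ~ Q sc.1,
    forall j, Q (sc.2 j) & Y (sc.1 * g`_i - \sum_(j < size g) sc.2 j * g`_j)].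
  have [|s nQs [y Yy [z hz E]]] := h g`_i.
    by rewrite Eg; apply: sub_sspan => /=; exact: mem_nth.
  rewrite Eg in hz; have [c [Qc Ez]] := imul_seqP iQ hz.
  by exists (s, c); split=> //=; rewrite -Ez -E addrK.
have [f fP] := choice hg.
pose N := \matrix_(i < size g, j < size g) ((f i).1 *+ (i == j) - (f i).2 j).
exists (\det N).
  (* Permutations other than the identity use an off-diagonal entry, which lies in [Q]; the identity
     contributes a product of elements outside the prime [Q]. *)
  rewrite /determinant (bigD1 (1%g : 'S_(size g))) //= => QD.
  have : Q (\sum_(i : 'S_(size g) | i != 1%g)
      (-1) ^+ i * \prod_(i0 < size g) N i0 (i i0)).
    apply: (subm_sum _ iQ) => s; move/eqP => s1.
    apply: (idlM _ iQ); have [i hi] : exists i, s i != i.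
      apply: contrapT => nh; apply: s1; apply/permP => i; rewrite perm1.
      by apply/eqP/negPn/negP => hi; apply: nh; exists i.
    rewrite (bigD1 i) //=; apply: (idlMr _ iQ); rewrite mxE eq_sym (negbTE hi) mulr0n sub0r.
    by apply: sgrpN; [exact: (subm_sgrp iQ)|have [] := fP i].
  move=> /((subm_sgrp iQ).2 _ _ QD); rewrite addrK odd_perm1 expr0 mul1r.
  apply: prime_prod => // i _; rewrite mxE perm1 eqxx mulr1n => Qd.
  have [nQ Qc _] := fP i; apply: nQ.
  by rewrite -[_.1](subrK ((f i).2 i)); have [_ Qdd _] := iQ; apply: Qdd.
have key (j : 'I_(size g)) : Y (\det N * g`_j).
  have : \det N *: (\col_(i < size g) g`_i) = \adj N *m (N *m (\col_(i < size g) g`_i)).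
    by rewrite mulmxA mul_adj_mx mul_scalar_mx.
  move/matrixP/(_ j ord0); rewrite !mxE => ->.
  apply: (subm_sum _ iY) => i _; apply: (idlM _ iY).
  rewrite mxE (_ : \sum_j0 _ = (f i).1 * g`_i - \sum_(j < size g) (f i).2 j * g`_j).
    by have [] := fP i.
  rewrite (eq_bigr (fun j : 'I_(size g) => ((f i).1 *+ (i == j)) * g`_j - (f i).2 j * g`_j));
    last by move=> k _; rewrite !mxE mulrBl.
  rewrite sumrB; congr (_ - _); rewrite (bigD1 i) //= eqxx big1 ?addr0 // => k.
  by rewrite eq_sym => /negbTE ->; rewrite mul0r.
move=> a; rewrite Eg => ha.
have : [set a | Y (\det N * a)] a; last by [].
apply: (sspan_least _ _ ha); first exact: colon_idl.
move=> x /= xg; have lt : (index x g < size g)%N by rewrite index_mem.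
by have := key (Ordinal lt); rewrite /= nth_index.
Qed.

End Noetherian.

Section Generators.
Variable A : comNzRingType.
Implicit Types (X Y : set A) (s t : seq A).

Lemma ipow_gens s N : ipow (isp [set` s]) N `<=`
  isp [set z | exists t, [/\ size t = N, {subset t <= s} & z = \prod_(y <- t) y]].
Proof.
elim: N => [|N IH].
  move=> z _; rewrite -[z]mulr1; apply: (@idlM _ (isp _)); first exact: sspan_subm.
  by apply: sub_sspan; exists [::]; rewrite big_nil.
apply: sspan_least; first exact: sspan_subm.
move=> _ [x hx [y /IH hy <-]].
set Z := isp _ in IH *; set Z' := isp _.
have iZ' : idl A Z' by exact: sspan_subm.
have : [set x | Z' (x * y)] x; last by [].
apply: (sspan_least _ _ hx).
  split=> /=; first by rewrite mul0r; case: iZ'.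
    by move=> u v hu hv; rewrite mulrDl; case: iZ' => _ h _; exact: h.
  by move=> a u hu; rewrite -mulrA; exact: (idlM _ iZ').
move=> u us /=; have : [set y | Z' (u * y)] y; last by [].
apply: (sspan_least _ _ hy); first exact: colon_idl.
move=> _ [t [st ts ->]] /=; apply: sub_sspan; exists (u :: t); split.
- by rewrite /= st.
- by move=> w; rewrite inE => /orP[/eqP->|/ts].
- by rewrite big_cons.
Qed.

Lemma prod_extract t g k : (k <= count_mem g t)%N -> exists t',
  [/\ {subset t' <= t}, size t = (k + size t')%N &
      \prod_(y <- t) y = g ^+ k * \prod_(y <- t') y].
Proof.
elim: k t => [|k IH] t h; first by exists t; split=> //; rewrite expr0 mul1r.
have gt : g \in t by rewrite -has_pred1 has_count; exact: leq_trans (ltn0Sn k) h.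
have pt := perm_to_rem gt.
have : (k <= count_mem g (rem g t))%N.
  by move: h; rewrite (seq.permP pt (pred1 g)) /= eqxx.
move=> /IH [t' [t1 t2 t3]]; exists t'; split.
- by move=> y /t1; exact: mem_rem.
- by rewrite (perm_size pt) /= t2.
- by rewrite (perm_big _ pt) big_cons t3 /= mulrA -exprS.
Qed.

Lemma pigeonhole s t k : {subset t <= s} -> (size s * k < size t)%N ->
  exists g t', [/\ g \in s, {subset t' <= t}, size t = (k.+1 + size t')%N &
      \prod_(y <- t) y = g ^+ k.+1 * \prod_(y <- t') y].
Proof.
move=> ts hk.
suff [g gs hg] : exists2 g, g \in s & (k.+1 <= count_mem g t)%N.
  by have [t' [h1 h2 h3]] := prod_extract hg; exists g, t'.
apply: contrapT => ng.
have hsum : (size t <= \sum_(g <- s) count_mem g t)%N.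
  elim: t ts {hk ng} => [|y t IH] ts //=.
  rewrite big_split /=.
  have ys : y \in s by apply: ts; exact: mem_head.
  have h1 : (0 < \sum_(g <- s) (y == g))%N.
    rewrite (big_rem y) //= eqxx; exact: ltn_addr.
  rewrite -add1n; apply: leq_add h1 (IH _).
  by move=> w hw; apply: ts; rewrite inE hw orbT.
have : (\sum_(g <- s) count_mem g t <= size s * k)%N.
  have -> : (size s * k = \sum_(g <- s) k)%N.
    by rewrite big_const_seq count_predT iter_addn_0 mulnC.
  rewrite big_seq_cond [X in (_ <= X)%N]big_seq_cond; apply: leq_sum => g /andP[gs _].
  by rewrite leqNgt; apply/negP => hg; apply: ng; exists g.
lia.
Qed.

(** A product of more than [size s * k] generators repeats one of them more than [k] times. The
    exponent is linear in [k], which later gives inclusions of powers of [M] uniform in [e]. *)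
Lemma rad_bound s k Y : idl A Y -> (forall g, g \in s -> Y (g ^+ k)) ->
  ipow (isp [set` s]) (size s * k).+1 `<=` Y.
Proof.
move=> iY hk z /ipow_gens hz; apply: (sspan_least iY _ hz).
move=> _ [t [st ts ->]].
have [|g [t' [gs _ _ ->]]] := pigeonhole (k := k) ts; first by rewrite st.
by apply: (idlMr _ iY); rewrite exprS; apply: (idlM _ iY); exact: hk.
Qed.

Lemma rad_fg s Y : idl A Y -> (forall g, g \in s -> exists n, Y (g ^+ n)) ->
  exists N, ipow (isp [set` s]) N `<=` Y.
Proof.
move=> iY h.
have [k hk] : exists k, forall g, g \in s -> Y (g ^+ k).
  elim: s h => [|g s IH] h; first by exists 0%N.
  have [k hk] := IH (fun w hw => h w (@mem_behead _ (g :: s) w hw)).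
  have [n hn] := h g (mem_head _ _).
  exists (k + n)%N => w; rewrite inE exprD => /orP[/eqP->|/hk ?].
    exact: (idlM _ iY).
  exact: (idlMr _ iY).
exists (size s * k).+1; exact: rad_bound.
Qed.

End Generators.

Section KrullDim.
Variable A : comNzRingType.
Hypothesis nA : fin_gen A.
Implicit Types (X Y Z M Q : set A).

(* Contraction to A of the extension of X to the localization at Q. *)
Definition satp Q X : set A := [set z | exists2 s, ~ Q s & X (s * z)].

Lemma satp_idl Q X : pidl Q -> idl A X -> idl A (satp Q X).
Proof.
move=> [iQ Q1 Qp] iX; split.
- by exists 1 => //; rewrite mulr0; case: iX.
- move=> x y [s ns hx] [u nu hy]; exists (s * u); first by move=> /Qp[].
  rewrite mulrDr; case: (iX) => _ Xd _; apply: Xd.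
    by rewrite mulrAC mulrC; exact: (idlM _ iX).
  by rewrite -mulrA; exact: (idlM _ iX).
- by move=> a x [s ns hx]; exists s => //=; rewrite mulrCA; exact: (idlM _ iX).
Qed.

Lemma satp_sub Q X : pidl Q -> X `<=` satp Q X.
Proof. by move=> [_ Q1 _] x Xx; exists 1 => //; rewrite mul1r. Qed.

(** These ideals correspond to the ideals of the localization at [Q], so [bnd (satd Q)] bounds
    lengths over that local ring without constructing it. *)
Definition satd Q X := idl A X /\ satp Q X `<=` X.

Lemma satp_satd Q X : pidl Q -> idl A X -> satd Q (satp Q X).
Proof.
move=> pQ iX; split; first exact: satp_idl.
move=> z [s ns [u nu hz]]; exists (u * s); last by rewrite -mulrA.
by case: pQ => _ _ Qp /Qp[].
Qed.

Lemma satd_bnd_trans Q X Y Z a b : pidl Q -> satd Q Y -> X `<=` Y -> satd Q Z ->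
  Y `<=` Z -> bnd (satd Q) X Y a -> bnd (satd Q) Y Z b -> bnd (satd Q) X Z (a + b).
Proof.
move=> pQ; have [iQ Q1 Qp] := pQ.
have W0 W : idl A W -> W 0 by case.
apply: (@bnd_trans _ _ (fun W W' => satp Q (addset W W'))).
- move=> W W' [iW sW] [iW' sW']; split; first exact: submI.
  by move=> z [s ns [h1 h2]]; split; [apply: sW|apply: sW']; exists s.
- by move=> W W' [iW sW] [iW' sW']; apply: satp_satd => //; exact: submA.
- move=> W W' [iW sW] [iW' sW']; split; apply: (subset_trans _ (satp_sub pQ)).
    by apply: addset_subl; exact: W0.
  by apply: addset_subr; exact: W0.
- move=> W W' U [iW sW] [iW' sW'] [iU sU] WU WU'; apply: subset_trans sU.
  move=> z [s ns h]; exists s => //.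
  exact: (addset_least (subm_sgrp iU) WU WU' h).
- move=> W W' U [iW sW] [iW' sW'] [iU sU] WW' EI EA; apply/seteqP; split=> // x W'x.
  have : satp Q (addset W U) x.
    by rewrite EA; apply: (satp_sub pQ); apply: addset_subl => //; exact: W0.
  case=> s ns [w Ww [u Uu E]]; apply: sW; exists s => //.
  have : (W' `&` U) u.
    split=> //; rewrite (_ : u = s * x - w); last by rewrite -E addrC addKr.
    by apply: (subm_sgrp iW').2; [exact: (idlM _ iW')|exact: WW'].
  by rewrite -EI -E => -[Wu _]; case: iW => _ Wd _; exact: Wd.
Qed.

(** Localized form of [bnd_cyc]: elements of [Q] kill [z] modulo [X] and all others act
    invertibly. *)
Lemma satd_bnd_cyc Q X z : pidl Q -> idl A X -> (forall b, Q b -> X (b * z)) ->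
  bnd (satd Q) (satp Q X) (satp Q (isp (X `|` [set z]))) 1.
Proof.
move=> pQ iX hz m hm; have [iQ Q1 Qp] := pQ.
rewrite leqNgt; apply/negP => /(lchain_leq hm) {hm}.
move E : (satp Q (isp (X `|` [set z]))) => C; move E2 : 2%N => n h2.
case: n C / h2 E E2 => // n W1 W2 h1 sW2 W12 nW12 E [] E2.
case: n W1 / h1 E2 W12 nW12 => // n W0 W1 h0 sW1 W01 nW01 _ W12 nW12.
have [sW0 XW0] := lchain_top h0.
have [w W1w nW0w] : exists2 w, W1 w & ~ W0 w.
  apply: contrapT => nh; apply: nW01; apply/seteqP; split=> // w W1w.
  by apply: contrapT => nw; apply: nh; exists w.
have : satp Q (isp (X `|` [set z])) w by rewrite E; exact: W12.
case=> s ns /(sspan_cons iX)[x Xx [_ [b _ <-] Ew]].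
have XXs := @satp_sub Q X pQ.
have [Qb|nQb] := pselect (Q b).
  apply: nW0w; apply: XW0; exists s => //; rewrite -Ew.
  by case: iX => _ Xd _; apply: Xd => //; exact: hz.
apply: nW12; apply/seteqP; split=> // v; rewrite -E => -[u nu].
have [[iW0 _] [iW1 sW1']] := (sW0, sW1).
have W1X : X `<=` W1 by apply: subset_trans W01; exact: subset_trans XW0.
have W1z : W1 z.
  apply: sW1'; exists b => //; rewrite (_ : b * z = s * w - x).
    by apply: (subm_sgrp iW1).2; [exact: (idlM _ iW1)|exact: W1X].
  by rewrite -Ew addrC addKr.
move=> huv; apply: sW1'; exists u => //.
by apply: (sspan_least iW1 _ huv) => y [/W1X|->].
Qed.

Lemma satd_bnd_gens Q X (zs : seq A) : pidl Q -> idl A X ->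
  (forall z, z \in zs -> forall b, Q b -> X (b * z)) ->
  bnd (satd Q) (satp Q X) (satp Q (isp (X `|` [set` zs]))) (size zs).
Proof.
move=> pQ; elim: zs X => [|z zs IH] X iX hz.
  have -> : isp (X `|` [set` [::]]) = X.
    apply/seteqP; split; first by apply: sspan_least => // x [].
    by move=> x Xx; apply: sub_sspan; left.
  exact: bnd0.
have iXz := sspan_subm idfun (X `|` [set z]); set X1 := isp _ in iXz.
have XX1 : X `<=` X1 by move=> x Xx; apply: sub_sspan; left.
have smono W W' : W `<=` W' -> satp Q W `<=` satp Q W'.
  by move=> h x [s ns hx]; exists s => //; exact: h.
have b1 : bnd (satd Q) (satp Q X) (satp Q X1) 1.
  by apply: satd_bnd_cyc => //; apply: hz; exact: mem_head.
have b2 : bnd (satd Q) (satp Q X1) (satp Q (isp (X1 `|` [set` zs]))) (size zs).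
  apply: IH => // y ys b Qb; apply: XX1; apply: hz => //.
  by rewrite inE ys orbT.
have iL := sspan_subm idfun (X1 `|` [set` zs]).
have -> : isp (X `|` [set` z :: zs]) = isp (X1 `|` [set` zs]).
  apply/seteqP; split; apply: sspan_least; try exact: sspan_subm.
    move=> y [Xy|]; first by apply: sub_sspan; left; exact: XX1.
    rewrite /= inE => /orP[/eqP->|ys]; last by apply: sub_sspan; right.
    by apply: sub_sspan; left; apply: sub_sspan; right.
  move=> y [|ys]; last by apply: sub_sspan; right; rewrite /= inE; apply/orP; right.
  apply: sspan_mono => w [Xw|->]; first by left.
  by right; rewrite /= inE eqxx.
rewrite /= -add1n; apply: (@satd_bnd_trans _ _ (satp Q X1)) => //.
- exact: satp_satd.
- exact: smono.
- exact: satp_satd.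
- by apply: smono => w hw; apply: sub_sspan; left.
Qed.

Lemma satd_bnd_pow Q N : pidl Q ->
  exists l, bnd (satd Q) (satp Q (ipow Q N)) setT l.
Proof.
move=> pQ; have [iQ Q1 Qp] := pQ.
have sT : satd Q setT by split.
elim: N => [|N [l bl]].
  by exists 0%N; apply: bnd0 => x _; exists 1.
have iN := ipow_idl Q N.
have [zs Ez] := nA iN.
exists (size zs + l)%N; apply: (@satd_bnd_trans _ _ (satp Q (ipow Q N))) => //.
- by apply: satp_satd => //; exact: ipow_idl.
- by move=> x [s ns h]; exists s => //; exact: ipowS_sub.
- have := @satd_bnd_gens Q (ipow Q N.+1) zs pQ (ipow_idl _ _).
  have -> : isp (ipow Q N.+1 `|` [set` zs]) = ipow Q N.
    apply/seteqP; split.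
      apply: (sspan_least iN) => x [h|xz]; first exact: (ipowS_sub h).
      by move: xz; rewrite Ez; exact: sub_sspan.
    by rewrite {1}Ez; apply: sspan_mono => x; right.
  apply=> z zz b Qb; have hz : ipow Q N z by rewrite Ez; exact: sub_sspan.
  exact: imul_in Qb hz.
Qed.

(* Krull's principal ideal theorem, in the form that moves an element of [p] into the
   second term of a chain of primes. *)
Lemma principal_ideal q q' p x : pidl q -> pidl q' -> pidl p ->
  q `<=` q' -> ~ (q' `<=` q) -> q' `<=` p -> ~ (p `<=` q') -> p x -> ~ q' x ->
  exists Q, [/\ pidl Q, q `<=` Q, Q x, Q `<=` p & ~ (p `<=` Q)].
Proof.
move=> pq pq' pp qq' nq'q q'p npq' px nq'x.
have [[[iq q1 qp] [iq' q'1 q'p']] [ip p1 pP]] := (pq, pq', pp).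
apply: contrapT => nQ.
(* Under the contrary assumption [p] is minimal over [q + (x)], so modulo this ideal the
   localization at [p] has finite length; this becomes [bY]. *)
have Hmin Q : pidl Q -> q `<=` Q -> Q x -> Q `<=` p -> p `<=` Q.
  by move=> h1 h2 h3 h4; apply: contrapT => h5; apply: nQ; exists Q.
pose Z := isp (q `|` [set x]).
have iZ : idl A Z by exact: sspan_subm.
pose Y := satp p Z.
have iY : idl A Y by exact: satp_idl.
have [ps Eps] := nA ip.
have [N hN] : exists N, ipow p N `<=` Y.
  rewrite Eps; apply: rad_fg => // g gs.
  have pg : p g by rewrite Eps; exact: sub_sspan.
  apply: contrapT => ng.
  have [||||Q [pQ ZQ QS]] := @prime_avoiding A nA
      [set w | exists s n, ~ p s /\ w = s * g ^+ n] Z.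
  - by exists 1, 0%N; rewrite mul1r.
  - move=> _ _ [s [n [ns ->]]] [u [m [nu ->]]]; exists (s * u), (n + m)%N.
    by split; [move=> /pP[]|rewrite exprD mulrACA].
  - exact: iZ.
  - by move=> w Zw [s [n [ns Ew]]]; apply: ng; exists n, s => //; rewrite -Ew.
  have /Hmin : pidl Q by [].
  move=> /(_ _ _ _)h; apply: (QS g).
    apply: h => //.
    + by apply: subset_trans ZQ => w qw; apply: sub_sspan; left.
    + by apply: ZQ; apply: sub_sspan; right.
    + move=> w Qw; apply: contrapT => npw; apply: (QS _ Qw).
      by exists w, 0%N; rewrite mulr1.
  by exists 1, 1%N; rewrite mul1r.
have [l bl] := satd_bnd_pow N pp.
have bY : bnd (satd p) Y setT l.
  apply: bnd_sub bl _ _ _ => //.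
  by move=> z [s ns h]; case: (satp_satd pp iZ) => _; apply; exists s => //; exact: hN.
(* Symbolic powers of [q'] modulo [q]. Since [x] is outside [q'], it can be cancelled modulo
   [R n]. *)
pose R n := satp q' (addset (ipow q' n) q).
have iR n : idl A (R n) by apply: satp_idl => //; apply: submA => //; exact: ipow_idl.
have R0 n : addset (ipow q' n) q `<=` R n by exact: satp_sub.
have Rsat n : satp q' (R n) `<=` R n.
  by have [] := satp_satd pq' (submA (ipow_idl q' n) iq).
have Rm n : R n.+1 `<=` R n.
  move=> z [s ns h]; exists s => //; move: h; apply: addset_mono => //; exact: ipowS_sub.
have [ix0 ixd ixm] := cyc_subm idfun x.
pose W n := satp p (addset (R n) (cyc idfun x)).
have iW n : idl A (addset (R n) (cyc idfun x)) by apply: submA => //; exact: cyc_subm.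
have WZ n : Y `<=` W n.
  move=> z [s ns h]; exists s => //; apply: (sspan_least (iW n) _ h) => w [qw|->].
    apply: addset_subl => //; apply: R0; apply: addset_subr => //.
    by have [] := ipow_idl q' n.
  by apply: addset_subr; [have [] := iR n|exact: cyc_id].
have WS n : satd p (W n) by exact: satp_satd.
have Wm n : W n.+1 `<=` W n.
  by move=> z [s ns h]; exists s => //; move: h; apply: addset_mono.
have [n EW] : exists n, W n = W n.+1.
  apply: contrapT => nE.
  have h : lchain (satd p) Y l.+1 (W (l.+1 - l.+1)%N).
    apply: (@seq_lchain _ (satd p) Y l.+1 (fun i => W (l.+1 - i)%N)) => // i hi.
    rewrite (_ : (l.+1 - i)%N = (l.+1 - i.+1).+1); last lia.
    split; first exact: Wm.
    move=> h; apply: nE; exists (l.+1 - i.+1)%N; apply/seteqP; split=> //; exact: Wm.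
  have := bY _ (lchain_widen h (conj (submT _) (fun _ _ => I)) (@subsetT _ _)).
  by rewrite ltnn.
(* In [s * a = b + c * x] both [s * a] and [b] lie in [R n]; cancelling [x] puts [c] in [R n], hence
   [c * x] in [p R n]. *)
have step1 a : R n a -> exists2 s, ~ p s & addset (R n.+1) (imul p (R n)) (s * a).
  move=> Ra; have : W n a.
    exists 1 => //; rewrite mul1r; apply: addset_subl => //.
  rewrite EW => -[s ns [b Rb [_ [c _ <-] E]]]; exists s => //.
  exists b => //; exists (x * c); last by rewrite -E /= [x * c]mulrC.
  apply: imul_in => //; apply: Rsat; exists x => //.
  rewrite (_ : x * c = s * a - b); last by rewrite -E /= addrC addKr mulrC.
  by apply: (subm_sgrp (iR n)).2; [exact: (idlM _ (iR n))|exact: Rm].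
(* Nakayama at [p] gives [R n = R n.+1]; Nakayama at [q'] then gives a multiplier outside [q']
   carrying the [n]-th power of [q'] into [q], which forces [q'] into [q]. *)
have [s ns hs] := nakayama_at nA pp (iR n) (iR n.+1) step1.
have Rn : R n `<=` R n.+1.
  move=> a /hs h; apply: Rsat; exists s => //; by move=> /q'p.
have step2 a : ipow q' n a -> exists2 s, ~ q' s & addset q (imul q' (ipow q' n)) (s * a).
  move=> ha; have : R n a by apply: R0; apply: addset_subl => //; case: iq.
  move=> /Rn [u nu [b hb [c qc E]]]; exists u => //.
  by exists c => //; exists b => //; rewrite addrC.
have [u nu hu] := nakayama_at nA pq' (ipow_idl q' n) iq step2.
apply: nq'q => y q'y.
have := hu _ (ipowX n q'y) => /qp[/qq'//|].
elim: (n) => [|k IH]; first by rewrite expr0.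
by rewrite exprS => /qp[|/IH].
Qed.

Inductive pchain : set A -> set A -> nat -> Prop :=
| Pchain0 Q : pidl Q -> pchain Q Q 0
| PchainS Q Q' Q'' n : pidl Q -> Q `<=` Q' -> ~ (Q' `<=` Q) -> pchain Q' Q'' n ->
    pchain Q Q'' n.+1.

Lemma pchainP Q Q' n : pchain Q Q' n -> [/\ pidl Q, pidl Q' & Q `<=` Q'].
Proof.
elim=> {Q Q' n} [Q pQ|Q Q' Q'' n pQ QQ' _ _ [pQ' pQ'' h]]; first by split.
by split=> //; exact: subset_trans h.
Qed.

Lemma pchain_inv Q Q'' n : pchain Q Q'' n.+1 ->
  exists Q', [/\ pidl Q, Q `<=` Q', ~ (Q' `<=` Q) & pchain Q' Q'' n].
Proof.
move E : n.+1 => m h; case: h E => // R R' R'' k pR RR' nR' h [->].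
by exists R'.
Qed.

(** Pushes [x] from the top of the chain down to the prime just above [Q], one prime at a time by
    [principal_ideal]; the ends and the length are kept. *)
Lemma pchain_adjust Q Q'' n x : pchain Q Q'' n.+1 -> Q'' x ->
  exists Q', [/\ Q `<=` Q', ~ (Q' `<=` Q), Q' x & pchain Q' Q'' n].
Proof.
elim: n Q => [|n IH] Q /pchain_inv[Q' [pQ QQ' nQ' h]] hx.
  have [pQ' pQ'' Q'Q''] := pchainP h.
  move E : 0%N h => m h; case: h E QQ' nQ' hx {pQ' pQ'' Q'Q''} => // R pR _ QR nR Rx.
  by exists R; split=> //; exact: Pchain0.
have [R [QR nRQ Rx hR]] := IH _ h hx.
have [pQ' _ _] := pchainP h; have [pR _ _] := pchainP hR.
have [Q'x|nQ'x] := pselect (Q' x).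
  by exists Q'; split.
have [P [pP QP Px PR nRP]] := principal_ideal pQ pQ' pR QQ' nQ' QR nRQ Rx nQ'x.
exists P; split=> //.
  by move=> PQ; apply: nQ'x; apply: QQ'; exact: PQ.
exact: PchainS PR nRP hR.
Qed.

(** Krull's height theorem relative to [Q]: once [x] lies in the prime just above [Q], the chain
    without [Q] is handled by the remaining elements. *)
Lemma pchain_le Q Q'' n (xs : seq A) : pchain Q Q'' n ->
  (forall x, x \in xs -> Q'' x) ->
  (forall P, pidl P -> Q `<=` P -> (forall x, x \in xs -> P x) -> P `<=` Q'' ->
    Q'' `<=` P) -> (n <= size xs)%N.
Proof.
elim: xs Q n => [|x xs IH] Q n h hx hP.
  have [pQ pQ'' QQ''] := pchainP h.
  have := hP Q pQ (fun _ z => z) (fun _ => ltac:(done)) QQ''.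
  case: n h => // n /pchain_inv[Q' [_ _ nQ' h]] Q''Q.
  have [_ _ Q'Q''] := pchainP h.
  by case: nQ'; exact: subset_trans Q'Q'' Q''Q.
case: n h => // n h; have [Q' [QQ' _ Q'x h']] := pchain_adjust h (hx x (mem_head _ _)).
rewrite ltnS; apply: IH h' _ _ => [y ys|P pP Q'P hxs PQ''].
  by apply: hx; rewrite inE ys orbT.
apply: hP => //; first exact: subset_trans Q'P.
by move=> y; rewrite inE => /orP[/eqP->|/hxs//]; exact: Q'P.
Qed.

End KrullDim.

Lemma idealr_closedP (A : comNzRingType) (Y : set A) : idealr_closed [in Y] <-> idl A Y /\ ~ Y 1.
Proof.
split=> [[/set_mem Y0 Y1 Yl]|[[Y0 Yd Ym] Y1]].
  split; last by move=> h; move: Y1; rewrite mem_set.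
  split=> // [x y hx hy|a x hx /=].
    by rewrite -[x]mul1r; apply/set_mem/Yl; exact: mem_set.
  by rewrite -[a * x]addr0; apply/set_mem/Yl; exact: mem_set.
split; [exact: mem_set|by apply/negP => /set_mem|].
by move=> a x y /set_mem hx /set_mem hy; apply/mem_set/Yd => //; exact: Ym.
Qed.

(** * Local rings, systems of parameters and growth of lengths *)

Section LocalRings.
Variable A : comNzRingType.
Implicit Types (X Y Z Q : set A).

Definition loc (M : set A) :=
  [/\ idl A M, ~ M 1 & forall a, ~ M a -> exists b, b * a = 1].

Lemma noetherian_localP (m : set A) (k : fieldType) : noetherian_local m k ->
  [/\ fin_gen A, loc m & exists f : {rmorphism A -> k},
      (forall y, exists x, f x = y) /\ (forall x, m x <-> f x = 0)].
Proof.
move=> [/noetherianP nA [[m0 m1 ml] mmax] muniq hf].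
have [im nm1] : idl A m /\ ~ m 1 by apply/idealr_closedP.
split=> //; split=> // a nma.
apply: contrapT => na.
have [||Y [iY [aY nY1] Ymax]] := @noeth_max A nA
   [set Y | cyc idfun a `<=` Y /\ ~ Y 1] (cyc idfun a).
- exact: cyc_subm.
- by split=> // -[b _ hb]; apply: na; exists b.
apply: nma; rewrite -(muniq Y); first by apply: aY; exact: cyc_id.
split; first exact/idealr_closedP.
move=> Z /idlP iZ YZ; have [Z1|nZ1] := pselect (Z 1).
  by right; exact: idlT.
left; apply/seteqP; split=> //; apply: Ymax => //.
by split=> //; exact: subset_trans YZ.
Qed.

Variable M : set A.
Hypotheses (nA : fin_gen A) (lM : loc M).

Lemma loc_proper X : idl A X -> ~ X 1 -> X `<=` M.
Proof.
move=> iX X1 x Xx; apply: contrapT => nx; have [_ _ u] := lM.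
by have [b hb] := u _ nx; apply: X1; rewrite -hb; exact: (idlM _ iX).
Qed.

Lemma loc_prime : pidl M.
Proof.
have [iM M1 u] := lM; split=> // x y Mxy; apply: contrapT => /not_orP[nx ny].
have [b hb] := u _ nx; have [c hc] := u _ ny; apply: M1.
by rewrite -[1]mulr1 -{1}hb -hc mulrACA; exact: (idlM _ iM).
Qed.

Lemma bnd_gens X (zs : seq A) : idl A X ->
  (forall z, z \in zs -> forall b, M b -> X (b * z)) ->
  bnd (idl A) X (isp (X `|` [set` zs])) (size zs).
Proof.
have [iM M1 u] := lM.
elim: zs X => [|z zs IH] X iX hz.
  by apply: bnd0; apply: (sspan_least iX) => x [].
have iXz := sspan_subm idfun (X `|` [set z]); set X1 := isp _ in iXz.
have XX1 : X `<=` X1 by move=> x Xx; apply: sub_sspan; left.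
have b1 : bnd (idl A) X X1 1.
  apply: bnd_sub (bnd_cyc (z := z) iX _) _ _ _ => //.
  - move=> b; have [Mb|nMb] := pselect (M b).
      by left; apply: hz => //; exact: mem_head.
    have [c hc] := u _ nMb; right; exists c.
    by rewrite /= hc mul1r subrr; case: iX.
  - exact: sspan_cons.
  - by apply: submA => //; exact: cyc_subm.
have b2 : bnd (idl A) X1 (isp (X1 `|` [set` zs])) (size zs).
  apply: IH => // y ys b Mb; apply: XX1; apply: hz => //.
  by rewrite inE ys orbT.
rewrite /= -add1n.
have b12 := subm_bndD iXz XX1 (sspan_subm _ _) _ b1 b2.
apply: bnd_sub (b12 _) _ _ _ => //.
- by move=> w hw; apply: sub_sspan; left.
- apply: sspan_least; first exact: sspan_subm.
  move=> y [Xy|]; first by apply: sub_sspan; left; exact: XX1.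
  rewrite /= inE => /orP[/eqP->|ys]; last by apply: sub_sspan; right.
  by apply: sub_sspan; left; apply: sub_sspan; right.
- exact: sspan_subm.
Qed.

(** Each layer [M^N / M^(N+1)] is a finitely generated vector space over the residue field. *)
Lemma local_len N : exists l, bnd (idl A) (ipow M N) setT l.
Proof.
elim: N => [|N [l bl]]; first by exists 0%N; exact: bnd0.
have iN := ipow_idl M N; have [zs Ez] := nA iN.
have zN z : z \in zs -> ipow M N z by move=> zz; rewrite Ez; exact: sub_sspan.
exists (size zs + l)%N; apply: (subm_bndD iN) => //; first exact: ipowS_sub.
have iN1 := ipow_idl M N.+1.
have bz := bnd_gens (zs := zs) iN1 (fun z zz b Mb => imul_in Mb (zN z zz)).
apply: bnd_sub bz _ _ _ => //; last exact: sspan_subm.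
by rewrite {1}Ez; apply: sspan_mono => x; right.
Qed.

Lemma seq_pchain n (Q : nat -> set A) :
  (forall i, (i <= n)%N -> prime_ideal (Q i)) ->
  (forall i, (i < n)%N -> Q i `<` Q i.+1) -> pchain (Q 0%N) (Q n) n.
Proof.
elim: n Q => [|n IH] Q h1 h2.
  by apply: Pchain0; apply/prime_idealP; exact: h1.
have [h3 h4] := h2 0%N (ltn0Sn _).
apply: (PchainS _ h3 h4); first by apply/prime_idealP; exact: h1.
by apply: (IH (fun i => Q i.+1)) => i hi; [exact: h1|exact: h2].
Qed.

Lemma pchain_seq Q Q' n : pchain Q Q' n -> exists N : nat -> set A,
  [/\ forall i, (i <= n)%N -> prime_ideal (N i),
      forall i, (i < n)%N -> N i `<` N i.+1 & N 0%N = Q].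
Proof.
elim=> {Q Q' n} [Q pQ|Q Q' Q'' n pQ QQ' nQ' _ [N [N1 N2 N3]]].
  by exists (fun=> Q); split=> // i _; apply/prime_idealP.
exists (fun i => if i is i'.+1 then N i' else Q); split=> //.
  by case=> [_|i hi]; [apply/prime_idealP|exact: N1].
by case=> [_|i hi]; [rewrite N3|exact: N2].
Qed.

Lemma pchain_rcons Q Q' Q'' n : pchain Q Q' n -> pidl Q'' -> Q' `<=` Q'' ->
  ~ (Q'' `<=` Q') -> pchain Q Q'' n.+1.
Proof.
elim=> {Q Q' n} [Q pQ pQ'' h1 h2|Q R Q' n pQ QR nR _ IH pQ'' h1 h2].
  by apply: (PchainS pQ h1 h2); exact: Pchain0.
exact: (PchainS pQ QR nR (IH pQ'' h1 h2)).
Qed.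

(** Every chain of primes extends up to [M], where [pchain_le] bounds it by the number of generators
    of [M]. Hence the maximum defining [krull_dim] is attained. *)
Lemma pchain_bounded : exists d, forall Q Q' n, pchain Q Q' n -> (n <= d)%N.
Proof.
have [iM M1 _] := lM; have pM := loc_prime.
have [xs Ex] := nA iM.
exists (size xs) => Q Q' n h.
have top R l : pchain R M l -> (l <= size xs)%N.
  move=> hR; apply: (pchain_le nA hR) => [x xx|P [iP _ _] _ hP _].
    by rewrite Ex; exact: sub_sspan.
  by rewrite Ex; exact: (sspan_least iP).
have [_ pQ' _] := pchainP h; have [iQ' Q'1 _] := pQ'.
have Q'M := loc_proper iQ' Q'1.
have [MQ'|nMQ'] := pselect (M `<=` Q').
  apply: (top Q); suff -> : M = Q' by [].
  exact/seteqP.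
exact: ltnW (top Q _ (pchain_rcons h pM Q'M nMQ')).
Qed.

Lemma pchain_krull Q Q' n : pchain Q Q' n -> (n <= krull_dim A)%N.
Proof.
move=> h; have [d hd] := pchain_bounded.
have [N [N1 N2 _]] := pchain_seq h.
have [|m [R [R1 R2]]|_] := @nat_maxP [set n | exists Q : nat -> set A,
    (forall i, (i <= n)%N -> prime_ideal (Q i)) /\
    (forall i, (i < n)%N -> Q i `<` Q i.+1)] d.
- by exists n, N.
- exact: (hd _ _ _ (seq_pchain R1 R2)).
- by apply; exists N.
Qed.

(** Parameters modulo [X]. An element of [M] outside those of the finitely many primes of
    [primes_over] that do not contain [M] makes every chain of positive length above it extendable
    downwards, so the bound on lengths drops by one. *)
Lemma sop_over d X : idl A X ->
  (forall Q Q' n, pchain Q Q' n -> X `<=` Q -> (n <= d)%N) ->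
  exists xs : seq A, [/\ size xs = d, forall x, x \in xs -> M x &
    exists c, ipow M c `<=` isp (X `|` [set` xs])].
Proof.
have [iM M1 _] := lM; have pM := loc_prime.
elim: d X => [|d IH] X iX hX.
  exists [::]; split=> //.
  have [ms Em] := nA iM.
  have [||N hN] := @rad_fg A ms X.
  - exact: iX.
  - move=> g gs; apply: contrapT => ng.
    have [||||Q [pQ XQ QS]] := @prime_avoiding A nA [set w | exists n, w = g ^+ n] X.
    + by exists 0%N.
    + by move=> _ _ [n ->] [m ->]; exists (n + m)%N; rewrite exprD.
    + exact: iX.
    + by move=> x Xx [n Ex]; apply: ng; exists n; rewrite -Ex.
    have [iQ Q1 _] := pQ; have QM := loc_proper iQ Q1.
    have [MQ|nMQ] := pselect (M `<=` Q).
      apply: (QS g); last by exists 1%N.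
      by apply: MQ; rewrite Em; exact: sub_sspan.
    by have := hX _ _ _ (PchainS pQ QM nMQ (Pchain0 pM)) XQ.
  exists N; rewrite Em; apply: subset_trans hN _ => x Xx.
  by apply: sub_sspan; left.
have [n [q [q1 q2]]] := primes_over nA iX.
have [x Mx hx] : exists2 x, M x & forall i, (i < n)%N -> ~ (M `<=` q i) -> ~ q i x.
  (* Primes containing [M] are not to be avoided; in the list they are replaced by one that is, if
     there is any. *)
  have [[i0 hi0 nM0]|all] := pselect (exists2 i0, (i0 < n)%N & ~ (M `<=` q i0)).
    have [|x Mx hx] := @prime_avoidance A M n
        (fun i => if `[< M `<=` q i >] then q i0 else q i) iM.
      move=> i hi; case: ifP => [_|/asboolP nM].
        by have [? _] := q1 _ hi0.
      by have [? _] := q1 _ hi.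
    exists x => // i hi nM; have := hx _ hi; case: ifP => // /asboolP h; by case: nM.
  by exists 0; [case: iM|move=> i hi nM; case: all; exists i].
have iX' := sspan_subm idfun (X `|` [set x]); set X' := isp _ in iX'.
have XX' : X `<=` X' by move=> w Xw; apply: sub_sspan; left.
have [|xs [sxs Mxs [c hc]]] := IH X' iX'.
  move=> Q Q' l h X'Q; have [pQ pQ' _] := pchainP h.
  have [i hi qQ] := q2 Q pQ (subset_trans XX' X'Q).
  have [pqi Xqi] := q1 _ hi.
  have [Mq|nMq] := pselect (M `<=` q i).
    case: l h => // l /pchain_inv[R [_ _ nRQ hR]]; exfalso.
    have [[iR R1 _] _ _] := pchainP hR.
    apply: nRQ; apply: subset_trans (loc_proper iR R1) _.
    exact: subset_trans qQ.
  have nQq : ~ (Q `<=` q i).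
    by move=> h'; apply: (hx _ hi nMq); apply: h'; apply: X'Q; apply: sub_sspan; right.
  by have := hX _ _ _ (PchainS pqi qQ nQq h) Xqi.
exists (x :: xs); split; first by rewrite /= sxs.
  by move=> y; rewrite inE => /orP[/eqP->|/Mxs].
exists c; apply: subset_trans hc _; apply: sspan_least; first exact: sspan_subm.
move=> y [|ys]; last by apply: sub_sspan; right; rewrite /= inE; apply/orP; right.
apply: sspan_mono => w [Xw|->]; first by left.
by right; rewrite /= inE eqxx.
Qed.

Lemma sop_exists : exists xs : seq A, [/\ size xs = krull_dim A,
  forall x, x \in xs -> M x & exists c, ipow M c `<=` isp [set` xs]].
Proof.
have i0 : idl A [set 0].
  by split=> // [_ _ -> ->|a _ ->]; rewrite ?addr0 ?mulr0.
have [|xs [h1 h2 [c hc]]] := @sop_over (krull_dim A) [set 0] i0.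
  by move=> Q Q' n h _; exact: pchain_krull h.
exists xs; split=> //; exists c; apply: subset_trans hc _.
apply: sspan_least; first exact: sspan_subm.
move=> x [->|]; last exact: sub_sspan.
by have [] := sspan_subm idfun [set` xs].
Qed.

(** The ideal of [N]-th powers of a system of parameters lies in [M^N], and [bnd_pows] bounds its
    colength. *)
Lemma growth : exists C, forall N,
  bnd (idl A) (ipow M N) setT (C * N ^ krull_dim A)%N.
Proof.
have [xs [sxs Mxs [c hc]]] := sop_exists; have [l bl] := local_len c.
exists l => N.
have i0 : idl A [set 0].
  by split=> // [_ _ -> ->|a _ ->]; rewrite ?addr0 ?mulr0.
have b1 : bnd (idl A) (isp ([set 0] `|` [set` xs])) setT l.
  apply: bnd_sub bl _ _ _ => //; apply: subset_trans hc _.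
  by apply: sspan_mono => x; right.
have b2 := @bnd_pows A _ xs l N i0 b1.
rewrite mulnC -sxs; apply: bnd_sub b2 _ _ _ => //.
apply: sspan_least; first exact: ipow_idl.
move=> x [->|[y yx <-]]; first by have [] := ipow_idl M N.
by apply: ipowX; exact: Mxs.
Qed.

End LocalRings.

Lemma krull_dim_surj (A B : comNzRingType) (M : set A) (f : {rmorphism A -> B}) :
  fin_gen A -> loc M -> (forall b, exists a, f a = b) ->
  (krull_dim B <= krull_dim A)%N.
Proof.
move=> nA lM fsurj.
have key n (Q : nat -> set B) : (forall i, (i <= n)%N -> prime_ideal (Q i)) ->
    (forall i, (i < n)%N -> Q i `<` Q i.+1) -> (n <= krull_dim A)%N.
  move=> h1 h2.
  have : pchain (f @^-1` Q 0%N) (f @^-1` Q n) n.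
    apply: (@seq_pchain A n (fun i => f @^-1` Q i)) => i hi.
      have /prime_idealP [[Q0 Qd Qm] Q1 Qp] := h1 _ hi; apply/prime_idealP.
      split; rewrite /preimage /= ?rmorph1 //; last by move=> x y; rewrite rmorphM; exact: Qp.
      split=> /= [|x y|a x]; first by rewrite rmorph0.
        by rewrite rmorphD; exact: Qd.
      by rewrite rmorphM; exact: Qm.
    have [h3 h4] := h2 _ hi; split; first by move=> x; exact: h3.
    move=> h; apply: h4 => b; have [a <-] := fsurj b; exact: h.
  exact: (pchain_krull nA lM).
have [ex|nex] := pselect (exists n, exists Q : nat -> set B,
    (forall i, (i <= n)%N -> prime_ideal (Q i)) /\
    (forall i, (i < n)%N -> Q i `<` Q i.+1)).
  have [m [R [R1 R2]]|[R [R1 R2]] _] := @nat_maxP [set n | exists Q : nat -> set B,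
    (forall i, (i <= n)%N -> prime_ideal (Q i)) /\
    (forall i, (i < n)%N -> Q i `<` Q i.+1)] (krull_dim A) ex.
    exact: key R1 R2.
  exact: key R1 R2.
(* Without any chain of primes, [krull_dim B] is the default value 0. *)
rewrite /krull_dim /nat_max xgetPN // => n [hn _]; apply: nex; by exists n.
Qed.

(** * Coefficient field and completion *)

Section Frobenius.
Variables (A : comNzRingType) (p : nat).
Hypothesis pA : p \in [pchar A].

Lemma frobD (x y : A) : (x + y) ^+ p = x ^+ p + y ^+ p.
Proof. by rewrite -!(pFrobenius_autE pA) pFrobenius_autD_comm //; exact: mulrC. Qed.

Lemma frobB (x y : A) : (x - y) ^+ p = x ^+ p - y ^+ p.
Proof. by rewrite -!(pFrobenius_autE pA) pFrobenius_autB_comm //; exact: mulrC. Qed.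

Lemma frob0 : (0 : A) ^+ p = 0.
Proof. by rewrite expr0n (negbTE (lt0n_neq0 (prime_gt0 (pcharf_prime pA)))). Qed.

Lemma frobXD n (x y : A) : (x + y) ^+ (p ^ n) = x ^+ (p ^ n) + y ^+ (p ^ n).
Proof.
by elim: n x y => [|n IH] x y; rewrite ?expn0 ?expr1 // expnS !exprM frobD IH.
Qed.

End Frobenius.

(** The minimal polynomial of [c] over [F] divides [X^p - c^p = (X - c)^p], so it is some
    [(X - c)^t]. For [0 < t < p] its coefficient [- t c] would put [c] in [F]; hence [c] has degree
    [p]. *)
Lemma pchar_degree (k : fieldType) (p : nat) (F : set k) (c : k) (d : nat -> k) :
  p \in [pchar k] -> F 1 -> (forall x y, F x -> F y -> F (x - y)) ->
  (forall x y, F x -> F y -> F (x * y)) -> (forall x, F x -> F x^-1) ->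
  F (c ^+ p) -> ~ F c -> (forall j, F (d j)) -> \sum_(j < p) d j * c ^+ j = 0 ->
  forall j, (j < p)%N -> d j = 0.
Proof.
move=> pk F1 Fs FM Fv Fcp nFc Fd Ed.
have F0 : F 0 by rewrite -(subrr 1); exact: Fs.
have FN x : F x -> F (- x) by move=> Fx; rewrite -sub0r; exact: Fs.
have FD x y : F x -> F y -> F (x + y).
  by move=> Fx Fy; rewrite -[y]opprK; apply: Fs => //; exact: FN.
pose FP (g : {poly k}) := forall i, F g`_i.
pose P r := `[< exists g, [/\ FP g, g.[c] = 0, g != 0 & size g = r] >].
suff nP r : P r -> (p < r)%N.
  pose g := \poly_(j < p) d j.
  have [g0|gN0] := eqVneq g 0.
    by move=> j jp; have := coef_poly p d j; rewrite -/g g0 coef0 jp.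
  have /nP : P (size g).
    apply/asboolP; exists g; split=> //.
      by move=> i; rewrite coef_poly; case: ifP.
    by rewrite horner_poly.
  by rewrite ltnNge size_poly.
move=> Pr; have exP : exists r, P r by exists r.
have [m /asboolP [g [Fg gc gN0 sg]] mmin] := ex_minnP exP.
apply: leq_trans (mmin _ Pr); rewrite ltnNge; apply/negP => mp.
pose f := (lead_coef g)^-1 *: g.
have lg0 : lead_coef g != 0 by rewrite lead_coef_eq0.
have Ff : FP f by move=> i; rewrite coefZ; apply: FM => //; exact/Fv/Fg.
have fc : f.[c] = 0 by rewrite hornerZ gc mulr0.
have sf : size f = m by rewrite size_scale ?invr_eq0.
have fm : f \is monic by rewrite monicE lead_coefZ mulVf.
(* Division by the monic [f], carried out so that the remainders visibly keep their coefficients in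
   [F]. *)
have fdiv h : FP h -> h.[c] = 0 -> f %| h.
  have [n] := ubnP (size h); elim: n h => // n IH h hn Fh hc.
  have [->|hN0] := eqVneq h 0; first exact: dvdp0.
  have mh : (m <= size h)%N by apply: mmin; apply/asboolP; exists h.
  have [e [se he]] : exists e, size ('X^e * f) = size h /\ e = (size h - m)%N.
    exists (size h - m)%N; split=> //.
    by rewrite size_monicM ?monicXn ?monic_neq0 // size_polyXn sf addSn /= subnK.
  have le : ('X^e * f)`_(size h).-1 = 1.
    by rewrite -se -lead_coefE; apply/monicP; rewrite monicMl ?monicXn.
  pose h' := h - lead_coef h *: ('X^e * f).
  have Fh' : FP h'.
    move=> i; rewrite coefB coefZ coefXnM; apply: Fs => //; apply: FM; first exact: Fh.
    by case: ifP.
  have hc' : h'.[c] = 0 by rewrite hornerD hornerN hornerZ hornerM fc hc !mulr0 subr0.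
  have fh' : f %| h'.
    apply: IH => //; rewrite -ltnS; apply: leq_trans hn; rewrite ltnS.
    rewrite -[X in (_ < X)%N](prednK (n := size h)) ?size_poly_gt0 // ltnS.
    apply/leq_sizeP => j; rewrite leq_eqVlt => /orP[/eqP <-|hj].
      by rewrite coefB coefZ le mulr1 -lead_coefE subrr.
    rewrite prednK ?size_poly_gt0 // in hj.
    by rewrite coefB coefZ !nth_default ?mulr0 ?subr0 // se.
  rewrite -[h](subrK (lead_coef h *: ('X^e * f))); apply: dvdp_add => //.
  by rewrite -mul_polyC; apply: dvdp_mull; apply: dvdp_mull; exact: dvdpp.
have : f %| ('X - c%:P) ^+ p.
  have pP : p \in [pchar {poly k}] by rewrite pchar_poly.
  rewrite (frobB pP); apply: fdiv; last by rewrite hornerD hornerN hornerXn -rmorphXn hornerC subrr.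
  move=> i; rewrite coefB coefXn -rmorphXn coefC; apply: Fs.
    by case: (i == p).
  by case: (i == 0%N).
move/dvdp_exp_XsubCP => [t _].
rewrite eqp_monic //; last by apply: monic_exp; exact: monicXsubC.
move/eqP => Ef.
have sr : m = t.+1 by rewrite -sf Ef size_exp_XsubC.
have r0 : (0 < t)%N.
  rewrite lt0n; apply/eqP => r0; move/eqP: fc.
  by rewrite Ef r0 expr0 hornerC oner_eq0.
have rp : (t < p)%N by rewrite -sr.
have Fr n : F n%:R by elim: n => [|n IH] //; rewrite -addn1 natrD; exact: FD.
have rN0 : (t%:R : k) != 0.
  by rewrite -(dvdn_pcharf pk) gtnNdvd.
apply: nFc.
have : F (c *+ t).
  rewrite -[_ *+ _]opprK; apply: FN; have := Ff t.-1.
  rewrite Ef (_ : ('X - c%:P) ^+ t = \prod_(x <- nseq t c) ('X - x%:P)).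
    rewrite -{2}(size_nseq t c) coefPn_prod_XsubC ?size_nseq -?lt0n //.
    by rewrite big_nseq iter_addr_0.
  by rewrite big_nseq iter_mulr_1.
rewrite -mulr_natl => h.
by rewrite -[c](mulKf rN0); apply: FM => //; exact: Fv.
Qed.

Section CoefficientRings.
Variables (A : comNzRingType) (k : fieldType) (f : {rmorphism A -> k}) (p : nat).
Variable M : set A.
Hypotheses (pA : p \in [pchar A]) (lM : loc M) (fM : forall x, M x <-> f x = 0).
Implicit Types (X Y Z D L : set A) (l : seq A).

Definition sring D := [/\ D 1, forall x y, D x -> D y -> D (x - y)
                         & forall x y, D x -> D y -> D (x * y)].

Lemma sring0 D : sring D -> D 0.
Proof. by move=> [D1 Ds _]; rewrite -(subrr 1); exact: Ds. Qed.

Lemma sringN D x : sring D -> D x -> D (- x).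
Proof. by move=> sD Dx; rewrite -sub0r; case: (sD) => _ Ds _; apply: Ds => //; exact: sring0. Qed.

Lemma sringD D x y : sring D -> D x -> D y -> D (x + y).
Proof.
by move=> sD Dx Dy; rewrite -[y]opprK; case: (sD) => _ Ds _; apply: Ds => //; exact: sringN.
Qed.

Lemma sringX D x n : sring D -> D x -> D (x ^+ n).
Proof.
move=> [D1 _ Dm] Dx; elim: n => [|n IH]; first by rewrite expr0.
by rewrite exprS; exact: Dm.
Qed.

Lemma sring_sum D (I : Type) (r : seq I) (P : pred I) (F : I -> A) :
  sring D -> (forall i, P i -> D (F i)) -> D (\sum_(i <- r | P i) F i).
Proof.
by move=> sD h; elim/big_ind: _ => //; [exact: sring0|move=> *; exact: sringD].
Qed.

Definition rgen X : set A := [set z | forall D, sring D -> X `<=` D -> D z].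

Lemma rgen_sring X : sring (rgen X).
Proof.
split.
- by move=> D [].
- by move=> x y hx hy D sD XD; case: (sD) => _ Ds _; apply: Ds; [exact: hx|exact: hy].
- by move=> x y hx hy D sD XD; case: (sD) => _ _ Dm; apply: Dm; [exact: hx|exact: hy].
Qed.

Lemma sub_rgen X : X `<=` rgen X. Proof. by move=> x Xx D _; exact. Qed.

Lemma rgen_least X D : sring D -> X `<=` D -> rgen X `<=` D.
Proof. by move=> sD XD z; exact. Qed.

Lemma rgen_mono X Y : X `<=` Y -> rgen X `<=` rgen Y.
Proof.
move=> XY; apply: rgen_least; first exact: rgen_sring.
exact: subset_trans (@sub_rgen Y).
Qed.

(* The image of [kring L] in the residue field k is k^p(L). The ring [dring n L] is
   generated by p^n-th powers and lifts of L, so that its elements in M lie in M^n; a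
   coefficient field is obtained as a limit of such rings for a p-basis L. *)
Definition pows q : set A := [set a ^+ q | a in setT].
Definition dring n L := rgen (pows (p ^ n) `|` L).
Definition kring L := rgen (pows p `|` L `|` M).

Lemma kring_sring L : sring (kring L). Proof. exact: rgen_sring. Qed.

Lemma kring_pow L a : kring L (a ^+ p).
Proof. by apply: sub_rgen; left; left; exists a. Qed.

Lemma kringM L a : M a -> kring L a.
Proof. by move=> Ma; apply: sub_rgen; right. Qed.

(** All [p]-th powers lie in [kring L], and the inverse of [a] is [b ^+ p * a ^+ p.-1]. *)
Lemma kring_inv L a b : b * a = 1 -> kring L a -> kring L b.
Proof.
move=> ba ka; have p0 := prime_gt0 (pcharf_prime pA).
rewrite (_ : b = b ^+ p * a ^+ p.-1).
  by have [_ _ h] := kring_sring L; apply: h; [exact: kring_pow|exact: (sringX _ (kring_sring L))].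
by rewrite -(prednK p0) exprS -mulrA -exprMn ba expr1n mulr1.
Qed.

(* Field-theoretic meaning: [c] has degree [p] over the image of [kring L]. *)
Lemma kring_degree L c (d : nat -> A) : ~ kring L c -> (forall j, kring L (d j)) ->
  M (\sum_(j < p) d j * c ^+ j) -> forall j, (j < p)%N -> M (d j).
Proof.
move=> nc kd Md j jp; apply/fM.
have sK := kring_sring L; have [K1 Ks Km] := sK.
have pk : p \in [pchar k] by exact: rmorph_pchar pA.
pose F : set k := [set f a | a in kring L].
have FE a : F (f a) -> kring L a.
  move=> [b kb E]; rewrite -[a](subrK b); apply: (sringD sK) => //.
  by apply: kringM; apply/fM; rewrite rmorphB E subrr.
apply: (@pchar_degree k p F (f c) (fun j => f (d j)) pk) => //.
- by exists 1 => //; rewrite rmorph1.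
- by move=> _ _ [a ka <-] [b kb <-]; exists (a - b); [exact: Ks|rewrite rmorphB].
- by move=> _ _ [a ka <-] [b kb <-]; exists (a * b); [exact: Km|rewrite rmorphM].
- move=> _ [a ka <-]; have [Ma|nMa] := pselect (M a).
    by move/fM: Ma => ->; rewrite invr0; exists 0; [exact: (sring0 sK)|rewrite rmorph0].
  have [_ _ u] := lM; have [b ba] := u _ nMa.
  exists b; first exact: kring_inv ba ka.
  apply: (mulIf (x := f a)); first by apply/eqP => /fM.
  rewrite mulVf; last by apply/eqP => /fM.
  by rewrite -rmorphM ba rmorph1.
- by rewrite -rmorphXn; exists (c ^+ p) => //; exact: kring_pow.
- by move=> /FE.
- by move=> i; exists (d i).
- have /fM := Md; rewrite rmorph_sum => E; rewrite -[RHS]E.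
  by apply: eq_bigr => i _; rewrite rmorphM rmorphXn.
Qed.

(** [p]-independence of the residues of [L] over the [p]-th powers of the residue field. *)
Definition pindep L := forall c, L c -> ~ kring (L `\ c) c.

(** An element of a generated ring involves finitely many generators, hence a single member of a
    totally ordered family. This is the upper bound needed for Zorn's lemma. *)
Lemma rgen_cup (Fm : set (set A)) X : (exists L, Fm L) -> total_on Fm subset ->
  forall (g : set A -> set A), (forall L L', L `<=` L' -> g L `<=` g L') ->
  rgen (X `|` [set z | exists2 L, Fm L & g L z]) `<=`
    [set z | exists2 L, Fm L & rgen (X `|` g L) z].
Proof.
move=> [L0 FL0] tot g gm.
have two L L' : Fm L -> Fm L' -> exists2 L2, Fm L2 &
    rgen (X `|` g L) `<=` rgen (X `|` g L2) /\ rgen (X `|` g L') `<=` rgen (X `|` g L2).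
  move=> FL FL'; have [LL'|L'L] := tot _ _ FL FL'.
    by exists L' => //; split=> //; apply: rgen_mono => z [Xz|/(gm _ _ LL') gz]; [left|right].
  by exists L => //; split=> //; apply: rgen_mono => z [Xz|/(gm _ _ L'L) gz]; [left|right].
apply: rgen_least.
  split.
  - by exists L0 => //; have [] := rgen_sring (X `|` g L0).
  - move=> x y [L FL hx] [L' FL' hy]; have [L2 FL2 [h1 h2]] := two _ _ FL FL'.
    exists L2 => //; have [_ h _] := rgen_sring (X `|` g L2).
    by apply: h; [exact: h1|exact: h2].
  - move=> x y [L FL hx] [L' FL' hy]; have [L2 FL2 [h1 h2]] := two _ _ FL FL'.
    exists L2 => //; have [_ _ h] := rgen_sring (X `|` g L2).
    by apply: h; [exact: h1|exact: h2].
move=> z [Xz|[L FL gz]]; first by exists L0 => //; apply: sub_rgen; left.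
by exists L => //; apply: sub_rgen; right.
Qed.

(** [c ^+ p] already lies in [kring L], so powers of [c] below [p] suffice. *)
Lemma kring_adj L c : kring (L `|` [set c]) `<=`
  [set z | exists d : nat -> A, (forall j, kring L (d j)) /\
     z = \sum_(j < p) d j * c ^+ j].
Proof.
have sK := kring_sring L; have [K1 Ks Km] := sK.
have p0 := prime_gt0 (pcharf_prime pA).
set Z := [set z | _].
have KZ z : kring L z -> Z z.
  move=> kz; exists (fun j => if j == 0%N then z else 0); split.
    by move=> j; case: ifP => // _; exact: (sring0 sK).
  rewrite (bigD1 (Ordinal p0)) //= mulr1 big1 ?addr0 // => i.
  by rewrite -val_eqE /= => /negbTE ->; rewrite mul0r.
have Zs x y : Z x -> Z y -> Z (x - y).
  move=> [d [kd ->]] [e [ke ->]]; exists (fun j => d j - e j); split.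
    by move=> j; exact: Ks.
  by rewrite -sumrB; apply: eq_bigr => i _; rewrite mulrBl.
have Z0 : Z 0 by apply: KZ; exact: (sring0 sK).
have ZD x y : Z x -> Z y -> Z (x + y).
  by move=> Zx Zy; rewrite -[y]opprK; apply: (Zs) => //; rewrite -sub0r; exact: Zs.
have ZK x y : kring L x -> Z y -> Z (x * y).
  move=> kx [d [kd ->]]; exists (fun j => x * d j); split; first by move=> j; exact: Km.
  by rewrite mulr_sumr; apply: eq_bigr => i _; rewrite mulrA.
have Zc y : Z y -> Z (c * y).
  move=> [d [kd ->]]; exists (fun j => if j is j'.+1 then d j' else d p.-1 * c ^+ p); split.
    move=> [|j] //; apply: Km => //; exact: kring_pow.
  rewrite -(prednK p0) big_ord_recr big_ord_recl /= mulr1 addrC mulrDr mulr_sumr.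
  congr (_ + _); first by rewrite mulrCA -exprS.
  by apply: eq_bigr => i _; rewrite mulrCA -exprS.
have Zcn n y : Z y -> Z (c ^+ n * y).
  elim: n y => [|n IH] y Zy; first by rewrite mul1r.
  by rewrite exprS -mulrA; apply: Zc; exact: IH.
apply: rgen_least.
  split; first exact: KZ.
    exact: Zs.
  move=> x y [d [kd ->]] Zy; rewrite mulr_suml.
  elim/big_ind: _ => // i _; rewrite -mulrA; apply: ZK => //; exact: Zcn.
move=> z [[hz|[Lz|->]]|Mz]; try (by apply: KZ; apply: sub_rgen; [left; left|left; right|right]).
- by apply: KZ; apply: sub_rgen; left; left.
- by apply: KZ; apply: sub_rgen; left; right.
- by rewrite -[c]mulr1; apply: Zc; exact: KZ.
- by apply: KZ; exact: kringM.
Qed.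

(** Expand [a] in powers of [c]. If [c] stayed outside after adjoining [a], independence of its
    powers would put all nonconstant coefficients in [M] and so [a] in [kring L]. *)
Lemma kring_exchange L a c : ~ kring L a -> kring (L `|` [set c]) a ->
  kring (L `|` [set a]) c.
Proof.
move=> na /kring_adj [d [kd Ea]]; apply: contrapT => nc.
have p0 := prime_gt0 (pcharf_prime pA).
have sK := kring_sring (L `|` [set a]).
have Lm : kring L `<=` kring (L `|` [set a]).
  by apply: rgen_mono => z [[h|h]|h]; [left; left|left; right; left|right].
have ka : kring (L `|` [set a]) a by apply: sub_rgen; left; right; right.
pose e j := if j == 0%N then d 0%N - a else d j.
have ke j : kring (L `|` [set a]) (e j).
  by rewrite /e; case: eqP => _; [case: sK => _ h _; apply: h => //; exact: Lm|exact: Lm].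
have Me : M (\sum_(j < p) e j * c ^+ j).
  have -> : \sum_(j < p) e j * c ^+ j = 0; last by case: lM => -[].
  rewrite (bigD1 (Ordinal p0)) //= mulr1 /e /=.
  move: Ea; rewrite (bigD1 (Ordinal p0)) //= mulr1 => Ea.
  rewrite (eq_bigr (fun i : 'I_p => d i * c ^+ i)).
    by apply/eqP; rewrite addrAC subr_eq0; apply/eqP; exact: esym Ea.
  by move=> i; rewrite -val_eqE /= => /negbTE ->.
have Mej := kring_degree nc ke Me.
apply: na; rewrite Ea (bigD1 (Ordinal p0)) //= mulr1.
apply: (sringD (kring_sring L)) => //; apply: kringM.
have iM : idl A M by case: lM.
apply: (subm_sum _ iM) => i; rewrite -val_eqE /= => i0.
apply: (idlMr _ iM); have := Mej i (ltn_ord i); by rewrite /e (negbTE i0).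
Qed.

Lemma pbasis_exists : exists L, pindep L /\ forall c, kring L c.
Proof.
have [L [pL maxL]] : exists L, pindep L /\ forall L', L `<` L' -> ~ pindep L'.
  apply: Zorn_bigcup => Fm FP tot c [L FL Lc] hc.
  have h : kring ((\bigcup_(X in Fm) X) `\ c) `<=`
      rgen (pows p `|` M `|` [set z | exists2 L, Fm L & (L `\ c) z]).
    apply: rgen_mono => z [[h|[[L' FL' L'z] zc]]|h]; [by left; left| |by left; right].
    by right; exists L'.
  have [||L' FL' hL'] := rgen_cup (X := pows p `|` M) _ tot (g := fun L => L `\ c) _ (h _ hc).
  - by exists L.
  - by move=> U V UV z [Uz zc]; split=> //; exact: UV.
  have hk U : rgen (pows p `|` M `|` (U `\ c)) `<=` kring (U `\ c).
    by apply: rgen_mono => z [[h1|h1]|h1]; [left; left|right|left; right].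
  have mono U V : U `<=` V -> kring (U `\ c) `<=` kring (V `\ c).
    move=> UV; apply: rgen_mono => z [[h1|[h1 h2]]|h1]; [by left; left| |by right].
    by left; right; split=> //; exact: UV.
  have [LL'|L'L] := tot _ _ FL FL'.
    by apply: (FP _ FL' c (LL' _ Lc)); exact: hk.
  by apply: (FP _ FL c Lc); apply: (mono L'); [exact: L'L|exact: hk].
exists L; split=> // c; apply: contrapT => nc.
have nLc : ~ L c by move=> Lc; apply: nc; apply: sub_rgen; left; right.
apply: (maxL (L `|` [set c])).
  split; first by move=> z; left.
  by move=> h; apply: nLc; apply: h; right.
move=> a [La|->]; last first.
  move=> h; apply: nc; move: h; apply: rgen_mono => z [[h|[[h|h] h']]|h].
  - by left; left.
  - by left; right.
  - by case: h'.
  - by right.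
have ac : a <> c by move=> E; apply: nLc; rewrite -E.
move=> h; have h' : kring ((L `\ a) `|` [set c]) a.
  move: h; apply: rgen_mono => z [[h|[[h|h] h']]|h].
  - by left; left.
  - by left; right; left.
  - by left; right; right.
  - by right.
have := kring_exchange (pL _ La) h'.
move=> h2; apply: nc; move: h2; apply: rgen_mono => z [[h2|[[h2 _]|->]]|h2].
- by left; left.
- by left; right.
- by left; right.
- by right.
Qed.

(** Nested expansions, one element of [l] at a time, so that [kring_degree] applies to each element
    over the others. *)
Fixpoint rcomb Z l : set A :=
  if l is x :: l' then
    [set z | exists c : nat -> A, (forall j, rcomb Z l' (c j)) /\
                z = \sum_(j < p) c j * x ^+ j]
  else [set w ^+ p | w in Z].

Lemma rcomb_sring Z l : sring Z -> {subset l <= Z} -> sring (rcomb Z l) /\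
  forall w, Z w -> rcomb Z l (w ^+ p).
Proof.
move=> sZ; have [Z1 Zs Zm] := sZ; have p0 := prime_gt0 (pcharf_prime pA).
elim: l => [|x l IH] lZ.
  split; last by move=> w Zw; exists w.
  split; first by exists 1 => //; rewrite expr1n.
    by move=> _ _ [a Za <-] [b Zb <-]; exists (a - b); [exact: Zs|exact: (frobB pA)].
  by move=> _ _ [a Za <-] [b Zb <-]; exists (a * b); [exact: Zm|exact: exprMn].
have [sR Rp] := IH (fun y yl => lZ y (@mem_behead _ (x :: l) y yl)).
have [R1 Rs Rm] := sR.
set R := rcomb Z (x :: l).
have KZ z : rcomb Z l z -> R z.
  move=> kz; exists (fun j => if j == 0%N then z else 0); split.
    by move=> j; case: ifP => // _; exact: (sring0 sR).
  rewrite (bigD1 (Ordinal p0)) //= mulr1 big1 ?addr0 // => i.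
  by rewrite -val_eqE /= => /negbTE ->; rewrite mul0r.
have RRs a b : R a -> R b -> R (a - b).
  move=> [d [kd ->]] [e [ke ->]]; exists (fun j => d j - e j); split.
    by move=> j; apply: Rs; [exact: kd|exact: ke].
  by rewrite -sumrB; apply: eq_bigr => i _; rewrite mulrBl.
have R0 : R 0 by apply: KZ; exact: (sring0 sR).
have RD a b : R a -> R b -> R (a + b).
  by move=> Ra Rb; rewrite -[b]opprK; apply: (RRs) => //; rewrite -sub0r; exact: RRs.
have RK a b : rcomb Z l a -> R b -> R (a * b).
  move=> kx [d [kd ->]]; exists (fun j => a * d j); split; first by move=> j; apply: Rm => //; exact: kd.
  by rewrite mulr_sumr; apply: eq_bigr => i _; rewrite mulrA.
have Zx : Z x by apply/set_mem/lZ; rewrite inE eqxx.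
have Rc y : R y -> R (x * y).
  move=> [d [kd ->]]; exists (fun j => if j is j'.+1 then d j' else d p.-1 * x ^+ p); split.
    by move=> [|j]; [apply: Rm; [exact: kd|exact: Rp]|exact: kd].
  rewrite -(prednK p0) big_ord_recr big_ord_recl /= mulr1 addrC mulrDr mulr_sumr.
  congr (_ + _); first by rewrite mulrCA -exprS.
  by apply: eq_bigr => i _; rewrite mulrCA -exprS.
have Rcn n y : R y -> R (x ^+ n * y).
  elim: n y => [|n IHn] y Ry; first by rewrite mul1r.
  by rewrite exprS -mulrA; apply: Rc; exact: IHn.
split; last by move=> w Zw; apply: KZ; exact: Rp.
split; [exact: KZ|exact: RRs|].
move=> a b [d [kd ->]] Rb; rewrite mulr_suml.
elim/big_ind: _ => // i _; rewrite -mulrA; apply: RK; [exact: kd|exact: Rcn].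
Qed.

Lemma rcomb_gens Z l x : sring Z -> {subset l <= Z} -> x \in l -> rcomb Z l x.
Proof.
move=> sZ; elim: l => // y l IH lZ.
have lZ' : {subset l <= Z} by move=> w wl; apply: lZ; rewrite inE wl orbT.
have [sR Rp] := rcomb_sring sZ lZ'; have p1 := prime_gt1 (pcharf_prime pA).
rewrite inE => /orP[/eqP->|xl].
  exists (fun j => (j == 1%N)%:R); split.
    by move=> j; case: (j == 1%N); [case: sR|exact: (sring0 sR)].
  rewrite (bigD1 (Ordinal p1)) //= mul1r expr1 big1 ?addr0 // => i.
  by rewrite -val_eqE /= => /negbTE ->; rewrite mul0r.
exists (fun j => if j == 0%N then x else 0); split.
  by move=> j; case: ifP => // _; [exact: IH|exact: (sring0 sR)].
have p0 := ltnW p1.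
rewrite (bigD1 (Ordinal p0)) //= mulr1 big1 ?addr0 // => i.
by rewrite -val_eqE /= => /negbTE ->; rewrite mul0r.
Qed.

Lemma rcomb_kring Z l : rcomb Z l `<=` kring [set` l].
Proof.
elim: l => [|x l IH] z; first by move=> [w _ <-]; exact: kring_pow.
move=> [c [hc ->]]; have sK := kring_sring [set` x :: l].
apply: (sring_sum _ sK) => i _; have [_ _ Km] := sK; apply: Km.
  have := IH _ (hc i); apply: rgen_mono => y [[h|h]|h]; [by left; left| |by right].
  by left; right; rewrite /= inE; apply/orP; right.
by apply: (sringX _ sK); apply: sub_rgen; left; right; rewrite /= inE eqxx.
Qed.

(** By [kring_degree] an expansion with value in [M] has all coefficients in [M]; after all elements
    of [l] are peeled off, [p]-th powers of elements of [M] remain. *)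
Lemma rcomb_max L Z l z : pindep L -> uniq l -> {subset l <= L} -> rcomb Z l z ->
  M z -> isp [set w ^+ p | w in Z `&` M] z.
Proof.
have pM := loc_prime lM; have [iM M1 Mp] := pM.
move=> pL; elim: l z => [|x l IH] z.
  move=> _ _ [w Zw <-] Mw; apply: sub_sspan; exists w => //; split=> //.
  by elim: (p) Mw => [|n IH]; rewrite ?expr0 // exprS => /Mp[].
move=> /= /andP[xl ul] lL [c [hc ->]] Mz.
have lL' : {subset l <= L} by move=> y yl; apply: lL; rewrite inE yl orbT.
have Lx : L x by apply/set_mem/lL; rewrite inE eqxx.
have kc j : kring (L `\ x) (c j).
  apply: (rgen_mono _ (rcomb_kring (hc j))) => y [[h|h]|h]; [by left; left| |by right].
  left; right; split; first exact/set_mem/lL'.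
  by move=> E; move: xl; rewrite -E => /negP; apply.
have Mc := kring_degree (pL _ Lx) kc Mz.
have iS := sspan_subm idfun [set w ^+ p | w in Z `&` M].
apply: (subm_sum _ iS) => i _; apply: (idlMr _ iS).
by apply: IH => //; exact: Mc.
Qed.

Lemma dring_seq n L z : dring n L z -> exists l,
  [/\ uniq l, {subset l <= L} & dring n [set` l] z].
Proof.
have mono l l' : {subset l <= l'} -> dring n [set` l] `<=` dring n [set` l'].
  by move=> ll; apply: rgen_mono => w [h|h]; [left|right; exact: ll].
have two l l' : {subset l <= L} -> {subset l' <= L} -> exists l2,
    [/\ uniq l2, {subset l2 <= L}, dring n [set` l] `<=` dring n [set` l2] &
    dring n [set` l'] `<=` dring n [set` l2]].
  move=> h1 h2; exists (undup (l ++ l')); split.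
  - exact: undup_uniq.
  - by move=> w; rewrite mem_undup mem_cat => /orP[/h1|/h2].
  - by apply: mono => w wl; rewrite mem_undup mem_cat wl.
  - by apply: mono => w wl; rewrite mem_undup mem_cat wl orbT.
move=> hz; apply: (rgen_least (D := [set z | exists l,
  [/\ uniq l, {subset l <= L} & dring n [set` l] z]]) _ _ hz).
  split.
  - by exists [::]; split=> //; have [] := rgen_sring (pows (p ^ n) `|` [set` [::]]).
  - move=> x y [l [ul lL hx]] [l' [ul' lL' hy]]; have [l2 [h1 h2 h3 h4]] := two _ _ lL lL'.
    exists l2; split=> //; have [_ h _] := rgen_sring (pows (p ^ n) `|` [set` l2]).
    by apply: h; [exact: h3|exact: h4].
  - move=> x y [l [ul lL hx]] [l' [ul' lL' hy]]; have [l2 [h1 h2 h3 h4]] := two _ _ lL lL'.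
    exists l2; split=> //; have [_ _ h] := rgen_sring (pows (p ^ n) `|` [set` l2]).
    by apply: h; [exact: h3|exact: h4].
move=> w [h|h]; first by exists [::]; split=> //; apply: sub_rgen; left.
exists [:: w]; split=> //; first by move=> v; rewrite inE => /eqP ->; exact: mem_set.
by apply: sub_rgen; right; rewrite /= inE.
Qed.

Lemma dring_rcomb n l : dring n.+1 [set` l] `<=` rcomb (dring n [set` l]) l.
Proof.
have sZ := rgen_sring (pows (p ^ n) `|` [set` l]).
have lZ : {subset l <= dring n [set` l]}.
  by move=> x xl; apply/mem_set; apply: sub_rgen; right.
have [sR Rp] := rcomb_sring sZ lZ.
apply: (rgen_least sR) => z [[a _ <-]|zl]; last exact: rcomb_gens.
rewrite expnSr exprM; apply: Rp; apply: sub_rgen; left; by exists a.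
Qed.

(** Each step from [n] to [n.+1] expands over [p]-th powers of the previous ring, so the exponent
    [p^n] accumulates. *)
Lemma dring_max L n z : pindep L -> dring n L z -> M z ->
  isp [set w ^+ (p ^ n) | w in M] z.
Proof.
move=> pL /dring_seq[l [ul lL]]; elim: n z => [|n IH] z hz Mz.
  by apply: sub_sspan; exists z => //; rewrite expn0 expr1.
have := rcomb_max pL ul lL (dring_rcomb hz) Mz.
have iS := sspan_subm idfun [set w ^+ (p ^ n.+1) | w in M].
apply: (sspan_least iS) => _ [w [Zw Mw] <-].
have : [set w | isp [set w ^+ (p ^ n.+1) | w in M] (w ^+ p)] w; last by [].
apply: (sspan_least _ _ (IH _ Zw Mw)).
  have [S0 Sd Sm] := iS; split=> /=.
  - by rewrite (frob0 pA).
  - by move=> x y hx hy; rewrite (frobD pA); exact: Sd.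
  - by move=> a x hx; rewrite exprMn; exact: Sm.
by move=> _ [v Mv <-] /=; rewrite -exprM -expnSr; apply: sub_sspan; exists v.
Qed.

(** A set generating the residue field over its [p]-th powers generates it, by iteration, over its
    [p^n]-th powers. *)
Lemma dring_dense L n a : (forall c, kring L c) -> exists2 d, dring n L d & M (a - d).
Proof.
move=> kL; have iM : idl A M by case: lM.
have gM := subm_sgrp iM; have [M0 Ms] := gM; have [_ Md Mm] := iM.
elim: n a => [|n IH] a.
  by exists a; [apply: sub_rgen; left; exists a => //; rewrite expn0 expr1|rewrite subrr].
set G := dring n.+1 L; have sG : sring G by exact: rgen_sring.
have [G1 Gs Gm] := sG.
apply: (rgen_least (D := [set a | exists2 d, G d & M (a - d)]) _ _ (kL a)).
  split.
  - by exists 1 => //; rewrite subrr.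
  - move=> x y [d Gd Mx] [e Ge My]; exists (d - e); first exact: Gs.
    by rewrite (_ : x - y - (d - e) = (x - d) - (y - e)); [exact: Ms|ring].
  - move=> x y [d Gd Mx] [e Ge My]; exists (d * e); first exact: Gm.
    rewrite (_ : x * y - d * e = (x - d) * y + d * (y - e)); last ring.
    by apply: Md; [exact: (idlMr _ iM)|exact: (idlM _ iM)].
move=> z [[[b _ <-]|Lz]|Mz].
- have [d Dd Mbd] := IH b; exists (d ^+ p).
    apply: (rgen_least (D := [set d | G (d ^+ p)]) _ _ Dd).
      split=> /= [|x y hx hy|x y hx hy]; first by rewrite expr1n.
        by rewrite (frobB pA); exact: Gs.
      by rewrite exprMn; exact: Gm.
    move=> w [[v _ <-]|Lw] /=.
      by rewrite -exprM -expnSr; apply: sub_rgen; left; exists v.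
    by apply: (sringX _ sG); apply: sub_rgen; right.
  rewrite -(frobB pA) -(prednK (prime_gt0 (pcharf_prime pA))) exprS.
  exact: (idlMr _ iM).
- by exists z; [apply: sub_rgen; right|rewrite subrr].
- by exists 0; [exact: (sring0 sG)|rewrite subr0].
Qed.

Lemma dring_anti L n : dring n.+1 L `<=` dring n L.
Proof.
apply: rgen_least; first exact: rgen_sring.
move=> z [[a _ <-]|Lz]; last by apply: sub_rgen; right.
by rewrite expnS exprM; apply: sub_rgen; left; exists (a ^+ p).
Qed.

Lemma coef_rings : exists D : nat -> set A, [/\ forall n, sring (D n),
  forall n, D n.+1 `<=` D n, forall n a, exists2 d, D n d & M (a - d) &
  forall n d, D n d -> M d -> ipow M n d].
Proof.
have [L [pL kL]] := pbasis_exists.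
exists (fun n => dring n L); split.
- by move=> n; exact: rgen_sring.
- by move=> n; exact: dring_anti.
- by move=> n a; exact: dring_dense.
- move=> n d Dd Md; have := dring_max pL Dd Md.
  have iN := ipow_idl M n; apply: (sspan_least iN) => _ [w Mw <-].
  apply: (@ipow_anti _ M n (p ^ n)); first by apply/ltnW/ltn_expl/prime_gt1/(pcharf_prime pA).
  exact: ipowX.
Qed.

End CoefficientRings.

(** * Subquotient rings and completion *)

Section SubQuotient.
Variables (R : comNzRingType) (D N : set R).
Hypotheses (sD : sring D) (N0 : N 0) (NB : forall x y, N x -> N y -> N (x - y)).
Hypotheses (NM : forall a x, D a -> N x -> N (a * x)) (N1 : ~ N 1).
Local Open Scope quotient_scope.

Definition sq_pred : {pred R} := [in D].

Fact sq_subring : subring_closed sq_pred.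
Proof.
have [D1 Ds Dm] := sD; split; first exact: mem_set.
  by move=> x y /set_mem hx /set_mem hy; apply/mem_set/Ds.
by move=> x y /set_mem hx /set_mem hy; apply/mem_set/Dm.
Qed.

HB.instance Definition _ := GRing.isSubringClosed.Build R sq_pred sq_subring.

Record sq_sub : Type := SqSub { sq_val :> R; _ : sq_val \in sq_pred }.

HB.instance Definition _ := [isSub for sq_val].
HB.instance Definition _ := [Choice of sq_sub by <:].
HB.instance Definition _ := [SubChoice_isSubComNzRing of sq_sub by <:].

Definition sq_ideal : {pred sq_sub} := fun x => (val x : R) \in N.

Fact sq_idealr : idealr_closed sq_ideal.
Proof.
have ND x y : N x -> N y -> N (x + y).
  by move=> Nx Ny; rewrite -[y]opprK -[- y]sub0r; apply: (NB Nx); exact: NB.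
split; rewrite /sq_ideal ?unfold_in.
- by rewrite rmorph0; exact: mem_set.
- by rewrite rmorph1; apply/negP => /set_mem.
- move=> a x y; rewrite !unfold_in => /set_mem hx /set_mem hy; apply/mem_set.
  have -> : val (a * x + y) = val a * val x + val y :> R by rewrite rmorphD rmorphM.
  by apply: ND => //; apply: NM => //; exact/set_mem/(valP a).
Qed.

HB.instance Definition _ := isIdealr.Build sq_sub sq_ideal sq_idealr.

Definition sq_quot : comNzRingType := @Quotient.quot sq_sub sq_ideal.

Local Notation Q := (@Quotient.quot sq_sub sq_ideal).

Lemma subquotient_aux : exists pi : R -> sq_quot, [/\ pi 1 = 1,
  forall x y, D x -> D y -> pi (x - y) = pi x - pi y /\ pi (x * y) = pi x * pi y,
  forall z, exists2 x, D x & pi x = z & forall x, D x -> (pi x = 0 <-> N x)].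
Proof.
have pi_eq (u v : sq_sub) : (\pi_Q u = \pi_Q v) <-> N (val u - val v).
  have vB : val u - val v = val (u - v) :> R by rewrite rmorphB.
  split=> [/eqP|h]; first by rewrite -Quotient.idealrBE unfold_in vB => /set_mem.
  apply/eqP; rewrite -Quotient.idealrBE unfold_in; apply/mem_set; by rewrite -vB.
have [D1 Ds Dm] := sD.
pose lift x : sq_sub := insubd (0 : sq_sub) x.
have liftE x (Dx : D x) : val (lift x) = x.
  by rewrite val_insubd; move/mem_set: Dx => ->.
exists (fun x => \pi_Q (lift x)); split.
- rewrite -(rmorph1 \pi_Q); apply/pi_eq.
  by rewrite liftE // rmorph1 subrr.
- move=> x y Dx Dy; split.
    rewrite -(rmorphB \pi_Q); apply/pi_eq.
    have -> : val (lift x - lift y) = val (lift x) - val (lift y) :> R by rewrite rmorphB.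
    by rewrite (liftE _ (Ds _ _ Dx Dy)) (liftE _ Dx) (liftE _ Dy) subrr.
  rewrite -(rmorphM \pi_Q); apply/pi_eq.
  have -> : val (lift x * lift y) = val (lift x) * val (lift y) :> R by rewrite rmorphM.
  by rewrite (liftE _ (Dm _ _ Dx Dy)) (liftE _ Dx) (liftE _ Dy) subrr.
- move=> z; exists (val (generic_quotient.repr (z : Q))); first exact/set_mem/valP.
  by rewrite /lift valKd reprK.
- move=> x Dx; rewrite -(rmorph0 \pi_Q); rewrite pi_eq liftE // rmorph0 subr0.
  by [].
Qed.

End SubQuotient.

(** For the completion, [R] is the ring of sequences, [D] its Cauchy and [N] its null sequences. The
    map [pi] is total but controlled only on [D]. *)
Lemma subquotient (R : comNzRingType) (D N : set R) : sring D -> N 0 ->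
  (forall x y, N x -> N y -> N (x - y)) ->
  (forall a x, D a -> N x -> N (a * x)) -> ~ N 1 ->
  exists (L : comNzRingType) (pi : R -> L), [/\ pi 1 = 1,
  forall x y, D x -> D y -> pi (x - y) = pi x - pi y /\ pi (x * y) = pi x * pi y,
  forall z, exists2 x, D x & pi x = z & forall x, D x -> (pi x = 0 <-> N x)].
Proof.
move=> sD N0 NB NM N1.
have [pi h] := @subquotient_aux R D N sD N0 NB NM N1.
by exists (sq_quot sD N0 NB NM N1), pi.
Qed.

Lemma rmorphism_exists (A B : comNzRingType) (g : A -> B) : g 1 = 1 ->
  (forall x y, g (x - y) = g x - g y) -> (forall x y, g (x * y) = g x * g y) ->
  exists h : {rmorphism A -> B}, forall x, h x = g x.
Proof.
move=> g1 gB gM.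
pose ga := GRing.isZmodMorphism.Build A B g gB.
pose gm := GRing.isMonoidMorphism.Build A B g (conj g1 gM).
pose h : {rmorphism A -> B} := HB.pack g ga gm.
by exists h.
Qed.

(** Completeness is phrased for series with [n]-th term in [F n], the form in which power series are
    evaluated. *)
Definition complete_filtration (L : comNzRingType) (F : nat -> set L) :=
  [/\ forall n, idl L (F n), F 0%N = setT /\ forall n, F n.+1 `<=` F n,
      forall m n x y, F m x -> F n y -> F (m + n)%N (x * y),
      forall x, (forall n, F n x) -> x = 0 &
      forall z : nat -> L, (forall n, F n (z n)) ->
        exists s, forall n, F n (s - \sum_(i < n) z i)].

Section Completion.
Variables (A : comNzRingType) (k : fieldType) (f : {rmorphism A -> k}) (p : nat).
Variable M : set A.
Hypotheses (pA : p \in [pchar A]) (nA : fin_gen A) (lM : loc M).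
Hypotheses (fM : forall x, M x <-> f x = 0) (fsurj : forall y, exists x, f x = y).

Lemma ipow_add_imul (X : set A) a n : ipow X (a + n) `<=` imul (ipow X a) (ipow X n).
Proof.
elim: a => [|a IH].
  by move=> x hx; rewrite -[x]mul1r; apply: imul_in.
apply: sspan_least; first exact: imul_idl.
move=> _ [x Xx [y /IH hy <-]].
have iI := imul_idl (ipow X a.+1) (ipow X n); have [I0 Id Im] := iI.
have : [set y | imul (ipow X a.+1) (ipow X n) (x * y)] y; last by [].
apply: (sspan_least _ _ hy); first exact: colon_idl.
move=> _ [u Xu [v Xv <-]] /=; rewrite mulrA.
by apply: sub_sspan; exists (x * u); [exact: imul_in|exists v].
Qed.

Lemma completion : exists (L : comNzRingType) (iota : {rmorphism A -> L})
  (sigma : {rmorphism k -> L}) (F : nat -> set L),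
  [/\ complete_filtration F,
      forall n z, exists a, F n (z - iota a),
      forall n a, F n (iota a) <-> ipow M n a,
      forall n, F n `<=` isp (iota @` ipow M n) &
      forall z, exists c, F 1%N (z - sigma c)].
Proof.
have iP n : idl A (ipow M n) by exact: ipow_idl.
have gP n := subm_sgrp (iP n).
have iM : idl A M by case: lM.
have P0 n : ipow M n 0 by case: (iP n).
have PD n x y : ipow M n x -> ipow M n y -> ipow M n (x + y) by case: (iP n) => _ h _; exact: h.
have PB n x y : ipow M n x -> ipow M n y -> ipow M n (x - y) by case: (gP n) => _; exact.
have PM n a x : ipow M n x -> ipow M n (a * x) by exact: (idlM _ (iP n)).
pose R := (nat -> A)%type.
(* The rate of convergence is fixed, so the term of index [n] determines the limit modulo [M^n]. *)
pose D : set R := [set z : R | forall n, ipow M n (z n.+1 - z n)].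
pose N : set R := [set z : R | forall n, ipow M n (z n)].
have sD : sring D.
  split.
  - by move=> n; rewrite subrr.
  - move=> x y hx hy n; rewrite (_ : _ - _ = (x n.+1 - x n) - (y n.+1 - y n)); first exact: PB.
    by rewrite !fctE; ring.
  - move=> x y hx hy n.
    rewrite (_ : _ - _ = y n.+1 * (x n.+1 - x n) + x n * (y n.+1 - y n)).
      by apply: PD; exact: PM.
    by rewrite !fctE; ring.
have [L [pi [pi1 piBM pis pi0]]] : exists (L : comNzRingType) (pi : R -> L), [/\ pi 1 = 1,
  forall x y, D x -> D y -> pi (x - y) = pi x - pi y /\ pi (x * y) = pi x * pi y,
  forall z, exists2 x, D x & pi x = z & forall x, D x -> (pi x = 0 <-> N x)].
  apply: subquotient => //.
  - by move=> x y hx hy n; exact: PB.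
  - by move=> a x ha hx n; exact: PM.
  - by move=> /(_ 1%N); rewrite ipow1 //; case: lM.
have [D1 Ds Dm] := sD.
have D0 : D 0 by exact: (sring0 sD).
have DD x y : D x -> D y -> D (x + y) by exact: (sringD sD).
have piB x y : D x -> D y -> pi (x - y) = pi x - pi y by move=> hx hy; have [] := piBM _ _ hx hy.
have piM x y : D x -> D y -> pi (x * y) = pi x * pi y by move=> hx hy; have [] := piBM _ _ hx hy.
have pi00 : pi 0 = 0 by rewrite -(subrr (1 : R)) piB // subrr.
have piN x : D x -> pi (- x) = - pi x by move=> hx; rewrite -sub0r piB // pi00 sub0r.
have piD x y : D x -> D y -> pi (x + y) = pi x + pi y.
  move=> hx hy; have hNy : D (- y) by exact: (sringN sD).
  by rewrite -{1}[y]opprK piB // piN // opprK.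
have pi_eq x y : D x -> D y -> (pi x = pi y <-> N (x - y)).
  move=> hx hy; rewrite -pi0; last exact: Ds.
  by rewrite piB //; split=> [->|/eqP]; [rewrite subrr|rewrite subr_eq0 => /eqP].
have Dsum (I : Type) (r : seq I) (G : I -> R) : (forall i, D (G i)) ->
    D (\sum_(i <- r) G i) /\ pi (\sum_(i <- r) G i) = \sum_(i <- r) pi (G i).
  move=> hG; elim: r => [|i r [IH1 IH2]]; first by rewrite !big_nil.
  by rewrite !big_cons; split; [exact: DD|rewrite piD // IH2].
have Dc a : D (fun=> a) by move=> n; rewrite subrr.
have up x n j : D x -> ipow M n (x n) -> (n <= j)%N -> ipow M n (x j).
  move=> hx hn /subnK <-; elim: (j - n)%N => [|i IH] //.
  rewrite addSn -[x _](subrK (x (i + n)%N)); apply: PD => //.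
  by apply: (ipow_anti (leq_addl i n)); exact: hx.
have [iota iotaE] : exists h : {rmorphism A -> L}, forall a, h a = pi (fun=> a).
  apply: rmorphism_exists => // x y; [rewrite -piB //|rewrite -piM //].
pose F n : set L := [set z | exists x, [/\ D x, pi x = z & ipow M n (x n)]].
have FE n x : D x -> (F n (pi x) <-> ipow M n (x n)).
  move=> hx; split=> [[y [hy /(pi_eq _ _ hy hx) h hn]]|hn]; last by exists x.
  by rewrite -[x n](subKr (y n)); apply: PB => //; exact: h.
have [Dn [sDn Dn_anti Dn_dense Dn_max]] := coef_rings pA lM fM.
have dex c n : exists d, Dn n d /\ f d = c.
  have [a <-] := fsurj c; have [d hd Md] := Dn_dense n a; exists d; split=> //.
  by apply/esym/eqP; rewrite -subr_eq0 -rmorphB; apply/eqP/fM.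
have dexf c : exists d : nat -> A, forall n, Dn n (d n) /\ f (d n) = c.
  by have [d hd] := choice (dex c); exists d.
have [d dP] := choice dexf.
(* Lifts in [Dn n] of one residue differ by an element of [Dn n] lying in [M], hence in [M^n]. So
   the lifts form a Cauchy sequence, and [sigma] is a ring morphism for the same reason. *)
have Dd c : D (d c).
  move=> n; have [h1 h2] := dP c n; have [h3 h4] := dP c n.+1.
  apply: Dn_max; last by apply/fM; rewrite rmorphB h2 h4 subrr.
  by have [_ h _] := sDn n; apply: h => //; exact: Dn_anti.
have [sigma sigmaE] : exists h : {rmorphism k -> L}, forall c, h c = pi (d c).
  apply: rmorphism_exists => [|x y|x y].
  - rewrite -pi1; apply/pi_eq => // n; have [h1 h2] := dP 1 n.
    have [G1 Gs Gm] := sDn n; apply: Dn_max; first exact: Gs.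
    by apply/fM; rewrite rmorphB rmorph1 h2 subrr.
  - rewrite -piB //; apply/pi_eq => //; first exact: Ds.
    move=> n; have [h1 h2] := dP x n; have [h3 h4] := dP y n; have [h5 h6] := dP (x - y) n.
    have [G1 Gs Gm] := sDn n; apply: Dn_max; first by apply: (Gs _ _ h5); exact: Gs.
    by apply/fM; rewrite !rmorphB h2 h4 h6 subrr.
  - rewrite -piM //; apply/pi_eq => //; first exact: Dm.
    move=> n; have [h1 h2] := dP x n; have [h3 h4] := dP y n; have [h5 h6] := dP (x * y) n.
    have [G1 Gs Gm] := sDn n; apply: Dn_max; first by apply: (Gs _ _ h5); exact: Gm.
    by apply/fM; rewrite rmorphB rmorphM h2 h4 h6 subrr.
exists L, iota, sigma, F; split.
- split.
  + move=> n; split.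
    * by rewrite -pi00; apply/FE.
    * move=> _ _ [x [hx <- xn]] [y [hy <- yn]]; rewrite -piD //; apply/FE; first exact: DD.
      exact: PD.
    * move=> z _ [x [hx <- xn]]; have [w hw <-] := pis z; rewrite /= -piM //.
      by apply/FE; [exact: Dm|exact: PM].
  + split; first by apply/seteqP; split=> // z _; have [w hw <-] := pis z; exists w.
    move=> n _ [x [hx <- xn]]; apply/FE => //.
    rewrite -[x n](subKr (x n.+1)); apply: PB; [exact: ipowS_sub|exact: hx].
  + move=> m n _ _ [x [hx <- xm]] [y [hy <- yn]]; rewrite -piM //; apply/FE; first exact: Dm.
    by apply: ipowM; [exact: (up _ _ _ hx xm (leq_addr _ _))|exact: (up _ _ _ hy yn (leq_addl _ _))].
  + move=> z; have [x hx <-] := pis z => h; apply/pi0 => // n; exact/FE.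
  + move=> z /choice [x xP].
    pose s : R := fun j => \sum_(i < j) x i j.
    have hs : D s.
      move=> n; rewrite /s big_ord_recr /= addrAC -sumrB; apply: PD.
        apply: (subm_sum _ (iP n)) => i _; have [h _ _] := xP i; exact: h.
      by have [h1 h2 h3] := xP n; exact: (up _ _ _ h1 h3 (leqnSn n)).
    exists (pi s) => n.
    have hx i : D (x i) by have [] := xP i.
    have [S1 S2] := Dsum _ (index_enum 'I_n) (fun i : 'I_n => x i) (fun i => hx i).
    have -> : \sum_(i < n) z i = pi (\sum_(i < n) x i).
      by rewrite S2; apply: eq_bigr => i _; have [_ -> _] := xP i.
    rewrite -piB //; apply/FE; first exact: Ds.
    by rewrite !fctE fct_sumE /s subrr.
- move=> n z; have [x hx <-] := pis z; exists (x n).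
  by rewrite iotaE -piB //; apply/FE; [exact: Ds|rewrite !fctE subrr].
- by move=> n a; rewrite iotaE; exact: FE.
- move=> n _ [x [hx <- xn]].
  have [g Eg] := nA (iP n).
  have [c0 Ec0] : exists c : nat -> A, x n = \sum_(i < size g) c i * g`_i.
    by move: xn; rewrite Eg => /sspan_seqP.
  (* The differences lie in [M^(l+n) = M^l M^n], so they expand over the generators of [M^n] with
     coefficients in [M^l]; summed over [l], these give the Cauchy sequences [y i]. *)
  have hc l : exists c : nat -> A, (forall i, ipow M l (c i)) /\
      x (l + n).+1 - x (l + n)%N = \sum_(i < size g) c i * g`_i.
    apply: imul_seqP; first exact: iP.
    by rewrite -Eg; apply: ipow_add_imul; exact: hx.
  have [c cP] := choice hc.
  pose y i : R := fun j => c0 i + \sum_(l < j) c l i.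
  have hy i : D (y i).
    move=> j; rewrite /y big_ord_recr /= addrA [X in X - _]addrC addrK.
    by have [h _] := cP j; exact: h.
  have Ey j : \sum_(i < size g) y i j * g`_i = x (j + n)%N.
    elim: j => [|j IH].
      by rewrite add0n Ec0; apply: eq_bigr => i _; rewrite /y big_ord0 addr0.
    rewrite addSn -[RHS](subrK (x (j + n)%N)); have [_ ->] := cP j; rewrite -IH -big_split.
    apply: eq_bigr => i _; rewrite /y big_ord_recr /= -mulrDl; congr (_ * _).
    by rewrite addrA [RHS]addrC.
  have hyg (i : 'I_(size g)) : D (y i * (fun=> g`_i)) by apply: Dm => //; exact: Dc.
  have [S1 S2] := Dsum _ (index_enum 'I_(size g)) (fun i : 'I_(size g) => y i * (fun=> g`_i)) hyg.
  have -> : pi x = pi (\sum_(i < size g) y i * (fun=> g`_i)).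
    apply/pi_eq => // j; rewrite !fctE fct_sumE.
    rewrite (_ : \sum_(i < size g) _ = x (j + n)%N); last exact: Ey.
    elim: (n) => [|i IH]; first by rewrite addn0 subrr.
    rewrite addnS (_ : x j - _ = (x j - x (j + i)%N) - (x (j + i).+1 - x (j + i)%N)); last ring.
    by apply: PB => //; apply: (ipow_anti (leq_addr i j)); exact: hx.
  have iS := sspan_subm idfun (iota @` ipow M n).
  rewrite S2; apply: (subm_sum _ iS) => i _; rewrite piM //.
  apply: (idlM _ iS); rewrite -iotaE; apply: sub_sspan; exists g`_i => //.
  by rewrite Eg; apply: sub_sspan => /=; exact: mem_nth.
- move=> z; have [x hx <-] := pis z; exists (f (x 1%N)).
  rewrite sigmaE -piB //; apply/FE; first exact: Ds.
  rewrite ipow1 //; apply/fM; have [_ h] := dP (f (x 1%N)) 1%N.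
  by rewrite !fctE rmorphB h subrr.
Qed.

End Completion.

(** * Finiteness over a power series ring *)

Section PowerSeries.
Variable R : idomainType.

Record pser := Pser { pcoef : nat -> R }.

HB.instance Definition _ := gen_eqMixin pser.
HB.instance Definition _ := gen_choiceMixin pser.

Lemma pser_ext (a b : pser) : (forall n, pcoef a n = pcoef b n) -> a = b.
Proof. by case: a b => [a] [b] /= h; congr Pser; apply/funext. Qed.

Definition pser_add (a b : pser) := Pser (fun n => pcoef a n + pcoef b n).
Definition pser_opp (a : pser) := Pser (fun n => - pcoef a n).
Definition pser_zero := Pser (fun=> 0).
Definition pser_one := Pser (fun n => (n == 0%N)%:R).
Definition pser_mul (a b : pser) :=
  Pser (fun n => \sum_(i < n.+1) pcoef a i * pcoef b (n - i)%N).

Fact pser_addA : associative pser_add.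
Proof. by move=> a b c; apply: pser_ext => n /=; rewrite addrA. Qed.
Fact pser_addC : commutative pser_add.
Proof. by move=> a b; apply: pser_ext => n /=; rewrite addrC. Qed.
Fact pser_add0 : left_id pser_zero pser_add.
Proof. by move=> a; apply: pser_ext => n /=; rewrite add0r. Qed.
Fact pser_addN : left_inverse pser_zero pser_opp pser_add.
Proof. by move=> a; apply: pser_ext => n /=; rewrite addNr. Qed.

HB.instance Definition _ :=
  GRing.isZmodule.Build pser pser_addA pser_addC pser_add0 pser_addN.

(** A coefficient of a product involves only coefficients of no larger index, so associativity and
    commutativity are inherited from polynomials. *)
Definition ptrunc (N : nat) (a : pser) : {poly R} := \poly_(i < N) pcoef a i.

Lemma ptrunc_coef N a i : (i < N)%N -> (ptrunc N a)`_i = pcoef a i.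
Proof. by move=> h; rewrite coef_poly h. Qed.

Lemma ptruncM N a b n : (n < N)%N ->
  (ptrunc N a * ptrunc N b)`_n = pcoef (pser_mul a b) n.
Proof.
move=> nN; rewrite coefM; apply: eq_bigr => i _.
by rewrite !ptrunc_coef //; have := ltn_ord i; lia.
Qed.

Fact pser_mulA : associative pser_mul.
Proof.
move=> a b c; apply: pser_ext => n.
rewrite -!(@ptruncM n.+1) //.
transitivity ((ptrunc n.+1 a * (ptrunc n.+1 b * ptrunc n.+1 c))`_n).
  rewrite !coefM; apply: eq_bigr => i _; congr (_ * _).
  by rewrite ptruncM ?ltnS ?leq_subr // ptrunc_coef // ltnS leq_subr.
rewrite mulrA !coefM; apply: eq_bigr => i _; congr (_ * _).
by rewrite ptruncM ?ltn_ord // ptrunc_coef.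
Qed.

Fact pser_mulC : commutative pser_mul.
Proof. by move=> a b; apply: pser_ext => n; rewrite -!(@ptruncM n.+1) // mulrC. Qed.

Fact pser_mul1 : left_id pser_one pser_mul.
Proof.
move=> a; apply: pser_ext => n /=; rewrite big_ord_recl /= mul1r subn0 big1 ?addr0 //.
by move=> i _; rewrite mul0r.
Qed.

Fact pser_mulD : left_distributive pser_mul pser_add.
Proof.
move=> a b c; apply: pser_ext => n /=; rewrite -big_split.
by apply: eq_bigr => i _; rewrite mulrDl.
Qed.

Fact pser_one_neq0 : pser_one != 0.
Proof.
apply/eqP => /(congr1 (fun a => pcoef a 0)) /= /eqP; by rewrite oner_eq0.
Qed.

HB.instance Definition _ := GRing.Zmodule_isComNzRing.Build pser
  pser_mulA pser_mulC pser_mul1 pser_mulD pser_one_neq0.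

Lemma pcoefB (a b : pser) n : pcoef (a - b) n = pcoef a n - pcoef b n.
Proof. by []. Qed.

Lemma pcoefM (a b : pser) n :
  pcoef (a * b) n = \sum_(i < n.+1) pcoef a i * pcoef b (n - i)%N.
Proof. by []. Qed.

Lemma pser_order (a : pser) : a != 0 ->
  exists n, pcoef a n != 0 /\ forall i, (i < n)%N -> pcoef a i = 0.
Proof.
move=> a0; have ex : exists n, pcoef a n != 0.
  apply: contrapT => h; move/eqP: a0; apply; apply: pser_ext => n.
  by apply/eqP/negPn/negP => hn; apply: h; exists n.
have [n hn nmin] := ex_minnP ex; exists n; split=> // i lt_in.
by apply/eqP/negPn/negP => /nmin; rewrite leqNgt lt_in.
Qed.

Lemma pser_domain (a b : pser) : a * b = 0 -> a = 0 \/ b = 0.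
Proof.
move=> ab; have [|a0] := eqVneq a 0; first by left.
have [|b0] := eqVneq b 0; first by right.
have [m [am lm]] := pser_order a0; have [n [bn ln]] := pser_order b0; exfalso.
have : pcoef (a * b) (m + n) = pcoef a m * pcoef b n.
  have mlt : (m < (m + n).+1)%N by rewrite ltnS leq_addr.
  rewrite pcoefM (bigD1 (Ordinal mlt)) //= addKn big1 ?addr0 // => i.
  rewrite -val_eqE /= => im.
  have [h|h|h] := ltngtP i m; [by rewrite lm // mul0r| |by rewrite h eqxx in im].
  by rewrite ln ?mulr0 //; have := ltn_ord i; lia.
by rewrite ab => /esym/eqP; rewrite mulf_eq0 (negbTE am) (negbTE bn).
Qed.

Definition pser_unit : pred pser := fun a => `[< exists b, b * a = 1 >].
Definition pser_inv (a : pser) : pser :=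
  match pselect (exists b, b * a = 1) with
  | left h => sval (cid h) | right _ => a end.

Fact pser_mulV : {in pser_unit, left_inverse 1 pser_inv *%R}.
Proof.
move=> a /asboolP ha; rewrite /pser_inv; case: pselect => // h.
exact: svalP (cid h).
Qed.
Fact pser_unitP (a b : pser) : b * a = 1 -> pser_unit a.
Proof. by move=> h; apply/asboolP; exists b. Qed.
Fact pser_inv_out : {in [predC pser_unit], pser_inv =1 id}.
Proof.
move=> a /negP; rewrite /pser_inv => ha; case: pselect => // h.
by case: ha; apply/asboolP.
Qed.

HB.instance Definition _ := GRing.ComNzRing_hasMulInverse.Build pser
  pser_mulV pser_unitP pser_inv_out.

Fact pser_integral : GRing.integral_domain_axiom pser.
Proof. by move=> a b /pser_domain[->|->]; rewrite eqxx ?orbT. Qed.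

HB.instance Definition _ := GRing.ComUnitRing_isIntegral.Build pser pser_integral.

Definition pconst (r : R) : pser := Pser (fun n => if n == 0%N then r else 0).

Fact pconst_zmod : zmod_morphism pconst.
Proof. by move=> a b; apply: pser_ext => n; rewrite pcoefB /=; case: ifP; rewrite ?subr0. Qed.

Fact pconst_monoid : monoid_morphism pconst.
Proof.
split; first by apply: pser_ext => n /=; case: (n == 0%N).
move=> a b; apply: pser_ext => n; rewrite pcoefM big_ord_recl /= subn0 big1 ?addr0.
  by case: ifP; rewrite ?mulr0.
by move=> i _; rewrite mul0r.
Qed.

HB.instance Definition _ := GRing.isZmodMorphism.Build R pser pconst pconst_zmod.
HB.instance Definition _ := GRing.isMonoidMorphism.Build R pser pconst pconst_monoid.

Definition pvar : pser := Pser (fun n => (n == 1%N)%:R).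
Definition pshift n (a : pser) : pser := Pser (fun i => pcoef a (n + i)%N).

Lemma pcoef_pvarM a n : pcoef (pvar * a) n = if n is n'.+1 then pcoef a n' else 0.
Proof.
rewrite pcoefM; case: n => [|n]; first by rewrite big_ord1 /= mul0r.
by rewrite 2!big_ord_recl /= mul0r add0r mul1r subSS subn0 big1 ?addr0 // => i _; rewrite mul0r.
Qed.

Lemma pvar_neq0 : pvar != 0.
Proof. by apply/eqP => /(congr1 (fun a => pcoef a 1)) /= /eqP; rewrite oner_eq0. Qed.

Lemma pser_split a n : (forall i, (i < n)%N -> pcoef a i = 0) ->
  a = pvar ^+ n * (pconst (pcoef a n) + pvar * pshift n.+1 a).
Proof.
move=> h; apply: pser_ext => i.
have key j b : pcoef (pvar ^+ j * b) i = if (i < j)%N then 0 else pcoef b (i - j)%N.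
  elim: j i {h} => [|j IH] i; first by rewrite mul1r subn0.
  rewrite exprS -mulrA pcoef_pvarM; case: i => // i; by rewrite IH ltnS subSS.
rewrite key; case: ltnP => [/h//|ni].
have -> : pcoef (pconst (pcoef a n) + pvar * pshift n.+1 a) (i - n) =
  pcoef (pconst (pcoef a n)) (i - n) + pcoef (pvar * pshift n.+1 a) (i - n) by [].
rewrite pcoef_pvarM; case E : (i - n)%N => [|j] /=.
  by rewrite addr0; congr (pcoef a _); lia.
by rewrite add0r; congr (pcoef a _); lia.
Qed.

Lemma pser_split0 a : a = pconst (pcoef a 0) + pvar * pshift 1 a.
Proof. by rewrite {1}(@pser_split a 0) // expr0 mul1r. Qed.

End PowerSeries.

Section Evaluation.
Variables (R : idomainType) (L : comNzRingType) (F : nat -> set L).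
Variables (beta : {rmorphism R -> L}) (x : L).
Hypotheses (cF : complete_filtration F) (Fx : F 1%N x).

Lemma filtX n : F n (x ^+ n).
Proof.
have [_ [F0 _] FM _ _] := cF.
elim: n => [|n IH]; first by rewrite F0.
by rewrite exprS -add1n; exact: FM.
Qed.

Lemma filt_anti m n : (m <= n)%N -> F n `<=` F m.
Proof.
have [_ [_ Fs] _ _ _] := cF.
move=> /subnK <-; elim: (n - m)%N => [|i IH] //.
by apply: subset_trans IH; exact: Fs.
Qed.

Lemma filt_horner (q : {poly L}) n : F n (q.[x] - \sum_(i < n) q`_i * x ^+ i).
Proof.
have [iF _ _ _ _] := cF.
rewrite (@horner_coef_wide _ (n + size q)) ?leq_addl // big_split_ord /= addrAC subrr add0r.
apply: (subm_sum _ (iF n)) => i _; apply: (idlM _ (iF n)).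
exact: (filt_anti (leq_addr i n) (filtX _)).
Qed.

(** The value is the sum of a convergent series; by separation it is the only element approximated
    by all partial sums, which makes evaluation a ring morphism. *)
Lemma pser_eval : exists h : {rmorphism pser R -> L},
  [/\ forall r, h (pconst r) = beta r, h (pvar R) = x &
      forall a n, F n (h a - \sum_(i < n) beta (pcoef a i) * x ^+ i)].
Proof.
have [iF [F0 Fs] FM Fsep Fc] := cF.
have gF n := subm_sgrp (iF n).
have ex (a : pser R) : exists s, forall n, F n (s - \sum_(i < n) beta (pcoef a i) * x ^+ i).
  apply: (Fc (fun n => beta (pcoef a n) * x ^+ n)) => n.
  by apply: (idlM _ (iF n)); exact: filtX.
have [g gP] := choice ex.
have uniq a s : (forall n, F n (s - \sum_(i < n) beta (pcoef a i) * x ^+ i)) -> g a = s.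
  move=> hs; apply/eqP; rewrite -subr_eq0; apply/eqP/Fsep => n.
  have [_ gB] := gF n.
  by have := gB _ _ (gP a n) (hs n); rewrite opprB addrA subrK.
have gC r : g (pconst r) = beta r.
  apply: uniq => [[|n]]; first by rewrite F0.
  rewrite big_ord_recl /= mulr1 big1 ?addr0 ?subrr; first by have [] := iF n.+1.
  by move=> i _; rewrite rmorph0 mul0r.
have [h hE] : exists h : {rmorphism pser R -> L}, forall a, h a = g a.
  apply: rmorphism_exists.
  - rewrite -(rmorph1 beta) -gC; congr g; apply: pser_ext => n /=; by case: eqP.
  - move=> a b; apply: uniq => n; have [_ gB] := gF n.
    have := gB _ _ (gP a n) (gP b n).
    rewrite opprB addrACA addrC addrA.
    have -> : \sum_(i < n) beta (pcoef (a - b) i) * x ^+ i =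
      \sum_(i < n) beta (pcoef a i) * x ^+ i - \sum_(i < n) beta (pcoef b i) * x ^+ i.
      by rewrite -sumrB; apply: eq_bigr => i _; rewrite pcoefB rmorphB mulrBl.
    by congr (F n _); ring.
  - move=> a b; apply: uniq => n; have [F0n Fd Fm] := iF n; have [_ gB] := gF n.
    pose pa := map_poly beta (ptrunc n a); pose pb := map_poly beta (ptrunc n b).
    have ev c : (map_poly beta (ptrunc n c)).[x] = \sum_(i < n) beta (pcoef c i) * x ^+ i.
      rewrite (@horner_coef_wide _ n); last first.
        by apply: leq_trans (size_poly _ _) (size_poly _ _).
      by apply: eq_bigr => i _; rewrite coef_map ptrunc_coef.
    have h1 := gP a n; have h2 := gP b n; rewrite -!ev -/pa -/pb in h1 h2.
    have h3 := filt_horner (pa * pb) n; rewrite hornerM in h3.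
    have E : \sum_(i < n) (pa * pb)`_i * x ^+ i = \sum_(i < n) beta (pcoef (a * b) i) * x ^+ i.
      by apply: eq_bigr => i _; rewrite -rmorphM coef_map ptruncM.
    rewrite E in h3.
    rewrite (_ : _ - _ = g b * (g a - pa.[x]) + (pa.[x] * (g b - pb.[x]) +
      (pa.[x] * pb.[x] - \sum_(i < n) beta (pcoef (a * b) i) * x ^+ i))); last by ring.
    by apply: (Fd) => //; [exact: Fm|apply: (Fd) => //; exact: Fm].
exists h; split=> [r||a n]; rewrite hE //.
apply: uniq => n; have [F0n _ _] := iF n.
rewrite (eq_bigr (fun i : 'I_n => (val i == 1%N)%:R * x ^+ i)); last first.
  by move=> i _; congr (_ * _); exact: rmorph_nat.
case: (ltnP 1 n) => hn.
  rewrite (bigD1 (Ordinal hn)) //= mul1r expr1 big1 ?addr0 ?subrr // => i.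
  by rewrite -val_eqE /= => /negbTE ->; rewrite mul0r.
rewrite big1 ?subr0; first exact: (filt_anti hn).
by move=> i _; rewrite ltn_eqF ?mul0r //; exact: leq_trans (ltn_ord i) hn.
Qed.

End Evaluation.

Lemma idl_preimage (A L : comNzRingType) (f : {rmorphism A -> L}) (X : set L) :
  idl L X -> idl A (f @^-1` X).
Proof.
move=> [X0 Xd Xm]; split; rewrite /preimage /=; first by rewrite rmorph0.
  by move=> x y; rewrite rmorphD; exact: Xd.
by move=> a x; rewrite rmorphM; exact: Xm.
Qed.

(** * Noether normalization, one parameter at a time *)

Section Normalization.
Variables (L : comNzRingType) (F : nat -> set L) (p : nat) (us : seq L).
Hypothesis cF : complete_filtration F.

(** Invariant of the construction of [B]: the parameters [ys] are already variables, [xs] are still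
    to be treated. The bound [N * l <= C * N ^ size ys] states [l = O(N^(size ys - 1))] without
    subtraction and so also makes sense for empty [ys]. *)
Record normal_at (B : idomainType) (beta : {rmorphism B -> L}) (ys xs : seq L) : Prop :=
  NormalAt {
    na_gen : forall z, exists (c : nat -> B) (w : L),
      isp [set` xs] w /\ z = \sum_(i < size us) beta (c i) * us`_i + w;
    na_small : forall g, g != 0 -> exists C, forall N, exists l,
      bnd (idl L) (isp ([set beta g] `|` [set y ^+ N | y in [set` ys]] `|` [set` xs])) setT l
      /\ (N * l <= C * N ^ size ys)%N;
    na_vars : exists Xs : seq B, [/\ map beta Xs = ys, forall X, X \in Xs -> X != 0 &
      forall b, isp [set` Xs] b \/ exists b', isp [set` Xs] (b' * b - 1)];
    na_res : forall z, exists b, F 1%N (z - beta b);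
    na_char : p \in [pchar B] }.

Lemma isp_mono_gens (X Y : set L) : (forall x, X x -> isp Y x) -> isp X `<=` isp Y.
Proof. by move=> h; apply: sspan_least => //; exact: sspan_subm. Qed.

(** Expand [z] over [us] modulo [x] and [xs], then expand the factor of [x], and so on; the
    successive coefficients form power series in [x]. *)
Lemma normal_gen_step (B : idomainType) (beta : {rmorphism B -> L}) (x : L) (xs : seq L)
  (h : {rmorphism pser B -> L}) : F 1%N x ->
  (forall a n, F n (h a - \sum_(i < n) beta (pcoef a i) * x ^+ i)) ->
  (forall z, exists (c : nat -> B) (w : L),
      isp [set` x :: xs] w /\ z = \sum_(i < size us) beta (c i) * us`_i + w) ->
  forall z, exists (c : nat -> pser B) (w : L),
      isp [set` xs] w /\ z = \sum_(i < size us) h (c i) * us`_i + w.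
Proof.
move=> Fx hF gen z; have [iF [F0 Fs] FM Fsep Fc] := cF.
have dec z0 : exists d : (nat -> B) * L * (nat -> L),
    z0 = \sum_(i < size us) beta (d.1.1 i) * us`_i + x * d.1.2 +
         \sum_(j < size xs) d.2 j * xs`_j.
  have [c [w [hw ->]]] := gen z0.
  have : addset (isp [set` xs]) (cyc idfun x) w.
    apply: sspan_cons; first exact: sspan_subm.
    apply: isp_mono_gens hw => y; rewrite /= inE => /orP[/eqP->|yx].
      by apply: sub_sspan; right.
    by apply: sub_sspan; left; exact: sub_sspan.
  case=> w' /sspan_seqP[e ->] [_ [z1 _ <-] <-].
  by exists (c, z1, e) => /=; rewrite -addrA; congr (_ + _); rewrite addrC mulrC.
have [d dP] := choice dec.
pose Z l := iter l (fun z0 => (d z0).1.2) z.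
pose S l := \sum_(i < size us) beta ((d (Z l)).1.1 i) * us`_i +
            \sum_(j < size xs) (d (Z l)).2 j * xs`_j.
have Zn n : z = \sum_(l < n) x ^+ l * S l + x ^+ n * Z n.
  elim: n => [|n IH]; first by rewrite big_ord0 add0r mul1r.
  rewrite big_ord_recr -addrA {1}IH; congr (_ + _).
  have -> : Z n.+1 = (d (Z n)).1.2 by [].
  by rewrite [in LHS](dP (Z n)) exprSr /S /=; ring.
have ex j : exists s, forall n, F n (s - \sum_(l < n) (d (Z l)).2 j * x ^+ l).
  by apply: (Fc (fun l => (d (Z l)).2 j * x ^+ l)) => n; apply: (idlM _ (iF n)); exact: filtX.
have [s sP] := choice ex.
pose b i := Pser (fun l => (d (Z l)).1.1 i).
exists b, (\sum_(j < size xs) s j * xs`_j); split.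
  have iX := sspan_subm idfun [set` xs].
  apply: (subm_sum _ iX) => i _; apply: (idlM _ iX); apply: sub_sspan.
  by rewrite /= mem_nth.
apply/eqP; rewrite -subr_eq0; apply/eqP/Fsep => n.
have [F0n Fd Fm] := iF n; have [_ gB] := subm_sgrp (iF n).
have -> : z - (\sum_(i < size us) h (b i) * us`_i + \sum_(j < size xs) s j * xs`_j) =
  x ^+ n * Z n - (\sum_(i < size us) (h (b i) - \sum_(l < n) beta (pcoef (b i) l) * x ^+ l) * us`_i
   + \sum_(j < size xs) (s j - \sum_(l < n) (d (Z l)).2 j * x ^+ l) * xs`_j).
  rewrite {1}(Zn n).
  have -> : \sum_(l < n) x ^+ l * S l =
    \sum_(i < size us) (\sum_(l < n) beta (pcoef (b i) l) * x ^+ l) * us`_i +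
    \sum_(j < size xs) (\sum_(l < n) (d (Z l)).2 j * x ^+ l) * xs`_j.
    rewrite (eq_bigr (fun l : 'I_n => \sum_(i < size us) beta (pcoef (b i) l) * x ^+ l * us`_i
       + \sum_(j < size xs) (d (Z l)).2 j * x ^+ l * xs`_j)); last first.
      move=> l _; rewrite /S mulrDr !mulr_sumr; congr (_ + _);
      by apply: eq_bigr => i _; rewrite mulrA [x ^+ l * _]mulrC.
    rewrite big_split /= exchange_big [X in _ + X]exchange_big /=; congr (_ + _);
    by apply: eq_bigr => i _; rewrite mulr_suml.
  have EB n0 (u v : nat -> L) (w : seq L) : \sum_(i < n0) (u i - v i) * w`_i =
      \sum_(i < n0) u i * w`_i - \sum_(i < n0) v i * w`_i.
    by rewrite -sumrB; apply: eq_bigr => i _; rewrite mulrBl.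
  rewrite (EB _ (fun i => h (b i)) (fun i => \sum_(l < n) beta (pcoef (b i) l) * x ^+ l)).
  rewrite (EB _ s (fun j => \sum_(l < n) (d (Z l)).2 j * x ^+ l)); ring.
apply: gB; first by apply: (idlMr _ (iF n)); exact: filtX.
apply: (Fd); apply: (subm_sum _ (iF n)) => i _; apply: (idlMr _ (iF n)); first exact: hF.
exact: sP.
Qed.

(** Filter by powers of [x], with [od] the order of [g]. Each of the first [od] layers is bounded by
    [bK]; on every later one the leading coefficient of [g] acts as zero, and the hypothesis for
    that coefficient applies. *)
Lemma normal_small_step (B : idomainType) (beta : {rmorphism B -> L}) (x : L) (ys xs : seq L)
  (h : {rmorphism pser B -> L}) K :
  (forall r, h (pconst r) = beta r) -> h (pvar B) = x ->
  bnd (idl L) (isp ([set` ys] `|` [set` x :: xs])) setT K ->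
  (forall g, g != 0 -> exists C, forall N, exists l,
      bnd (idl L) (isp ([set beta g] `|` [set y ^+ N | y in [set` ys]] `|` [set` x :: xs])) setT l
      /\ (N * l <= C * N ^ size ys)%N) ->
  forall g, g != 0 -> exists C, forall N, exists l,
      bnd (idl L) (isp ([set h g] `|` [set y ^+ N | y in [set` x :: ys]] `|` [set` xs])) setT l
      /\ (N * l <= C * N ^ size (x :: ys))%N.
Proof.
move=> hC hx bK small g g0.
have [od [gone lo]] := pser_order g0.
have [C hCo] := small _ gone.
have Eg := pser_split lo.
have Ehg : h g = x ^+ od * (beta (pcoef g od) + x * h (pshift od.+1 g)).
  by rewrite {1}Eg rmorphM rmorphXn rmorphD rmorphM hC hx.
(* At most [od] layers of length [K N^(size ys)] and [N] layers of length [l], the total multiplied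
   by [N]. *)
exists (od * K + C)%N => N; have [l [bl hl]] := hCo N.
set G := [set h g] `|` [set y ^+ N | y in [set` x :: ys]] `|` [set` xs].
pose V i := isp (G `|` [set x ^+ i]).
have iV i : idl L (V i) by exact: sspan_subm.
have VG i y : G y -> V i y by move=> Gy; apply: sub_sspan; left.
have Vx i : V i (x ^+ i) by apply: sub_sspan; right.
have Vs i : V i.+1 `<=` V i.
  apply: (sspan_least (iV i)) => y [/VG//|->]; rewrite exprS; exact: (idlM _ (iV i)).
pose t i := if (i < od)%N then (N ^ size ys * K)%N else l.
have preim i Y m : bnd (idl L) (isp Y) setT m ->
    (forall y, Y y -> V i.+1 (x ^+ i * y)) -> bnd (idl L) (V i.+1) (V i) m.
  move=> b hY.
  apply: (@bnd_preim _ _ (idl L) (idl L) (GRing.mull_fun (x ^+ i) (idfun : {additive L -> L}))).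
  - by move=> W; exact: subm_sgrp.
  - by move=> W; exact: colon_idl.
  - have iG := sspan_subm idfun G.
    have VG' : V i `<=` addset (isp G) (cyc idfun (x ^+ i)).
      apply: subset_trans (sspan_cons iG); apply: sspan_mono => y [Gy|]; last by right.
      by left; exact: sub_sspan.
    move=> y /VG' [u Gu [_ [a _ <-] <-]]; exists u.
      by apply: (sspan_least (iV _) _ Gu); exact: VG.
    by exists a; rewrite /= mulrC.
  - apply: bnd_sub b _ _ _ => //.
    apply: sspan_least; first by apply: colon_idl; exact: iV.
    by move=> y Yy; exact: hY.
have bstep i : bnd (idl L) (V i.+1) (V i) (t i).
  rewrite /t; case: ltnP => oi.
    have b1 : bnd (idl L) (isp (isp [set` x :: xs] `|` [set` ys])) setT K.
      apply: bnd_sub bK _ _ _ => //; apply: sspan_mono => y [yy|yx]; first by right.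
      by left; exact: sub_sspan.
    have b2 := @bnd_pows L _ ys K N (sspan_subm _ _) b1.
    apply: preim b2 _ => y [hy|[y' yy <-]].
      have : [set y | V i.+1 (x ^+ i * y)] y; last by [].
      apply: (sspan_least _ _ hy); first by apply: colon_idl; exact: iV.
      move=> w; rewrite /= inE => /orP[/eqP->|wx]; first by rewrite -exprSr; exact: Vx.
      by apply: (idlM _ (iV _)); apply: VG; right.
    apply: (idlM _ (iV _)); apply: VG; left; right; exists y' => //=.
    by rewrite inE; apply/orP; right.
  apply: preim bl _ => y [[->|[y' yy <-]]|yx].
  - have -> : x ^+ i * beta (pcoef g od) = x ^+ (i - od) * h g - x ^+ i.+1 * h (pshift od.+1 g).
      rewrite Ehg exprS (_ : x ^+ i = x ^+ (i - od) * x ^+ od); first ring.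
      by rewrite -exprD subnK.
    apply: (subm_sgrp (iV _)).2; first by apply: (idlM _ (iV _)); apply: VG; left; left.
    exact: (idlMr _ (iV _)).
  - apply: (idlM _ (iV _)); apply: VG; left; right; exists y' => //=.
    by rewrite inE; apply/orP; right.
  - move: yx; rewrite /= inE => /orP[/eqP->|yx]; first by rewrite -exprSr; exact: Vx.
    by apply: (idlM _ (iV _)); apply: VG; right.
have bsum n : bnd (idl L) (V n) setT (\sum_(i < n) t i).
  elim: n => [|n IH].
    by rewrite big_ord0; apply: bnd0; rewrite (idlT (iV 0%N)).
  rewrite big_ord_recr /= addnC; exact: (subm_bndD (iV n)).
exists (\sum_(i < N) t i)%N; split.
  apply: bnd_sub (bsum N) _ _ _ => //.
  apply: isp_mono_gens => y [Gy|->]; first exact: sub_sspan.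
  by apply: sub_sspan; left; right; exists x => //=; rewrite inE eqxx.
pose a := (N ^ size ys * K)%N.
have le1 n : (\sum_(i < n) t i <= minn od n * a + n * l)%N.
  elim: n => [|n IH]; first by rewrite big_ord0.
  rewrite big_ord_recr /= {2}/t mulSn -/a; case: ltnP => no.
    have -> : minn od n.+1 = (minn od n).+1 by lia.
    rewrite mulSn; apply: leq_trans (leq_add IH (leqnn a)) _.
    by move: (minn od n * a)%N (n * l)%N => u v; lia.
  have -> : minn od n.+1 = minn od n by lia.
  apply: leq_trans (leq_add IH (leqnn l)) _.
  by move: (minn od n * a)%N (n * l)%N => u v; lia.
have le2 : (\sum_(i < N) t i <= od * a + N * l)%N.
  by apply: leq_trans (le1 N) _; rewrite leq_add2r leq_mul2r geq_minl orbT.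
apply: leq_trans (leq_mul (leqnn N) le2) _.
rewrite /= expnS mulnDr mulnDl; apply: leq_add.
  by rewrite /a; apply: eq_leq; ring.
by rewrite mulnCA leq_mul2l hl orbT.
Qed.

Lemma normal_step (B : idomainType) (beta : {rmorphism B -> L}) x ys xs K :
  normal_at beta ys (x :: xs) -> F 1%N x ->
  bnd (idl L) (isp ([set` ys] `|` [set` x :: xs])) setT K ->
  exists (B' : idomainType) (beta' : {rmorphism B' -> L}), normal_at beta' (x :: ys) xs.
Proof.
move=> [gen small [Xs [EXs Xs0 Xmax]] res ch] Fx bK.
have [h [hC hx hF]] := pser_eval beta cF Fx.
exists (pser B), h; split.
- exact: (normal_gen_step Fx hF gen).
- exact: (normal_small_step hC hx bK small).
- exists (pvar B :: map (@pconst B) Xs); split.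
  + rewrite /= hx -map_comp; congr (_ :: _); rewrite -EXs.
    by apply: eq_map => r /=; rewrite hC.
  + move=> X; rewrite inE => /orP[/eqP->|/mapP[Y YX ->]]; first exact: pvar_neq0.
    apply: contra (Xs0 _ YX) => /eqP/(congr1 (fun a => pcoef a 0)) /= ->.
    exact: eqxx.
  + have iS := sspan_subm idfun [set` pvar B :: map (@pconst B) Xs].
    have [S0 Sd Sm] := iS.
    have lift b : isp [set` Xs] b -> isp [set` pvar B :: map (@pconst B) Xs] (pconst b).
      move=> hb; have : [set b | isp [set` pvar B :: map (@pconst B) Xs] (pconst b)] b; last by [].
      apply: (sspan_least _ _ hb).
        exact: (idl_preimage (@pconst B) iS).
      move=> y yX; apply: sub_sspan; rewrite /= inE; apply/orP; right; exact: map_f.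
    have pv a : isp [set` pvar B :: map (@pconst B) Xs] (pvar B * a).
      by apply: (idlMr _ iS); apply: sub_sspan; rewrite /= inE eqxx.
    move=> b; rewrite (pser_split0 b).
    have [hb|[b' hb]] := Xmax (pcoef b 0).
      by left; apply: Sd; [exact: lift|exact: pv].
    right; exists (pconst b').
    have -> : pconst b' * (pconst (pcoef b 0) + pvar B * pshift 1 b) - 1 =
       pconst (b' * pcoef b 0 - 1) + pvar B * (pconst b' * pshift 1 b).
      rewrite rmorphB rmorphM rmorph1; ring.
    by apply: Sd; [exact: lift|exact: pv].
- by move=> z; have [b hb] := res z; exists (pconst b); rewrite hC.
- exact: (rmorph_pchar (@pconst B) ch).
Qed.

Lemma normal_all (B : idomainType) (beta : {rmorphism B -> L}) ys xs K :
  normal_at beta ys xs -> (forall x, x \in xs -> F 1%N x) ->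
  bnd (idl L) (isp ([set` ys] `|` [set` xs])) setT K ->
  exists (B' : idomainType) (beta' : {rmorphism B' -> L}) (zs : seq L),
    [/\ normal_at beta' zs [::], size zs = (size ys + size xs)%N &
        {subset zs <= ys ++ xs}].
Proof.
elim: xs B beta ys => [|x xs IH] B beta ys nys Fxs bK.
  by exists B, beta, ys; split=> //; rewrite ?addn0 ?cats0.
have [B' [beta' n']] := normal_step nys (Fxs x (mem_head _ _)) bK.
have [||B2 [beta2 [zs [h1 h2 h3]]]] := IH B' beta' (x :: ys) n'.
- by move=> y ys'; apply: Fxs; rewrite inE ys' orbT.
- apply: bnd_sub bK _ _ _ => //; apply: sspan_mono => y [yy|].
    by left; rewrite /= inE yy orbT.
  by rewrite /= inE => /orP[/eqP->|yx]; [left; rewrite /= inE eqxx|right].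
exists B2, beta2, zs; split=> //; first by rewrite h2 /= addSnnS.
move=> z /h3; rewrite !mem_cat !inE => /orP[/orP[->|->]|->] //; rewrite ?orbT //.
Qed.

End Normalization.

(* L is the completion of A, module-finite over a power series ring B in d variables, as
   in Cohen's structure theorem; [nz_small] expresses that L / g L has dimension < d. *)
Record normalization (A L : comNzRingType) (M : set A) (d p : nat)
    (iota : {rmorphism A -> L}) (B : idomainType) (beta : {rmorphism B -> L})
    (us : seq L) (Xs : seq B) : Prop := {
  nz_gen : forall z, exists c : nat -> B, z = \sum_(i < size us) beta (c i) * us`_i;
  nz_small : forall g, g != 0 -> exists C, forall N, exists l,
    bnd (idl L) (isp ([set beta g] `|` iota @` ipow M N)) setT l /\ (N * l <= C * N ^ d)%N;
  nz_size : size Xs = d;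
  nz_ne0 : forall X, X \in Xs -> X != 0;
  nz_in : forall X, X \in Xs -> isp (iota @` M) (beta X);
  nz_max : forall b, isp [set` Xs] b \/ exists b', isp [set` Xs] (b' * b - 1);
  nz_res : forall z, exists b, isp (iota @` M) (z - beta b);
  nz_char : p \in [pchar B];
  nz_contr : forall I N a, idl A I -> ipow M N `<=` I -> isp (iota @` I) (iota a) -> I a;
  nz_dense : forall N z, exists a, isp (iota @` ipow M N) (z - iota a);
  nz_sep : forall z, (forall N, isp (iota @` ipow M N) z) -> z = 0 }.

Lemma normalization_exists (A : comNzRingType) (k : fieldType) (f : {rmorphism A -> k})
    (p : nat) (M : set A) : p \in [pchar A] -> fin_gen A -> loc M ->
  (forall x, M x <-> f x = 0) -> (forall y, exists x, f x = y) ->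
  exists (L : comNzRingType) (iota : {rmorphism A -> L}) (B : idomainType)
    (beta : {rmorphism B -> L}) us Xs,
    normalization M (krull_dim A) p iota beta us Xs.
Proof.
move=> pA nA lM fM fsurj.
have [L [iota [sigma [F [cF dense contr ext res]]]]] := completion pA nA lM fM fsurj.
have [iF [F0 Fs] FM Fsep Fc] := cF.
have iM : idl A M by case: lM.
have F1E : F 1%N `<=` isp (iota @` M) by have := ext 1%N; rewrite ipow1.
have MF n x : isp (iota @` ipow M n) x -> F n x.
  by apply: (sspan_least (iF n)) => _ [a Ma <-]; apply/contr.
(* [A] is dense in [L], so an element of the extension of [I] agrees with an element of [I] modulo
   [F N], and [I] contains [M^N]. *)
have contraction I N a : idl A I -> ipow M N `<=` I -> isp (iota @` I) (iota a) -> I a.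
  move=> iI MI hz; have [I0 Id Im] := iI; have [FN0 FNd FNm] := iF N.
  have : exists2 i, I i & F N (iota a - iota i).
    apply: (sspan_least (Y := [set z | exists2 i, I i & F N (z - iota i)]) _ _ hz).
      split.
      - by exists 0 => //; rewrite rmorph0 subrr.
      - move=> x y [i Ii hi] [j Ij hj]; exists (i + j); first exact: Id.
        by rewrite rmorphD opprD addrACA; exact: FNd.
      - move=> z y [i Ii hi]; have [b hb] := dense N z; exists (b * i); first exact: Im.
        rewrite /= (_ : z * y - _ = z * (y - iota i) + iota i * (z - iota b)).
          by apply: FNd; exact: FNm.
        rewrite rmorphM; ring.
    by move=> _ [i Ii <-]; exists i => //; rewrite subrr.
  case=> i Ii; rewrite -rmorphB => /contr /MI h.
  by rewrite -[a](subrK i); exact: Id.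
have [sop [ssop Msop [c hc]]] := sop_exists nA lM.
pose xs := map iota sop.
have Fxs x : x \in xs -> F 1%N x.
  by move=> /mapP[y ys ->]; apply/contr; rewrite ipow1 //; exact: Msop.
have Fcxs : F c `<=` isp [set` xs].
  apply: subset_trans (ext c) _; apply: sspan_least; first exact: sspan_subm.
  move=> _ [a Ma <-]; have iX := sspan_subm idfun [set` xs]; have [X0 Xd Xm] := iX.
  have : [set a | isp [set` xs] (iota a)] a; last by [].
  apply: (sspan_least _ _ (hc _ Ma)).
    exact: (idl_preimage iota iX).
  by move=> y ys; apply: sub_sspan; rewrite /= map_f.
(* Modulo [F c], the ring [L] is spanned over the coefficient field by the generators of the [M^n]
   with [n < c]. *)
have husE : exists us : seq L, forall z : L, addset (sspan sigma [set` us]) (F c) z.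
  elim: (c) => [|n [us IH]].
    exists [::] => z; exists 0; first by have [] := sspan_subm sigma [set` [::]].
    by exists z; rewrite ?F0 // add0r.
  have [g Eg] := nA _ (ipow_idl M n).
  exists (us ++ map iota g) => z; have [s hs [w hw <-]] := IH z.
  have iS := sspan_subm sigma [set` us ++ map iota g].
  have iA : subm sigma (F n.+1).
    by have [a1 a2 a3] := iF n.+1; split=> // b x; exact: a3.
  have [S0 Sd Sm] := submA iS iA.
  apply: Sd.
    exists s; last by exists 0; rewrite ?addr0 //; have [] := iF n.+1.
    by apply: sspan_mono hs => y yu; rewrite /= mem_cat yu.
  have : isp [set` map iota g] w.
    have := ext _ _ hw; apply: sspan_least; first exact: sspan_subm.
    move=> _ [a Ma <-]; move: Ma; rewrite Eg => ha.
    have iX := sspan_subm idfun [set` map iota g]; have [X0 Xd Xm] := iX.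
    have : [set a | isp [set` map iota g] (iota a)] a; last by [].
    apply: (sspan_least _ _ ha).
      exact: (idl_preimage iota iX).
    by move=> y ys; apply: sub_sspan; rewrite /= map_f.
  move=> /sspan_seqP[e ->]; apply: (subm_sum _ (submA iS iA)) => i _.
  have [b hb] := res (e i).
  rewrite (_ : _ * _ = sigma b * (map iota g)`_i + (e i - sigma b) * (map iota g)`_i);
    last by rewrite /=; ring.
  have gi : (map iota g)`_i \in map iota g by rewrite mem_nth.
  exists (sigma b * (map iota g)`_i).
    have [_ _ Sm'] := iS; apply: Sm'; apply: sub_sspan.
    by rewrite /= mem_cat gi orbT.
  exists ((e i - sigma b) * (map iota g)`_i) => //.
  rewrite -add1n; apply: FM => //.
  have /mapP[a ag ->] := gi; apply/contr; rewrite Eg; exact: sub_sspan.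
have [us hus] := husE.
have pk : p \in [pchar k] by exact: (rmorph_pchar f pA).
(* At the start [B] is the coefficient field: a nonzero [g] is a unit and the quotient vanishes. *)
have n0 : normal_at F p us sigma [::] xs.
  split.
  - move=> z; have [s /sspan_seqP[e ->] [w hw <-]] := hus z.
    by exists e, w; split=> //; exact: Fcxs.
  - move=> g g0; exists 0%N => N; exists 0%N; split; last by rewrite muln0.
    set X := isp _; have iX : idl L X by exact: sspan_subm.
    apply: bnd0; rewrite (idlT iX) // -(rmorph1 sigma) -(mulVf g0) rmorphM.
    by apply: (idlM _ iX); apply: sub_sspan; left; left.
  - exists [::]; split=> // b; have [->|b0] := eqVneq b 0.
      by left; have [] := sspan_subm idfun [set` ([::] : seq k)].
    right; exists b^-1; rewrite mulVf // subrr.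
    by have [] := sspan_subm idfun [set` ([::] : seq k)].
  - exact: res.
  - exact: pk.
have [K bK] := local_len nA lM c.
have bK' : bnd (idl L) (isp ([set` [::]] `|` [set` xs])) setT K.
  apply: (@bnd_preim _ _ (idl A) (idl L) iota).
  - by move=> W; exact: subm_sgrp.
  - by move=> W; exact: idl_preimage.
  - move=> z _; have [a ha] := dense c z; exists (z - iota a); last by exists a; rewrite subrK.
    by apply: (sspan_mono _ (Fcxs _ ha)) => y; right.
  - apply: bnd_sub bK _ _ _ => // a Ma /=.
    by apply: (sspan_mono _ (Fcxs _ _)) => [y|]; [right|apply/contr].
have [B [beta [zs [nz szs zsub]]]] := normal_all cF n0 Fxs bK'.
have [gen small [Xs [EXs Xs0 Xmax]] nres ch] := nz.
exists L, iota, B, beta, us, Xs; split=> //.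
- move=> z; have [e [w [hw ->]]] := gen z; exists e.
  by move: hw => /sspan_seqP[e' ->]; rewrite big_ord0 addr0.
- move=> g g0; have [C hC] := small g g0; exists C => N; have [l [bl hl]] := hC N.
  exists l; split; last by rewrite -ssop; move: hl; rewrite szs size_map.
  apply: bnd_sub bl _ _ _ => //; apply: isp_mono_gens => y [[->|[x xz <-]]|//].
    by apply: sub_sspan; left.
  apply: sub_sspan; right; have /mapP[a as' ->] : x \in xs by exact: (zsub _ xz).
  by rewrite -rmorphXn; exists (a ^+ N) => //; apply: ipowX; exact: Msop.
- by rewrite -(size_map beta) EXs szs /= size_map.
- move=> X XX; apply: F1E; apply: Fxs; apply: zsub; rewrite -EXs; exact: map_f.
- by move=> z; have [b hb] := nres z; exists b; exact: F1E.
- by move=> N z; have [a ha] := dense N z; exists a; exact: ext.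
- by move=> z hz; apply: Fsep => n; exact: MF.
Qed.

Lemma nonincreasing_stable (f : nat -> nat) : (forall n, (f n.+1 <= f n)%N) ->
  exists n, f n.+1 = f n.
Proof.
move=> h; have ex : exists m, `[< exists n, f n = m >] by exists (f 0%N); apply/asboolP; exists 0%N.
have [m /asboolP[n En] hm] := ex_minnP ex; exists n.
by apply/eqP; rewrite eqn_leq h En hm //; apply/asboolP; exists n.+1.
Qed.

(** * Generic semisimplicity *)

Section MatrixFrobenius.
Variables (K : fieldType) (r p : nat).
Hypothesis pK : p \in [pchar K].

Lemma mx_frobD (a b : 'M[K]_r) : GRing.comm a b -> (a + b) ^+ p = a ^+ p + b ^+ p.
Proof.
move=> ab; have pp := pcharf_prime pK; have p0 := prime_gt0 pp.
have pM (x : 'M[K]_r) n : (p %| n)%N -> x *+ n = 0.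
  move=> /dvdnP[m ->]; rewrite mulnC mulrnA -[x *+ p]scaler_nat.
  by rewrite (pcharf0 pK) scale0r mul0rn.
rewrite exprDn_comm // (bigD1 ord0) //= (bigD1 ord_max) /=; last first.
  by rewrite -val_eqE /= -lt0n.
rewrite bin0 subn0 mulr1n expr0 mulr1 subnn binn mul1r mulr1n addrA big1 ?addr0 //.
move=> i /andP[]; rewrite -!val_eqE /= => i0 ip; apply: pM; apply: prime_dvd_bin => //.
by have := ltn_ord i; lia.
Qed.

Lemma mx_exprZ n (c : K) (a : 'M[K]_r) : (c *: a) ^+ n = c ^+ n *: a ^+ n.
Proof.
elim: n => [|n IH]; first by rewrite !expr0 scale1r.
by rewrite !exprS IH -!mulmxE -scalemxAl -scalemxAr scalerA.
Qed.

Lemma mx_frob_sum n (c : 'I_n -> K) (e : 'I_n -> 'M[K]_r) :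
  (forall i j, e i * e j = e j * e i) ->
  (\sum_i c i *: e i) ^+ p = \sum_i c i ^+ p *: e i ^+ p.
Proof.
move=> ce; have p0 := prime_gt0 (pcharf_prime pK).
have key (s : seq 'I_n) : (\sum_(i <- s) c i *: e i) ^+ p = \sum_(i <- s) c i ^+ p *: e i ^+ p.
  elim: s => [|i s IH]; first by rewrite !big_nil expr0n -(prednK p0).
  rewrite !big_cons mx_frobD ?IH; first by rewrite mx_exprZ.
  rewrite /GRing.comm mulr_suml mulr_sumr; apply: eq_bigr => j _.
  by rewrite -!mulmxE -!scalemxAl -!scalemxAr !mulmxE ce scalerA mulrC -scalerA.
exact: key.
Qed.

End MatrixFrobenius.

Section Semisimple.
Variables (K : fieldType) (r : nat) (E : {vspace 'M[K]_r}).
Hypotheses (E1 : (1 : 'M[K]_r) \in E) (EM : forall a b, a \in E -> b \in E -> a * b \in E).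
Hypothesis EC : forall a b, a \in E -> b \in E -> a * b = b * a.
Hypothesis Ered : forall a, a \in E -> a * a = 0 -> a = 0.

Lemma EX a n : a \in E -> a ^+ n \in E.
Proof. by move=> aE; elim: n => [|n IH]; rewrite ?expr0 // exprS EM. Qed.

Lemma E_nilpotent a n : a \in E -> a ^+ n = 0 -> a = 0.
Proof.
move=> aE an.
have h k : a ^+ (2 ^ k) = 0 -> a = 0.
  elim: k => [|k IH]; first by rewrite expn0 expr1.
  by rewrite expnSr exprM expr2 => /Ered h; apply/IH/h/EX.
apply: (h n); rewrite -(subnK (ltnW (ltn_expl n (leqnn 2)))) exprD an mulr0 //.
Qed.

(** Makes [c * d] an idempotent. The descending chain of the [c^n E] stops with some
    [c^n = c^(n+1) d], so [c (1 - c d)] is nilpotent, hence zero. *)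
Lemma E_idempotent c : c \in E -> c != 0 ->
  exists2 d, d \in E & c = c * (c * d).
Proof.
move=> cE c0.
pose V n := (linfun (mulmx (c ^+ n)) @: E)%VS.
have VP n a : reflect (exists2 d, d \in E & a = c ^+ n * d) (a \in V n).
  by apply: (iffP memv_imgP) => -[d dE ->]; exists d; rewrite ?lfunE.
have VS n : (V n.+1 <= V n)%VS.
  apply/subvP => a /VP[d dE ->]; apply/VP; exists (c * d); first exact: EM.
  by rewrite exprSr mulrA.
have [n En] := nonincreasing_stable (fun n => dimvS (VS n)).
have EV : V n.+1 = V n by apply/eqP; rewrite eqEdim VS En /=.
have : c ^+ n \in V n.+1 by rewrite EV; apply/VP; exists 1; rewrite ?mulr1.
case/VP => d dE Ec; exists d => //.
have dcE : 1 - c * d \in E by rewrite rpredB // EM.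
have cdE : c * (1 - c * d) \in E by rewrite EM.
have : (c * (1 - c * d)) ^+ n.+1 = 0.
  rewrite exprMn_comm; last exact: EC.
  have Z : c ^+ n.+1 * (1 - c * d) = 0.
    by rewrite mulrBr mulr1 [c ^+ n.+1]exprS -mulrA [c ^+ n * _]mulrA -exprSr -Ec subrr.
  by rewrite [(1 - _) ^+ _]exprS mulrA Z mul0r.
move/(E_nilpotent cdE)/eqP; rewrite mulrBr mulr1 subr_eq0 => /eqP.
by rewrite mulrA.
Qed.

Definition stable (U : {vspace 'rV[K]_r}) := forall v e, v \in U -> e \in E -> v *m e \in U.

Definition cycE (v : 'rV[K]_r) : {vspace 'rV[K]_r} := (linfun (mulmx v) @: E)%VS.

Lemma cycEP v w : reflect (exists2 e, e \in E & w = v *m e) (w \in cycE v).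
Proof. by apply: (iffP memv_imgP) => -[d dE ->]; exists d; rewrite ?lfunE. Qed.

Lemma cycE_stable v : stable (cycE v).
Proof.
move=> w e /cycEP[d dE ->] eE; apply/cycEP; exists (d * e); first exact: EM.
by rewrite mulmxA.
Qed.

Lemma cycE_id v : v \in cycE v.
Proof. by apply/cycEP; exists 1 => //; rewrite mulmx1. Qed.

Lemma stableD U W : stable U -> stable W -> stable (U + W)%VS.
Proof.
move=> sU sW v e /memv_addP[u uU [w wW ->]] eE.
by rewrite mulmxDl memv_add //; [exact: sU|exact: sW].
Qed.

Lemma stableI U W : stable U -> stable W -> stable (U :&: W)%VS.
Proof.
by move=> sU sW v e; rewrite !memv_cap => /andP[vU vW] eE; rewrite sU ?sW.
Qed.

(** Semisimplicity. For [W] maximal and [v] outside [U + W], take an idempotent [e] of largest rank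
    sending [v] into [U + W]. Then [v (1 - e)] generates a stable space meeting [U + W] trivially,
    which enlarges [W]. *)
Lemma stable_complement U W0 : stable U -> stable W0 -> (U :&: W0 = 0)%VS ->
  exists W, [/\ stable W, (W0 <= W)%VS, (U :&: W = 0)%VS & (U + W = fullv)%VS].
Proof.
move=> sU sW0 UW0.
pose P n := `[< exists W, [/\ stable W, (W0 <= W)%VS, (U :&: W = 0)%VS & \dim W = n] >].
have exP : exists n, P n by exists (\dim W0); apply/asboolP; exists W0.
have bP n : P n -> (n <= \dim {:'rV[K]_r})%N.
  by move=> /asboolP[W [_ _ _ <-]]; apply: dimvS; exact: subvf.
have [n /asboolP[W [sW W0W UW dW]] maxW] := ex_maxnP exP bP.
exists W; split=> //; apply/eqP; rewrite eqEsubv subvf /=; apply/subvP => v _.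
apply: contrapT => /negP vN.
have sUW := stableD sU sW.
pose Q (e : 'M[K]_r) := [/\ e \in E, e * e = e & v *m e \in (U + W)%VS].
pose QR m := `[< exists e, Q e /\ \rank e = m >].
have exQ : exists m, QR m.
  exists (\rank (0 : 'M[K]_r)); apply/asboolP; exists 0; split=> //; split.
  - exact: mem0v.
  - by rewrite mulr0.
  - by rewrite mulmx0 mem0v.
have bQ m : QR m -> (m <= r)%N by move=> /asboolP[e [_ <-]]; exact: rank_leq_row.
have [m /asboolP[e [[eE ee ve] re]] maxe] := ex_maxnP exQ bQ.
(* Otherwise [E_idempotent] applied to [a * (1 - e)] yields a nonzero idempotent [f] orthogonal to
   [e] with [v *m f] in [U + W], and [e + f] has larger rank. *)
have annih a : a \in E -> v *m a \in (U + W)%VS -> a * (1 - e) = 0.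
  move=> aE va; apply/eqP; apply: contrapT => /negP c0.
  set c := a * (1 - e) in c0.
  have eE' : 1 - e \in E by rewrite rpredB.
  have cE : c \in E by rewrite EM.
  have [d dE Ec] := E_idempotent cE c0.
  have ce : c * e = 0 by rewrite /c -mulrA mulrBl mul1r ee subrr mulr0.
  set f := c * d; have fE : f \in E by rewrite EM.
  have ff : f * f = f by rewrite {2}/f mulrA [f * c]EC // -Ec.
  have fe : f * e = 0 by rewrite /f -mulrA (EC dE eE) mulrA ce mul0r.
  have ef : e * f = 0 by rewrite EC.
  have f0 : f != 0 by apply: contraNneq c0 => f0; rewrite Ec -/f f0 mulr0.
  have vc : v *m c \in (U + W)%VS.
    by rewrite /c mulmxA; apply: sUW.
  have : (\rank (e + f)%R <= m)%N.
    apply: maxe; apply/asboolP; exists (e + f); split=> //; split.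
    - by rewrite rpredD.
    - by rewrite mulrDr !mulrDl ee ff fe ef addr0 add0r.
    - by rewrite mulmxDr rpredD // /f mulmxA; apply: sUW.
  have rk : \rank (e + f)%R = (\rank e + \rank f)%N.
    rewrite -mxrank_disjoint_sum; last first.
      apply/eqP/rowV0P => w; rewrite sub_capmx => /andP[/submxP[x ->] /submxP[y E2]].
      have : x *m e *m e = y *m f *m e by rewrite E2.
      rewrite -[x *m e *m e]mulmxA -[y *m f *m e]mulmxA (_ : e *m e = e) //.
      by rewrite (_ : f *m e = 0) // mulmx0.
    apply/eqP; rewrite eqn_leq; apply/andP; split; apply: mxrankS.
      by rewrite addmx_sub_adds.
    rewrite addsmx_sub; apply/andP; split.
      by apply/submxP; exists e; rewrite mulmxDr (_ : e *m e = e) // (_ : e *m f = 0) ?addr0.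
    by apply/submxP; exists f; rewrite mulmxDr (_ : f *m f = f) // (_ : f *m e = 0) ?add0r.
  rewrite rk re -{2}[m]addn0 leq_add2l leqn0 mxrank_eq0 => f00.
  by rewrite f00 in f0.
pose v' := v *m (1 - e).
have v'N : v' \notin (U + W)%VS.
  apply: contra vN => h; rewrite -[v](subrK (v *m e)) rpredD //.
  by rewrite -{1}[v]mulmx1 -mulmxBr.
have eE' : 1 - e \in E by rewrite rpredB.
have ev' a : a \in E -> v' *m a \in (U + W)%VS -> v' *m a = 0.
  move=> aE h.
  have hE : (1 - e) * a \in E by rewrite EM.
  have := annih _ hE; rewrite mulmxA => /(_ h) Z.
  have : (1 - e) * a = 0.
    rewrite -Z -mulrA (EC aE eE') mulrA; congr (_ * _).
    by rewrite mulrBr mulr1 mulrBl mul1r ee subrr subr0.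
  by rewrite /v' -mulmxA mulmxE => ->; rewrite mulmx0.
have sC : stable (cycE v') := @cycE_stable v'.
have dCW : (\dim (W + cycE v') <= n)%N.
  apply: maxW; apply/asboolP; exists (W + cycE v')%VS; split=> //.
  - exact: stableD.
  - exact: subv_trans (addvSl _ _).
  - apply/eqP; rewrite -subv0; apply/subvP => w; rewrite memv_cap memv0 => /andP[wU].
    case/memv_addP => x xW [y /cycEP[a aE Ey] Ew].
    have y0 : y = 0.
      rewrite Ey; apply: ev' => //; rewrite -Ey (_ : y = w - x); last by rewrite Ew addrC addKr.
      by apply: rpredB; [exact: (subvP (addvSl U W) _ wU)|exact: (subvP (addvSr U W) _ xW)].
    have : w \in (U :&: W)%VS by rewrite memv_cap wU Ew y0 addr0 xW.
    by rewrite UW memv0.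
have EW : W = (W + cycE v')%VS.
  by apply/eqP; rewrite eqEdim addvSl dW.
move/negP: v'N; apply; apply: (subvP (addvSr U W)); rewrite EW.
exact: (subvP (addvSr _ _) _ (cycE_id v')).
Qed.

End Semisimple.

Section Semilinear.
Variables (K : fieldType) (r p : nat) (E : {vspace 'M[K]_r}).
Hypothesis pK : p \in [pchar K].
Hypotheses (E1 : (1 : 'M[K]_r) \in E) (EM : forall a b, a \in E -> b \in E -> a * b \in E).
Hypothesis EC : forall a b, a \in E -> b \in E -> a * b = b * a.
Hypothesis Ered : forall a, a \in E -> a * a = 0 -> a = 0.
Hypothesis Efrob : forall e, e \in E -> exists n (c : 'I_n -> K) (a : 'I_n -> 'M[K]_r),
  (forall i, a i \in E) /\ e = \sum_i c i *: a i ^+ p.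

Definition semilinear_on (U : {vspace 'rV[K]_r}) (u : 'rV[K]_r -> 'rV[K]_r) :=
  [/\ forall v w, v \in U -> w \in U -> u (v + w) = u v + u w,
      forall c v, v \in U -> u (c *: v) = c ^+ p *: u v,
      forall v e, v \in U -> e \in E -> u (v *m e) = u v *m (e ^+ p) &
      forall v, v \in U -> exists s : seq 'rV[K]_r,
        {subset s <= U} /\ v \in <<map u s>>%VS].

(** Split off a cyclic summand [v0 E] and put [u (v0 e + w) = v0 e^p + u2 w]. This is well defined
    because [v0 e = 0] implies [v0 e^p = 0], and the image spans because [E] is spanned by its
    [p]-th powers. *)
Lemma semilinear_exists U : stable E U -> exists u, semilinear_on U u.
Proof.
have p0 := prime_gt0 (pcharf_prime pK).
have [n] := ubnP (\dim U); elim: n U => // n IH U dU sU.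
have [U0|U0] := eqVneq U 0%VS.
  exists (fun=> 0); split.
  - by move=> v w _ _; rewrite addr0.
  - by move=> c v _; rewrite scaler0.
  - by move=> v e _ _; rewrite mul0mx.
  - by move=> v; rewrite U0 memv0 => /eqP ->; exists [::]; split=> //; exact: mem0v.
pose v0 := vpick U.
have v0U : v0 \in U by exact: memv_pick.
have v00 : v0 != 0 by rewrite vpick0.
have sC : stable E (cycE E v0) by exact: cycE_stable.
have CU : (cycE E v0 <= U)%VS.
  by apply/subvP => w /cycEP[e eE ->]; exact: sU.
have s0 : stable E 0%VS.
  by move=> v e; rewrite !memv0 => /eqP -> _; rewrite mul0mx.
have [W [sW _ CW CWf]] := stable_complement E1 EM EC Ered sC s0 (capv0 _).
pose W2 := (W :&: U)%VS.
have sW2 : stable E W2 by exact: stableI.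
have dec x : x \in U -> exists ew : 'M[K]_r * 'rV[K]_r,
    [/\ ew.1 \in E, ew.2 \in W2 & x = v0 *m ew.1 + ew.2].
  move=> xU; have : x \in (cycE E v0 + W)%VS by rewrite CWf memvf.
  case/memv_addP => c /[dup] cC /cycEP[e eE Ec] [w wW Ex]; exists (e, w); split=> //=.
    rewrite memv_cap wW (_ : w = x - c); last by rewrite Ex addrC addKr.
    by apply: rpredB => //; exact: (subvP CU).
  by rewrite -Ec.
have dW2 : (\dim W2 < n)%N.
  rewrite -ltnS; apply: leq_trans dU; rewrite ltnS ltnNge; apply/negP => h.
  have E2 : W2 = U by apply/eqP; rewrite eqEdim capvSr.
  have : v0 \in (cycE E v0 :&: W)%VS.
    rewrite memv_cap cycE_id //=; have : v0 \in W2 by rewrite E2.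
    by rewrite memv_cap => /andP[].
  by rewrite CW memv0 (negbTE v00).
have [u2 [u2D u2Z u2E u2s]] := IH W2 dW2 sW2.
have u20 : u2 0 = 0.
  have := u2D 0 0 (mem0v _) (mem0v _); rewrite addr0 => /eqP.
  by rewrite -subr_eq0 opprD addNKr oppr_eq0 => /eqP.
have dec' x : exists ew : 'M[K]_r * 'rV[K]_r, x \in U ->
    [/\ ew.1 \in E, ew.2 \in W2 & x = v0 *m ew.1 + ew.2].
  have [xU|xU] := boolP (x \in U); last by exists (0, 0).
  by have [ew h] := dec x xU; exists ew.
have [d dP] := choice dec'.
pose u x := v0 *m ((d x).1 ^+ p) + u2 (d x).2.
have frobB a b : a \in E -> b \in E -> (a - b) ^+ p = a ^+ p - b ^+ p.
  move=> aE bE; have bE' : a - b \in E by rewrite rpredB.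
  have cab : GRing.comm (a - b) b by exact: EC.
  by have := mx_frobD pK cab; rewrite subrK => ->; rewrite addrK.
have uE e w : e \in E -> w \in W2 -> u (v0 *m e + w) = v0 *m (e ^+ p) + u2 w.
  move=> eE wW; set x := _ + w.
  have xU : x \in U.
    rewrite /x rpredD //; first exact: sU.
    by move: wW; rewrite memv_cap => /andP[].
  have [h1 h2 h3] := dP x xU; rewrite /u; set e' := (d x).1 in h1 h3 *; set w' := (d x).2 in h2 h3 *.
  have Ed : v0 *m (e' - e) = w - w'.
    rewrite mulmxBr; apply/eqP; rewrite subr_eq addrAC -subr_eq opprK eq_sym; apply/eqP.
    by rewrite -h3 /x addrC.
  have : v0 *m (e' - e) \in (cycE E v0 :&: W)%VS.
    rewrite memv_cap; apply/andP; split; first by apply/cycEP; exists (e' - e); rewrite ?rpredB.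
    rewrite Ed; move: wW h2; rewrite !memv_cap => /andP[? _] /andP[? _]; exact: rpredB.
  rewrite CW memv0 => /eqP Z.
  have -> : w' = w by apply/eqP; rewrite eq_sym -subr_eq0 -Ed Z.
  congr (_ + _); apply/eqP; rewrite -subr_eq0 -mulmxBr -frobB //.
  by rewrite -(prednK p0) exprS -mulmxE mulmxA Z mul0mx.
have uE0 e : e \in E -> u (v0 *m e) = v0 *m (e ^+ p).
  by move=> eE; rewrite -[v0 *m e]addr0 uE ?mem0v // u20 addr0.
have uW w : w \in W2 -> u w = u2 w.
  move=> wW; rewrite -[w in LHS]add0r -(mulmx0 _ v0) uE ?mem0v //.
  by rewrite expr0n -[p](prednK p0) /= mulmx0 add0r.
exists u; split.
- move=> x y /dec[[e w] /= [eE wW ->]] /dec[[e' w'] /= [eE' wW' ->]].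
  rewrite addrACA -mulmxDr !uE ?rpredD // u2D // (mx_frobD pK) ?mulmxDr 1?addrACA //.
  exact: EC.
- move=> c x /dec[[e w] /= [eE wW ->]].
  rewrite scalerDr scalemxAr !uE ?rpredZ // u2Z // mx_exprZ scalerDr.
  by rewrite -scalemxAr.
- move=> x a /dec[[e w] /= [eE wW ->]] aE.
  rewrite mulmxDl -mulmxA mulmxE uE; last exact: sW2; last exact: EM.
  rewrite uE // u2E // mulmxDl -mulmxA mulmxE exprMn_comm //; exact: EC.
- move=> x /dec[[e w] /= [eE wW ->]].
  have [s [sW2' ws]] := u2s w wW.
  have [m [c [a [aE Ee]]]] := Efrob eE.
  exists ([seq v0 *m a i | i <- enum 'I_m] ++ s); split.
    move=> y; rewrite mem_cat => /orP[/mapP[i _ ->]|/sW2']; first exact: sU.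
    by rewrite memv_cap => /andP[].
  rewrite map_cat span_cat memv_add //; last first.
    suff -> : map u s = map u2 s by [].
    by apply/eq_in_map => y /sW2'; exact: uW.
  rewrite Ee mulmx_sumr; apply: rpred_sum => i _; rewrite -scalemxAr rpredZ //.
  rewrite -uE0 //; apply: memv_span; apply: map_f; apply/mapP; exists i => //.
  by rewrite mem_enum.
Qed.

End Semilinear.

(** * Coordinates over the fraction field of B *)

Section Fractions.
Import FracField generic_quotient.
Variable B : idomainType.
Local Notation K := {fraction B}.
Local Notation "x %:F" := (@FracField.tofrac B x).

Lemma frac_denom (x : K) : exists2 b, b != 0 & exists a, b%:F * x = a%:F.
Proof.
elim/quotW: x => y; exists y.2; first exact: denom_ratioP.
exists y.1; have y0 := denom_ratioP y.
unlock FracField.tofrac; rewrite -[LHS]FracField.pi_mul.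
apply/eqmodP; rewrite /= FracField.equivfE /FracField.mulf.
by rewrite !numden_Ratio ?mulf_neq0 ?oner_eq0 ?mulr1 ?mul1r.
Qed.

Lemma common_denom (I : eqType) (s : seq I) (x : I -> K) :
  exists2 b, b != 0 & forall i, i \in s -> exists a, b%:F * x i = a%:F.
Proof.
elim: s => [|i s [b b0 IH]]; first by exists 1; rewrite ?oner_eq0.
have [b1 b10 [a Ea]] := frac_denom (x i); exists (b * b1); first by rewrite mulf_neq0.
move=> j; rewrite inE => /orP[/eqP ->|/IH[a1 Ea1]].
  by exists (b * a); rewrite !tofracM -mulrA Ea.
by exists (b1 * a1); rewrite !tofracM -Ea1 mulrA [b%:F * _]mulrC.
Qed.

Lemma common_denom_row r (v : 'rV[K]_r) : exists2 b, b != 0 &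
  exists c : 'I_r -> B, b%:F *: v = \sum_j (c j)%:F *: delta_mx 0 j.
Proof.
have [b b0 h] := common_denom (enum 'I_r) (fun j => v 0 j); exists b => //.
have h' j : exists a, b%:F * v 0 j = a%:F by apply: h; rewrite mem_enum.
have [c hc] := choice h'; exists c.
rewrite [v]row_sum_delta scaler_sumr; apply: eq_bigr => j _.
by rewrite scalerA hc.
Qed.

End Fractions.

Notation "x %:F" := (@FracField.tofrac _ x).

Section Coordinates.
Variables (L : comNzRingType) (B : idomainType) (beta : {rmorphism B -> L}).
Local Notation K := {fraction B}.

(* kappa : L / cc -> K^r is the localization at B \ {0}, in a basis lifted by y. *)
Record coordinates (cc : set L) r (kappa : L -> 'rV[K]_r) (y : 'I_r -> L) : Prop := {
  ckD : forall x z, kappa (x + z) = kappa x + kappa z;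
  ckZ : forall b x, kappa (beta b * x) = b%:F *: kappa x;
  cky : forall j, kappa (y j) = delta_mx 0 j;
  ck0 : forall x, cc x -> kappa x = 0;
  ck_sat : exists2 g, g != 0 & forall x, kappa x = 0 -> cc (beta g * x) }.

Lemma coordinates_exist us cc : idl L cc ->
  (forall z, exists c : nat -> B, z = \sum_(i < size us) beta (c i) * us`_i) ->
  exists r (kappa : L -> 'rV[K]_r) y, coordinates cc kappa y.
Proof.
move=> icc gen.
pose cmb (ys : seq L) (c : nat -> B) := \sum_(i < size ys) beta (c i) * ys`_i.
(* A maximal subfamily of [us] independent modulo [cc], with one denominator [g] expressing
   everything through it. *)
have [ys [g [ind g0 span]]] : exists ys g,
   [/\ forall c, cc (cmb ys c) -> forall i, (i < size ys)%N -> c i = 0, g != 0 &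
      forall a, exists c, cc (beta g * cmb us a - cmb ys c)].
  elim: us {gen} => [|u us [ys [g [ind g0 span]]]].
    exists [::], 1; split=> //; first by rewrite oner_eq0.
    by move=> a; exists (fun=> 0); rewrite /cmb !big_ord0 mulr0 subr0; case: icc.
  have cons_cmb a w ws : cmb (w :: ws) a = beta (a 0%N) * w + cmb ws (fun i => a i.+1).
    by rewrite /cmb /= big_ord_recl.
  have cmbD ws a a' : cmb ws (fun i => a i + a' i) = cmb ws a + cmb ws a'.
    by rewrite /cmb -big_split /=; apply: eq_bigr => i _; rewrite rmorphD mulrDl.
  have cmbZ ws b a : cmb ws (fun i => b * a i) = beta b * cmb ws a.
    by rewrite /cmb mulr_sumr; apply: eq_bigr => i _; rewrite rmorphM mulrA.
  have [[b [c [b0 hc]]]|dep] := pselect (exists b c, b != 0 /\ cc (beta b * u - cmb ys c)).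
    exists ys, (g * b); split=> //; first by rewrite mulf_neq0.
    move=> a; have [c' hc'] := span (fun i => a i.+1).
    exists (fun i => g * a 0%N * c i + b * c' i).
    rewrite cons_cmb cmbD !cmbZ.
    have -> : beta (g * b) * (beta (a 0%N) * u + cmb us (fun i => a i.+1)) -
       (beta (g * a 0%N) * cmb ys c + beta b * cmb ys c') =
       beta (g * a 0%N) * (beta b * u - cmb ys c) +
       beta b * (beta g * cmb us (fun i => a i.+1) - cmb ys c').
      by rewrite !rmorphM; ring.
    by case: (icc) => _ cD _; apply: cD; apply: (idlM _ icc).
  exists (u :: ys), g; split=> // [c hc|a].
    rewrite cons_cmb in hc.
    have c0 : c 0%N = 0.
      apply/eqP/negPn/negP => c0; apply: dep; exists (c 0%N), (fun i => (-1) * c i.+1); split=> //.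
      by rewrite cmbZ rmorphN rmorph1 mulN1r opprK.
    move: hc; rewrite c0 rmorph0 mul0r add0r => /ind h [_|i]; first exact: c0.
    exact: h.
  have [c' hc'] := span (fun i => a i.+1).
  exists (fun i => if i is j.+1 then c' j else g * a 0%N).
  rewrite !cons_cmb.
  have -> : beta g * (beta (a 0%N) * u + cmb us (fun i => a i.+1)) -
    (beta (g * a 0%N) * u + cmb ys c') = beta g * cmb us (fun i => a i.+1) - cmb ys c'.
    by rewrite rmorphM; ring.
  exact: hc'.
pose Pz z (c : nat -> B) := cc (beta g * z - cmb ys c).
have ex z : exists c, Pz z c.
  by have [a ->] := gen z; exact: span.
have [C hC] := choice ex.
have gF : g%:F != 0 by rewrite tofrac_eq0.
pose kappa z : 'rV[K]_(size ys) := \row_j ((C z j)%:F / g%:F).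
(* Any relation [b z = sum c_i y_i] modulo [cc] with [b] nonzero computes [kappa z]; so [kappa] is
   independent of the chosen [C] and linear. *)
have char z b c : b != 0 -> cc (beta b * z - cmb ys c) ->
    kappa z = \row_(j < size ys) ((c j)%:F / b%:F).
  move=> b0 hc; have bF : b%:F != 0 by rewrite tofrac_eq0.
  have : cc (cmb ys (fun i => b * C z i - g * c i)).
    have -> : cmb ys (fun i => b * C z i - g * c i) =
       beta g * (beta b * z - cmb ys c) - beta b * (beta g * z - cmb ys (C z)).
      have -> : cmb ys (fun i => b * C z i - g * c i) = beta b * cmb ys (C z) - beta g * cmb ys c.
        rewrite /cmb !mulr_sumr -sumrB; apply: eq_bigr => i _.
        by rewrite rmorphB !rmorphM mulrBl !mulrA.
      by ring.
    by case: (subm_sgrp icc) => _; apply; apply: (idlM _ icc) => //; exact: hC.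
  move=> /ind h; apply/rowP => j; rewrite !mxE; apply/eqP.
  rewrite eqr_div // -!rmorphM tofrac_eq -subr_eq0 mulrC [c j * g]mulrC; apply/eqP; exact: h.
exists (size ys), kappa, (fun j => ys`_j); split.
- move=> x z; rewrite (char _ g (fun i => C x i + C z i)) //.
    by apply/rowP => j; rewrite !mxE rmorphD mulrDl.
  have -> : beta g * (x + z) - cmb ys (fun i => C x i + C z i) =
     (beta g * x - cmb ys (C x)) + (beta g * z - cmb ys (C z)).
    rewrite mulrDr addrACA -opprD; congr (_ - _); rewrite /cmb -big_split /=.
    by apply: eq_bigr => i _; rewrite rmorphD mulrDl.
  by case: (icc) => _ cD _; apply: cD; exact: hC.
- move=> b x; rewrite (char _ g (fun i => b * C x i)) //.
    by apply/rowP => j; rewrite !mxE rmorphM mulrA.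
  have -> : beta g * (beta b * x) - cmb ys (fun i => b * C x i) =
     beta b * (beta g * x - cmb ys (C x)).
    rewrite mulrBr mulrCA; congr (_ - _); rewrite /cmb mulr_sumr.
    by apply: eq_bigr => i _; rewrite rmorphM mulrA.
  exact: (idlM _ icc (hC _)).
- move=> j; rewrite (char _ 1 (fun i => (i == j)%:R)) ?oner_eq0 //.
    apply/rowP => i; rewrite !mxE eqxx rmorph1 divr1 -val_eqE /=.
    by case: eqP => _; rewrite ?rmorph1 ?rmorph0.
  rewrite rmorph1 mul1r /cmb (bigD1 j) //= eqxx rmorph1 mul1r big1 ?addr0 ?subrr.
    by case: icc.
  by move=> i /negbTE; rewrite -val_eqE /= => ->; rewrite rmorph0 mul0r.
- move=> x ccx; rewrite (char _ 1 (fun=> 0)) ?oner_eq0 //.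
    by apply/rowP => i; rewrite !mxE rmorph0 mul0r.
  rewrite rmorph1 mul1r /cmb big1 ?subr0 // => i _; by rewrite rmorph0 mul0r.
- exists g => // x /rowP k0; suff -> : beta g * x = beta g * x - cmb ys (C x) by exact: hC.
  rewrite /cmb big1 ?subr0 // => i _; have := k0 i; rewrite !mxE => /eqP.
  by rewrite mulf_eq0 invr_eq0 (negbTE gF) orbF tofrac_eq0 => /eqP ->; rewrite rmorph0 mul0r.
Qed.

End Coordinates.

Lemma ltn_size_map (T U : Type) (f : T -> U) s (i : 'I_(size (map f s))) : (i < size s)%N.
Proof. by case: i => i /=; rewrite size_map. Qed.

Lemma span_ind (K : fieldType) (V : vectType K) (s : seq V) (P : V -> Prop) :
  P 0 -> (forall c v w, P v -> P w -> P (c *: v + w)) -> (forall v, v \in s -> P v) ->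
  forall v, v \in << s >>%VS -> P v.
Proof.
move=> P0 PD; elim: s => [|x s IH] Ps v; first by rewrite span_nil memv0 => /eqP ->.
rewrite span_cons => /memv_addP[_ /vlineP[c ->] [w ws ->]].
apply: (PD); first by apply: Ps; exact: mem_head.
by apply: IH ws => u us; apply: Ps; rewrite inE us orbT.
Qed.

Section CoordinateAlgebra.
Variables (L : comNzRingType) (B : idomainType) (beta : {rmorphism B -> L}).
Local Notation K := {fraction B}.
Variables (us : seq L) (cc : set L) (r : nat) (kappa : L -> 'rV[K]_r) (y : 'I_r -> L).
Hypothesis icc : idl L cc.
Hypothesis gen : forall z, exists c : nat -> B, z = \sum_(i < size us) beta (c i) * us`_i.
Hypothesis H : coordinates beta cc kappa y.

Lemma kappa0 : kappa 0 = 0.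
Proof. by apply: (ck0 H); case: icc. Qed.

Lemma kappaN x : kappa (- x) = - kappa x.
Proof. by apply/eqP; rewrite -addr_eq0 -(ckD H) addNr kappa0. Qed.

Lemma kappaB x z : kappa (x - z) = kappa x - kappa z.
Proof. by rewrite (ckD H) kappaN. Qed.

Lemma kappa_sum (I : Type) (s : seq I) (P : pred I) (F : I -> L) :
  kappa (\sum_(i <- s | P i) F i) = \sum_(i <- s | P i) kappa (F i).
Proof. exact: (big_morph kappa (ckD H) kappa0). Qed.

(** The kernel of [kappa] is the [B]-torsion modulo [cc], which is an ideal. *)
Lemma kappa_ideal x z : kappa x = 0 -> kappa (z * x) = 0.
Proof.
move=> x0; have [g g0 hg] := ck_sat H.
have := ck0 H (idlM z icc (hg x x0)); rewrite mulrCA (ckZ H) => /eqP.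
by rewrite scaler_eq0 tofrac_eq0 (negbTE g0) => /eqP.
Qed.

Lemma kappa_denom v : exists2 b, b != 0 & exists x, b%:F *: v = kappa x.
Proof.
have [b b0 [c Ec]] := common_denom_row v; exists b => //.
exists (\sum_j beta (c j) * y j); rewrite Ec kappa_sum.
by apply: eq_bigr => j _; rewrite (ckZ H) (cky H).
Qed.

Definition mu z : 'M[K]_r := \matrix_(i, j) kappa (z * y i) 0 j.

Lemma row_mu z i : row i (mu z) = kappa (z * y i).
Proof. by apply/rowP => j; rewrite !mxE. Qed.

Lemma kappaM z w : kappa (z * w) = kappa w *m mu z.
Proof.
have [b b0 [c Ec]] := common_denom_row (kappa w).
have : kappa (beta b * w - \sum_j beta (c j) * y j) = 0.
  rewrite kappaB (ckZ H) Ec kappa_sum; apply/eqP; rewrite subr_eq0; apply/eqP.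
  by apply: eq_bigr => j _; rewrite (ckZ H) (cky H).
move=> /(kappa_ideal z); rewrite mulrBr kappaB => /eqP; rewrite subr_eq0 => /eqP E.
have bF : b%:F != 0 by rewrite tofrac_eq0.
apply: (scalerI bF); rewrite -(ckZ H) mulrCA E scalemxAl Ec mulmx_suml mulr_sumr kappa_sum.
by apply: eq_bigr => j _; rewrite mulrCA (ckZ H) -scalemxAl -rowE row_mu.
Qed.

Lemma muD z w : mu (z + w) = mu z + mu w.
Proof. by apply/row_matrixP => i; rewrite linearD /= !row_mu mulrDl (ckD H). Qed.

Lemma mu0 : mu 0 = 0.
Proof. by apply/row_matrixP => i; rewrite linear0 row_mu mul0r kappa0. Qed.

Lemma mu_sum (I : Type) (s : seq I) (P : pred I) (F : I -> L) :
  mu (\sum_(i <- s | P i) F i) = \sum_(i <- s | P i) mu (F i).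
Proof. exact: (big_morph mu muD mu0). Qed.

Lemma muZ b z : mu (beta b * z) = b%:F *: mu z.
Proof. by apply/row_matrixP => i; rewrite linearZ /= !row_mu -mulrA (ckZ H). Qed.

Lemma muM z w : mu (z * w) = mu z * mu w.
Proof.
by apply/row_matrixP => i; rewrite row_mul !row_mu [z * w]mulrC -mulrA kappaM.
Qed.

Lemma mu1 : mu 1 = 1.
Proof. by apply/row_matrixP => i; rewrite row_mu mul1r (cky H) row1. Qed.

Lemma muX z n : mu (z ^+ n) = mu z ^+ n.
Proof. by elim: n => [|n IH]; rewrite ?expr0 ?mu1 // !exprS muM IH. Qed.

(** Semilinearity reduces the denominators to those on the finitely many [us]. The exponent [m] is 1
    for a projection and [p] for a Frobenius-semilinear map. *)
Lemma lattice m (f : 'rV[K]_r -> 'rV[K]_r) :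
  (forall v w, f (v + w) = f v + f w) -> (forall c v, f (c *: v) = c ^+ m *: f v) ->
  exists2 b, b != 0 & forall w, exists w', b%:F *: f (kappa w) = kappa w'.
Proof.
move=> fD fZ.
have [b b0 hb] : exists2 b, b != 0 & forall u, u \in us -> exists x, b%:F *: f (kappa u) = kappa x.
  elim: (us) => [|u s [b b0 IH]]; first by exists 1; rewrite ?oner_eq0.
  have [b1 b10 [x Ex]] := kappa_denom (f (kappa u)).
  exists (b * b1); first by rewrite mulf_neq0.
  move=> w; rewrite inE => /orP[/eqP ->|/IH[x' Ex']].
    by exists (beta b * x); rewrite tofracM -scalerA Ex (ckZ H).
  by exists (beta b1 * x'); rewrite mulrC tofracM -scalerA Ex' (ckZ H).
exists b => // w; have [c ->] := gen w.
have f0 : f 0 = 0 by have /eqP := fD 0 0; rewrite addr0 -subr_eq0 opprD addNKr oppr_eq0 => /eqP.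
have h (i : 'I_(size us)) : exists x, b%:F *: f (kappa us`_i) = kappa x by apply: hb; exact: mem_nth.
have [x hx] := choice h.
exists (\sum_(i < size us) beta (c i ^+ m) * x i).
rewrite !kappa_sum (big_morph f fD f0) scaler_sumr; apply: eq_bigr => i _.
by rewrite !(ckZ H) fZ scalerA mulrC -scalerA hx -tofracXn.
Qed.

(** Finitely many values already span [kappa X] over the fraction field, and clearing denominators
    leads back into [X]. *)
Lemma max_span (X : set L) : idl L X -> exists U : {vspace 'rV[K]_r},
  (forall x, X x -> kappa x \in U) /\
  forall v, v \in U -> exists2 b, b != 0 & exists2 x, X x & b%:F *: v = kappa x.
Proof.
move=> iX.
pose P n := `[< exists s : seq L, (forall x, x \in s -> X x) /\ \dim <<map kappa s>> = n >].
have exP : exists n, P n by exists (\dim <<map kappa [::]>>); apply/asboolP; exists [::].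
have bP n : P n -> (n <= \dim {:'rV[K]_r})%N.
  by move=> /asboolP[s [_ <-]]; apply: dimvS; exact: subvf.
have [n /asboolP[s [sX ds]] maxs] := ex_maxnP exP bP.
exists <<map kappa s>>%VS; split=> [x Xx|v].
  have sub : (<<map kappa s>> <= <<map kappa (x :: s)>>)%VS.
    by apply: sub_span => w; rewrite /= inE orbC => ->.
  have /eqP -> : (<<map kappa s>> == <<map kappa (x :: s)>>)%VS.
    rewrite eqEdim sub ds; apply: maxs; apply/asboolP; exists (x :: s); split=> //.
    by move=> w; rewrite inE => /orP[/eqP ->|/sX].
  by apply: memv_span; rewrite /= mem_head.
rewrite -[map kappa s]in_tupleE => /coord_span ->.
set T := in_tuple _; set c := fun i => coord T i v.
have [b b0 hb] := common_denom (enum 'I_(size (map kappa s))) c.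
have hb' i : exists a, b%:F * c i = a%:F by apply: hb; rewrite mem_enum.
have [a ha] := choice hb'; exists b => //.
exists (\sum_i beta (a i) * s`_i).
  apply: (subm_sum _ iX) => i _; apply: (idlM _ iX); apply: sX; apply: mem_nth.
  exact: ltn_size_map.
rewrite kappa_sum scaler_sumr; apply: eq_bigr => i _.
rewrite scalerA ha (ckZ H); congr (_ *: _).
by rewrite (nth_map 0) // ltn_size_map.
Qed.

Variable p : nat.
Hypothesis pB : p \in [pchar B].

(* The spans of the p^n-th powers of L decrease, hence stabilize; from then on Frobenius
   maps a basis of E to a basis of E, so that E is reduced. *)
Lemma frob_algebra : exists n (E : {vspace 'M[K]_r}),
  [/\ (1 : 'M[K]_r) \in E, forall a b, a \in E -> b \in E -> a * b \in E,
      forall a b, a \in E -> b \in E -> a * b = b * a,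
      forall a, a \in E -> a * a = 0 -> a = 0 &
  [/\ forall e, e \in E -> exists n (c : 'I_n -> K) (a : 'I_n -> 'M[K]_r),
        (forall i, a i \in E) /\ e = \sum_i c i *: a i ^+ p,
      forall z, mu (z ^+ (p ^ n)) \in E &
      forall (V : {vspace 'rV[K]_r}) v, (forall z, v *m mu z \in V) ->
        forall e, e \in E -> v *m e \in V]].
Proof.
have pK : p \in [pchar K] by exact: (rmorph_pchar (@FracField.tofrac B)).
have pL : p \in [pchar L] by exact: (rmorph_pchar beta).
have pp := pcharf_prime pK; have p1 := prime_gt1 pp; have p0 := prime_gt0 pp.
pose E n := (<<[seq mu (u ^+ (p ^ n)) | u <- us]>>)%VS.
have inE' n z : mu (z ^+ (p ^ n)) \in E n.
  have [c ->] := gen z.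
  have -> : (\sum_(i < size us) beta (c i) * us`_i) ^+ (p ^ n) =
    \sum_(i < size us) beta (c i ^+ (p ^ n)) * us`_i ^+ (p ^ n).
    rewrite (big_morph _ (frobXD pL n) (_ : 0 ^+ (p ^ n) = 0)); last first.
      by rewrite expr0n expn_eq0 (gtn_eqF p0).
    by apply: eq_bigr => i _; rewrite exprMn rmorphXn.
  rewrite mu_sum; apply: rpred_sum => i _; rewrite muZ rpredZ //.
  by apply: memv_span; apply/mapP; exists us`_i => //; exact: mem_nth.
have indE n (V : {vspace 'M[K]_r}) : (forall z, mu (z ^+ (p ^ n)) \in V) -> (E n <= V)%VS.
  by move=> h; apply/span_subvP => _ /mapP[u _ ->].
have Edec n : (E n.+1 <= E n)%VS.
  by apply: indE => z; rewrite expnS exprM; exact: inE'.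
have EM n a b : a \in E n -> b \in E n -> a * b \in E n.
  move=> aE; move: b; apply: span_ind; first by rewrite mulr0 mem0v.
    by move=> c v w hv hw; rewrite mulrDr -mulmxE -scalemxAr rpredD ?rpredZ.
  move=> _ /mapP[u _ ->]; move: a aE; apply: span_ind; first by rewrite mul0r mem0v.
    by move=> c v w hv hw; rewrite mulrDl -mulmxE -scalemxAl rpredD ?rpredZ.
  by move=> _ /mapP[w _ ->]; rewrite -muM -exprMn; exact: inE'.
have EC n a b : a \in E n -> b \in E n -> a * b = b * a.
  move=> aE; move: b; apply: span_ind; first by rewrite mulr0 mul0r.
    move=> c v w hv hw; rewrite mulrDr mulrDl -hw -!mulmxE -scalemxAr -scalemxAl.
    by rewrite !mulmxE hv.
  move=> _ /mapP[u _ ->]; move: a aE; apply: span_ind; first by rewrite mul0r mulr0.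
    move=> c v w hv hw; rewrite mulrDr mulrDl hw -!mulmxE -scalemxAr -scalemxAl.
    by rewrite !mulmxE hv.
  by move=> _ /mapP[w _ ->]; rewrite -!muM mulrC.
have [n dn] := nonincreasing_stable (fun n => dimvS (Edec n)).
have En : E n.+1 = E n by apply/eqP; rewrite eqEdim Edec dn leqnn.
pose X := vbasis (E n).
have XE (i : 'I_(\dim (E n))) : X`_i \in E n by apply: vbasis_mem; apply: mem_nth; rewrite size_tuple.
have frobE a : a \in E n -> a ^+ p = \sum_i coord X i a ^+ p *: X`_i ^+ p.
  move=> aE; rewrite {1}(coord_vbasis aE) (mx_frob_sum pK) // => i j; exact: EC.
pose Xp := [tuple of map (fun x => x ^+ p) X].
have Xpi (i : 'I_(\dim (E n))) : Xp`_i = X`_i ^+ p.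
  by rewrite /= (nth_map 0) // size_tuple.
have span : (E n <= <<Xp>>)%VS.
  apply: (@subv_trans _ _ (E n.+1)); first by rewrite En.
  apply: indE => z; rewrite expnSr exprM muX frobE //.
  apply: rpred_sum => i _; rewrite rpredZ // -Xpi; apply: memv_span; apply: mem_nth.
  by rewrite size_tuple.
have basis : basis_of (E n) Xp by rewrite basisEdim span size_tuple leqnn.
exists n, (E n); split; [|exact: EM|exact: EC| |split].
- by rewrite -mu1 -[X in mu X](expr1n _ (p ^ n)); exact: inE'.
- move=> a aE a2.
  have ap : a ^+ p = 0 by rewrite -(subnK p1) exprD expr2 a2 mulr0.
  rewrite (coord_vbasis aE) big1 // => i _.
  have /freeP fr := basis_free basis.
  have /(_ i)/eqP : forall i, coord X i a ^+ p = 0.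
    apply: fr; rewrite -[RHS]ap (frobE a aE).
    by apply: eq_bigr => j _; rewrite -Xpi.
  by rewrite expf_eq0 p0 /= => /eqP ->; rewrite scale0r.
- move=> e eE; exists (\dim (E n)), (fun i => coord Xp i e), (fun i => X`_i); split=> //.
  rewrite {1}(coord_basis basis eE); apply: eq_bigr => i _; by rewrite Xpi.
- exact: inE'.
- move=> V v h; apply: span_ind; first by rewrite mulmx0 mem0v.
    by move=> c a b ha hb; rewrite mulmxDr -scalemxAr rpredD ?rpredZ.
  by move=> _ /mapP[u _ ->].
Qed.

End CoordinateAlgebra.

Section FrobeniusLift.
Variables (L : comNzRingType) (B : idomainType) (beta : {rmorphism B -> L}) (us : seq L).
Variable p : nat.
Hypothesis gen : forall z, exists c : nat -> B, z = \sum_(i < size us) beta (c i) * us`_i.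
Hypothesis pB : p \in [pchar B].
Local Notation K := {fraction B}.

(* Clearing denominators in an E-linear projection of K^r onto the span of aa that kills bb. *)
Lemma separated_ideals aa bb : idl L aa -> idl L bb ->
  (forall x, aa x -> bb x -> x = 0) ->
  exists n g, g != 0 /\ forall G : set L, (forall x, G x -> exists z, x = z ^+ (p ^ n)) ->
    forall x y, aa x -> bb y -> isp G (x + y) -> isp G (beta g * x).
Proof.
move=> iaa ibb ab0.
have ic0 : idl L [set 0].
  by split=> // [x y -> ->|b x ->] /=; rewrite ?addr0 ?mulr0.
have [r [kappa [ys H]]] := coordinates_exist ic0 gen.
have [n [E [E1 EM EC Ered [Efrob muE Eind]]]] := frob_algebra ic0 gen H pB.
have [g1 g10 sat] := ck_sat H.
have k_inj x z : kappa x = kappa z -> beta g1 * x = beta g1 * z.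
  move=> e; have : kappa (x - z) = 0 by rewrite (kappaB ic0 H) e subrr.
  by move=> /sat /eqP; rewrite mulrBr subr_eq0 => /eqP.
have span X : idl L X -> exists U : {vspace 'rV[K]_r}, [/\ stable E U,
    forall x, X x -> kappa x \in U &
    forall v, v \in U -> exists2 b, b != 0 & exists2 x, X x & b%:F *: v = kappa x].
  move=> iX; have [U [h1 h2]] := max_span ic0 H iX.
  exists U; split=> // v e vU; apply: (Eind U v) => z.
  have [b b0 [x Xx Ex]] := h2 v vU.
  have bF : b%:F != 0 by rewrite tofrac_eq0.
  rewrite -[v](scalerK bF) Ex -scalemxAl -(kappaM ic0 H) rpredZ //; apply: h1.
  exact: (idlM z iX).
have [U [sU aU Ua]] := span aa iaa; have [V [sV bV Vb]] := span bb ibb.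
(* A common vector gives, after clearing denominators, an element of [aa] and of [bb], hence 0. *)
have UV : (U :&: V = 0)%VS.
  apply/eqP; rewrite -subv0; apply/subvP => v; rewrite memv_cap memv0 => /andP[/Ua[b b0 [x ax Ex]]].
  case/Vb => b' b'0 [x' bx' Ex'].
  have : kappa (beta b' * x) = kappa (beta b * x').
    by rewrite !(ckZ H) -Ex -Ex' !scalerA mulrC.
  move=> /k_inj e; have e0 : beta g1 * (beta b' * x) = 0.
    apply: ab0; first by do 2!apply: (idlM _ iaa).
    by rewrite e; do 2!apply: (idlM _ ibb).
  have := kappa0 ic0 H; rewrite -e0 !(ckZ H) -Ex !scalerA => /eqP.
  by rewrite -!tofracM scaler_eq0 tofrac_eq0 !mulf_eq0 (negbTE g10) (negbTE b0) (negbTE b'0).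
have [W [sW VW UW UWf]] := stable_complement E1 EM EC Ered sU sV UV.
pose pi := daddv_pi U W.
have piU v : v \in U -> pi v = v by exact: daddv_pi_id.
have piUW v : pi v + daddv_pi W U v = v by rewrite daddv_pi_add // UWf memvf.
have piW v : v \in W -> pi v = 0.
  move=> vW; have : pi v \in (U :&: W)%VS.
    rewrite memv_cap memv_pi /=; have -> : pi v = v - daddv_pi W U v by rewrite -{2}(piUW v) addrK.
    by rewrite rpredB // memv_pi.
  by rewrite UW memv0 => /eqP.
have piE v e : e \in E -> pi (v *m e) = pi v *m e.
  move=> eE; rewrite -{1}(piUW v) mulmxDl linearD /= piU; last by apply: sU => //; exact: memv_pi.
  by rewrite [X in _ + X]piW ?addr0 //; apply: sW => //; exact: memv_pi.
have [b b0 hb] := lattice ic0 gen H (m := 1) (linearD pi) (fun c v => linearZ _ v).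
exists n, (g1 * b); split=> [|G hG x y ax by' Gxy]; first by rewrite mulf_neq0.
(* The projection commutes with [E], not with [L]. Quantifying over all multipliers [l] makes [Y] an
   ideal, so only the elements of [G], which are [p^n]-th powers, have to be checked. *)
pose Y := [set x | forall l, exists2 x', isp G x' & b%:F *: pi (kappa (l * x)) = kappa x'].
have iG : idl L (isp G) by exact: sspan_subm.
have iY : idl L Y.
  split=> [l|x1 x2 h1 h2 l|a x1 h1 l].
  - exists 0; first by case: iG.
    by rewrite mulr0 (kappa0 ic0 H) linear0 scaler0.
  - have [x1' G1 e1] := h1 l; have [x2' G2 e2] := h2 l; exists (x1' + x2').
      by case: iG => _ + _; apply.
    by rewrite mulrDr !(ckD H) linearD scalerDr e1 e2.
  - have [x' G' e'] := h1 (l * a); exists x' => //; by rewrite -e' mulrA.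
have GY : G `<=` Y.
  move=> x1 /[dup] Gx1 /hG[z Ez] l.
  have [w Ew] := hb l; exists (w * x1); first by apply: (idlM _ iG); exact: sub_sspan.
  by rewrite [l * x1]mulrC [w * x1]mulrC Ez !(kappaM ic0 H) piE // scalemxAl Ew.
have /(_ 1)[x' Gx'] := sspan_least iY GY Gxy.
rewrite mul1r (ckD H) linearD /= piU ?aU // piW ?addr0; last by apply: (subvP VW); exact: bV.
by rewrite -(ckZ H) => /k_inj e; rewrite rmorphM -mulrA e; apply: (idlM _ iG).
Qed.

(** [u] lifts to [L] a nonzero multiple of the semilinear map on the generic module. Identities
    there hold in [L] only modulo the kernel [c'] of [kappa], and [g1] brings [c'] back into
    [cc]. *)
Lemma frobenius_lift cc : idl L cc ->
  exists n c' (u : L -> L) g g1, [/\ idl L c', cc `<=` c', g != 0 /\ g1 != 0,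
    forall x, c' x -> cc (beta g1 * x) & [/\ forall x y, c' (u (x + y) - u x - u y),
    forall b x, c' (u (beta b * x) - beta b ^+ p * u x),
    forall x y, c' (u (y ^+ (p ^ n) * x) - (y ^+ (p ^ n)) ^+ p * u x),
    forall x, c' x -> c' (u x) &
    forall z, sspan beta (u @` setT `|` c') (beta g * z)]].
Proof.
move=> icc.
have [r [kappa [ys H]]] := coordinates_exist icc gen.
have [n [E [E1 EM EC Ered [Efrob muE Eind]]]] := frob_algebra icc gen H pB.
have [g1 g10 sat] := ck_sat H.
have pK : p \in [pchar K] by exact: (rmorph_pchar (@FracField.tofrac B)).
have p0 := prime_gt0 (pcharf_prime pK).
have sf : stable E fullv by move=> v e _ _; exact: memvf.
have [f [fD' fZ' fE' fs']] := semilinear_exists pK E1 EM EC Ered Efrob sf.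
have fD v w : f (v + w) = f v + f w by apply: fD'; exact: memvf.
have fZ c v : f (c *: v) = c ^+ p *: f v by apply: fZ'; exact: memvf.
have f0 : f 0 = 0 by have := fZ 0 0; rewrite scale0r expr0n -(prednK p0) scale0r.
have [b b0 hb] := lattice icc gen H fD fZ.
have bF : b%:F != 0 by rewrite tofrac_eq0.
have [u hu] := choice hb.
pose c' := [set x | kappa x = 0].
have ic' : idl L c'.
  split=> [|x y /= x0 y0|a x x0]; rewrite /c' /=.
  - exact: (kappa0 icc H).
  - by rewrite (ckD H) x0 y0 addr0.
  - exact: (kappa_ideal icc H).
have spanK v : exists s : seq L, v \in << [seq kappa (u x) | x <- s] >>%VS.
  have [s [_ vs]] := fs' v (memvf v).
  elim: s v vs => [|w s IH] v; first by exists [::].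
  rewrite /= span_cons => /memv_addP[_ /vlineP[c ->] [v' /IH[s' v's] ->]].
  have [d d0 [x Ex]] := kappa_denom icc H w.
  exists (x :: s'); rewrite /= span_cons memv_add // memvZ //.
  have dF : d%:F != 0 by rewrite tofrac_eq0.
  rewrite -hu -Ex fZ scalerA; apply/vlineP; exists (b%:F * d%:F ^+ p)^-1.
  by rewrite scalerA mulVf ?scale1r // mulf_neq0 // expf_neq0.
have spanB z : exists2 g, g != 0 & sspan beta (u @` setT `|` c') (beta g * z).
  have [s zs] := spanK (kappa z).
  suff [g g0 [w hw ew]] : exists2 g, g != 0 & exists2 w, sspan beta (u @` setT) w &
      g%:F *: kappa z = kappa w.
    exists g => //; have -> : beta g * z = w + (beta g * z - w) by rewrite addrC subrK.
    case: (sspan_subm beta (u @` setT `|` c')) => _ + _; apply.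
      by apply: (sspan_mono _ hw); exact: subsetUl.
    apply: sub_sspan; right; rewrite /c' /= (kappaB icc H) (ckZ H) ew subrr //.
  elim: s (kappa z) zs => [|x s IH] v /=.
    rewrite span_nil memv0 => /eqP ->; exists 1; rewrite ?oner_eq0 //.
    by exists 0; [case: (sspan_subm beta (u @` setT)) | rewrite scaler0 (kappa0 icc H)].
  rewrite span_cons => /memv_addP[_ /vlineP[c ->] [v' /IH[g g0 [w hw ew]] ->]].
  have [d d0 [a Ea]] := frac_denom c; exists (d * g); first by rewrite mulf_neq0.
  exists (beta (g * a) * u x + beta d * w).
    case: (sspan_subm beta (u @` setT)) => _ sD sZ; apply: (sD _ _ _ (sZ _ _ hw)).
    by apply: sZ; apply: sub_sspan; exists x.
  rewrite (ckD H) !(ckZ H) -ew scalerDr !scalerA !tofracM; congr (_ *: _ + _).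
  by rewrite -Ea mulrA [d%:F * _]mulrC.
have [g g0 hg] : exists2 g, g != 0 & forall z, sspan beta (u @` setT `|` c') (beta g * z).
  have iS := sspan_subm beta (u @` setT `|` c').
  suff [g g0 hg] : exists2 g, g != 0 & forall z, z \in us -> sspan beta (u @` setT `|` c') (beta g * z).
    exists g => // z; have [c ->] := gen z; rewrite mulr_sumr; apply: (subm_sum _ iS) => i _.
    by rewrite mulrCA; case: iS => _ _; apply; apply: hg; exact: mem_nth.
  elim: (us) => [|z s [g g0 IH]]; first by exists 1; rewrite ?oner_eq0.
  have [g' g'0 h'] := spanB z; exists (g * g'); first by rewrite mulf_neq0.
  case: iS => _ _ sZ w; rewrite inE rmorphM => /orP[/eqP ->|/IH h].
    by rewrite -mulrA; exact: sZ.
  by rewrite [beta g * _]mulrC -mulrA; exact: sZ.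
exists n, c', u, g, g1; split=> // [x /(ck0 H)//|]; split=> //.
- by move=> x y; rewrite /c' /= !(kappaB icc H) -!hu (ckD H) fD scalerDr addrAC addrK subrr.
- move=> d x; rewrite /c' /= (kappaB icc H) -rmorphXn (ckZ H) -!hu (ckZ H) fZ tofracXn.
  by rewrite !scalerA [b%:F * _]mulrC subrr.
- move=> x y; rewrite /c' /= (kappaB icc H) !(kappaM icc H) -!hu (kappaM icc H).
  by rewrite fE' ?memvf // !(muX icc H) -scalemxAl subrr.
- by move=> x x0; rewrite /c' /= -hu x0 f0 scaler0.
Qed.

End FrobeniusLift.

(** * Length asymptotics *)

Lemma bnd_cyc_ann (L B : comNzRingType) (beta : {rmorphism B -> L}) X z n : subm beta X ->
  bnd (idl B) [set b | X (beta b * z)] setT n -> bnd (subm beta) X (addset X (cyc beta z)) n.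
Proof.
move=> sX b.
pose f : {additive B -> L} := GRing.mull_fun z (beta : {additive B -> L}).
have fE x : f x = beta x * z by rewrite mulrC.
apply: (@bnd_preim _ _ (idl B) (subm beta) f).
- exact: subm_sgrp.
- move=> W [W0 WD WZ]; split=> [|x y hx hy|a x hx].
  + by change (W (f 0)); rewrite raddf0.
  + by change (W (f (x + y))); rewrite raddfD; exact: WD.
  + by change (W (f (a * x))); rewrite fE rmorphM -mulrA -fE; exact: WZ.
- by move=> _ [x Xx [_ [c _ <-] <-]]; exists x => //; exists c; rewrite fE.
have -> : f @^-1` X = [set b | X (beta b * z)].
  by apply/seteqP; split=> x; rewrite /preimage /mkset fE.
by apply: bnd_sub b _ _ _ => //.
Qed.

(** Ideals of [L] are [B]-submodules, so bounds over [B] become bounds over [L]. *)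
Lemma bnd_family (V : Type) (S S' : set (set V)) X Y n : S' `<=` S -> bnd S X Y n -> bnd S' X Y n.
Proof.
move=> SS b m hm; apply: b; elim: hm => {m Y} [Y sY XY|m Y Z _ IH sZ YZ nYZ].
  by apply: Lchain0 => //; exact: SS.
by apply: LchainS IH _ YZ nYZ; exact: SS.
Qed.

Lemma bnd_step (V : Type) (S : set (set V)) X Y Z n : S X -> S Y -> X `<=` Y -> X <> Y ->
  bnd S X Z n.+1 -> bnd S Y Z n.
Proof.
move=> sX sY XY nXY b m hm; rewrite -ltnS.
have := b _ (lchain_cat (LchainS (Lchain0 sX (fun _ => id)) sY XY nXY) hm).
by rewrite add1n.
Qed.

Section NormalizationLength.
Variables (A L : comNzRingType) (M : set A) (d p : nat) (iota : {rmorphism A -> L}).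
Variables (B : idomainType) (beta : {rmorphism B -> L}) (us : seq L) (Xs : seq B).
Hypothesis nz : normalization M d p iota beta us Xs.
Hypotheses (nA : fin_gen A) (lM : loc M).

Definition ext (X : set A) : set L := isp (iota @` X).

Lemma ext_idl X : idl L (ext X). Proof. exact: sspan_subm. Qed.

Lemma ext_mono X Y : X `<=` Y -> ext X `<=` ext Y.
Proof. by move=> XY; apply: sspan_mono; exact: image_subset. Qed.

Lemma ext_in X x : X x -> ext X (iota x).
Proof. by move=> Xx; apply: sub_sspan; exists x. Qed.

Lemma ext_add X Y : idl A X -> idl A Y -> ext (addset X Y) = addset (ext X) (ext Y).
Proof.
move=> [X0 _ _] [Y0 _ _]; apply/seteqP; split.
  apply: sspan_least; first by apply: submA; exact: ext_idl.
  move=> _ [_ [x Xx [y Yy <-]] <-]; rewrite rmorphD.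
  by exists (iota x); [exact: ext_in|exists (iota y); [exact: ext_in|]].
apply: addset_least; first exact: (subm_sgrp (ext_idl _)).
  by apply: ext_mono; exact: addset_subl.
by apply: ext_mono; exact: addset_subr.
Qed.

Lemma extM X Y Z : (forall x y, X x -> Y y -> Z (x * y)) ->
  forall x y, ext X x -> ext Y y -> ext Z (x * y).
Proof.
move=> h x y hx hy.
suff : ext X `<=` [set x | ext Z (x * y)] by exact.
apply: sspan_least.
  split=> [|a b|a b] /=; case: (ext_idl Z) => Z0 ZD ZM.
  - by rewrite mul0r.
  - by rewrite mulrDl; exact: ZD.
  - by rewrite -mulrA; exact: ZM.
move=> _ [a Xa <-] /=; suff : ext Y `<=` [set y | ext Z (iota a * y)] by exact.
apply: sspan_least.
  split=> [|b c|b c] /=; case: (ext_idl Z) => Z0 ZD ZM.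
  - by rewrite mulr0.
  - by rewrite mulrDr; exact: ZD.
  - by rewrite mulrCA; exact: ZM.
by move=> _ [b Yb <-] /=; rewrite -rmorphM; apply: ext_in; exact: h.
Qed.

Lemma ext_pow x N : ext M x -> ext (ipow M N) (x ^+ N).
Proof.
move=> hx; elim: N => [|N IH].
  by rewrite expr0 -(rmorph1 iota); apply: ext_in.
by rewrite exprS; apply: (extM _ hx IH) => a b Ma; exact: imul_in.
Qed.

Lemma ext_preim X N : idl A X -> ipow M N `<=` X -> iota @^-1` (ext X) = X.
Proof.
move=> iX NX; apply/seteqP; split=> x; last exact: ext_in.
exact: (nz_contr nz iX NX).
Qed.

Lemma lam_bnd X N : idl A X -> ipow M N `<=` X -> bnd (idl A) X setT (lam X).
Proof.
move=> iX NX; have [l bl] := local_len nA lM N.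
have b : bnd (idl A) X setT l by exact: (bnd_sub bl NX (fun _ => id) (submT _)).
by have [] := lenP b (@submT _ _ idfun) (fun _ _ => I).
Qed.

Lemma ext_bnd Y N n : idl L Y -> ext (ipow M N) `<=` Y ->
  bnd (idl A) (iota @^-1` Y) setT n -> bnd (idl L) Y setT n.
Proof.
move=> iY NY b; apply: (@bnd_preim _ _ (idl A) (idl L) (iota : {additive A -> L})).
- exact: subm_sgrp.
- by move=> W iW; exact: idl_preimage.
- move=> y _; have [a ha] := nz_dense nz N y; exists (y - iota a); first exact: NY.
  by exists a; rewrite subrK.
- exact: b.
Qed.

Lemma ext_fin Y N : idl L Y -> ext (ipow M N) `<=` Y -> bnd (idl L) Y setT (lam Y).
Proof.
move=> iY NY; have [l bl] := local_len nA lM N.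
have b : bnd (idl L) Y setT l.
  apply: (ext_bnd iY NY); apply: bnd_sub bl _ _ _ => //.
  by move=> x hx; apply: NY; exact: ext_in.
by have [] := lenP b (@submT _ _ idfun) (fun _ _ => I).
Qed.

(** Contraction undoes extension for ideals containing a power of [M], and by density an ideal of
    [L] above such an extension is recovered from its contraction. *)
Lemma lam_ext X N : idl A X -> ipow M N `<=` X -> lam (ext X) = lam X.
Proof.
move=> iX NX; have NX' := ext_mono NX.
have bX := lam_bnd iX NX; have bE := ext_fin (ext_idl X) NX'.
apply/eqP; rewrite eqn_leq; apply/andP; split.
  apply: len_le => //.
  by apply: (ext_bnd (ext_idl X) NX'); rewrite (ext_preim iX NX).
have [h _] := lenP bX (@submT _ _ idfun) (fun _ _ => I).
suff h' : lchain (idl L) (ext X) (lam X) (ext setT).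
  by apply: bE; apply: lchain_widen h' _ _ => //; exact: submT.
apply: (@lchain_map _ _ (idl A) (idl L) ext X setT) h => //.
- by move=> W _ _ _; exact: ext_idl.
- by move=> W _ XW _; exact: ext_mono.
- move=> W W' iW iW' XW WW' _; split; first exact: ext_mono.
  move=> E; have NW := subset_trans NX XW.
  by rewrite -(ext_preim iW NW) E (ext_preim iW' (subset_trans NW WW')).
Qed.

Lemma small_len g c : g != 0 -> (0 < d)%N -> exists C, forall e X Y, idl L X -> idl L Y ->
  X `<=` Y -> ext (ipow M (c * p ^ e)) `<=` X -> (forall y, Y y -> X (beta g * y)) ->
  (len (idl L) X Y <= C * (p ^ e) ^ d.-1)%N.
Proof.
move=> g0 d0; have p0 : (0 < p)%N by exact: prime_gt0 (pcharf_prime (nz_char nz)).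
have [C hC] := nz_small nz g0.
exists (C * c.+1 ^ d.-1)%N => e X Y iX iY XY MX gY.
(* Passing from [c] to [c.+1] makes the exponent positive, so that it can be cancelled in
   [N * l <= C * N ^ d]. *)
have MX' : ext (ipow M (c.+1 * p ^ e)) `<=` X.
  apply: subset_trans MX; apply: ext_mono; apply: ipow_anti.
  by rewrite leq_mul2r leqnSn orbT.
have bX := ext_fin iX MX'.
apply: leq_trans (len_killed iX iY XY gY bX) _.
have [l [bl hl]] := hC (c.+1 * p ^ e)%N.
have N0 : (0 < c.+1 * p ^ e)%N by rewrite muln_gt0 expn_gt0 p0.
have : (lam (addset X (cyc idfun (beta g))) <= l)%N.
  apply: len_le => //.
  apply: bnd_sub bl _ _ _ => //.
  apply: sspan_least; first by apply: submA => //; exact: cyc_subm.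
  move=> x [->|hx].
    by apply: addset_subr; [case: iX|exact: cyc_id].
  by apply: addset_subl; [case: (cyc_subm idfun (beta g))|apply: MX'; exact: sub_sspan].
move/leq_trans; apply; rewrite -(leq_pmul2l N0) (leq_trans hl) //.
by rewrite -{1}(prednK d0) expnS mulnCA -!mulnA -expnMn.
Qed.

Lemma max_len : bnd (idl B) (isp [set` Xs]) setT 1.
Proof.
have iX := sspan_subm idfun [set` Xs].
have h b : isp [set` Xs] (b * 1) \/ exists b', isp [set` Xs] (b' * b * 1 - 1).
  rewrite mulr1; case: (nz_max nz b) => [|[b' hb]]; first by left.
  by right; exists b'; rewrite mulr1.
apply: bnd_sub (bnd_cyc iX h) _ _ _ => //.
  move=> x _; apply: addset_subr; first by case: iX.
  by exists x => //=; rewrite mulr1.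
by apply: submA => //; exact: cyc_subm.
Qed.

Lemma max_pow_len N : bnd (idl B) (isp [set x ^+ N | x in [set` Xs]]) setT (N ^ d)%N.
Proof.
have i0 : idl B [set 0] by split=> // [x y -> ->|b x ->] /=; rewrite ?addr0 ?mulr0.
have b : bnd (idl B) (isp ([set 0] `|` [set` Xs])) setT 1.
  apply: bnd_sub max_len _ _ _ => //.
  by apply: sspan_mono; exact: subsetUr.
have := bnd_pows (N := N) i0 b; rewrite muln1 (nz_size nz) => h.
apply: bnd_sub h _ _ _ => //.
apply: sspan_least; first exact: sspan_subm.
move=> x [->|hx]; last exact: sub_sspan.
by case: (sspan_subm idfun [set x ^+ N | x in [set` Xs]]).
Qed.

(** The last multiple of [z] by elements of [M] that stays outside [X] is a socle element. *)
Lemma ext_socle X N z : idl L X -> ~ X z -> (forall a, ipow M N a -> X (iota a * z)) ->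
  exists y, ~ X y /\ forall x, ext M x -> X (x * y).
Proof.
move=> iX; elim: N z => [|N IH] z nXz h.
  by case: nXz; rewrite -[z]mul1r -(rmorph1 iota); exact: h.
have [[m [Mm nXm]]|hm] := pselect (exists m, M m /\ ~ X (iota m * z)).
  apply: (IH _ nXm) => a ha; rewrite mulrA -rmorphM [a * m]mulrC.
  by apply: h; exact: imul_in.
exists z; split=> // x hx; suff : ext M `<=` [set x | X (x * z)] by exact.
apply: sspan_least.
  case: (iX) => X0 XD XM; split=> [|a b|a b] /=.
  - by rewrite mul0r.
  - by rewrite mulrDl; exact: XD.
  - by rewrite -mulrA; exact: XM.
by move=> _ [m Mm <-] /=; apply: contrapT => n; apply: hm; exists m.
Qed.

End NormalizationLength.

Section FrobeniusCount.
Variables (A L : comNzRingType) (M : set A) (d p : nat) (iota : {rmorphism A -> L}).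
Variables (B : idomainType) (beta : {rmorphism B -> L}) (us : seq L) (Xs : seq B).
Hypothesis nz : normalization M d p iota beta us Xs.
Hypotheses (nA : fin_gen A) (lM : loc M) (d0 : (0 < d)%N).
Variables (n : nat) (cc : set L) (u : L -> L) (g : B).
Hypotheses (icc : idl L cc) (g0 : g != 0).
Hypothesis uD : forall x y, cc (u (x + y) - u x - u y).
Hypothesis uZ : forall b x, cc (u (beta b * x) - beta b ^+ p * u x).
Hypothesis uF : forall x y, cc (u (y ^+ (p ^ n) * x) - (y ^+ (p ^ n)) ^+ p * u x).
Hypothesis ucc : forall x, cc x -> cc (u x).
Hypothesis uS : forall z, sspan beta (u @` setT `|` cc) (beta g * z).

Definition uspan (Y : set L) : set L := sspan beta (u @` Y `|` cc).

Lemma uspan_subm Y : subm beta (uspan Y). Proof. exact: sspan_subm. Qed.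

Lemma uspan_mono X Y : X `<=` Y -> uspan X `<=` uspan Y.
Proof. by move=> XY; apply: sspan_mono; apply: setSU; exact: image_subset. Qed.

Lemma uspan_in X x : X x -> uspan X (u x).
Proof. by move=> Xx; apply: sub_sspan; left; exists x. Qed.

Lemma uspan_cc X x : cc x -> uspan X x.
Proof. by move=> Xx; apply: sub_sspan; right. Qed.

Lemma idl_subm X : idl L X -> subm beta X.
Proof. by case=> X0 XD XM; split=> // b x; exact: XM. Qed.

Lemma uspan_eq X x y : cc (x - y) -> uspan X y -> uspan X x.
Proof.
move=> /(@uspan_cc X _) h hy; case: (uspan_subm X) => _ + _.
by move/(_ _ _ h hy); rewrite subrK.
Qed.

(** Modulo [uspan X] only [u y] is new, because the residue field of [L] comes from [B]; it is
    killed by the [p]-th powers of the [d] variables, whence [p ^ d]. *)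
Lemma uspan_step X y : idl L X -> (forall x, ext iota M x -> X (x * y)) ->
  bnd (subm beta) (uspan X) (uspan (addset X (cyc idfun y))) (p ^ d).
Proof.
move=> iX hy; have sU := uspan_subm X.
have b : bnd (subm beta) (uspan X) (addset (uspan X) (cyc beta (u y))) (p ^ d).
  have h := max_pow_len nz (N := p).
  apply: bnd_cyc_ann => //; apply: (bnd_sub h _ (fun _ => id) (submT _)).
  apply: sspan_least.
    split=> [|b b'|b b'] /=; case: sU => U0 UD UZ.
    - by rewrite rmorph0 mul0r.
    - by rewrite rmorphD mulrDl; exact: UD.
    - by rewrite rmorphM -mulrA; exact: UZ.
  move=> _ [x Xx <-] /=; rewrite rmorphXn.
  apply: (@uspan_eq _ _ (u (beta x * y))).
    by case: (subm_sgrp icc) => _ hB; rewrite -opprB -[- _]add0r; apply: hB => //; case: icc.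
  by apply: uspan_in; apply: hy; exact: nz_in nz _ Xx.
apply: bnd_sub b _ _ _ => //; last by apply: submA => //; exact: cyc_subm.
apply: sspan_least; first by apply: submA => //; exact: cyc_subm.
have sA := submA sU (cyc_subm beta (u y)).
have UA : uspan X `<=` addset (uspan X) (cyc beta (u y)).
  by apply: addset_subl; case: (cyc_subm beta (u y)).
move=> x [[_ [x' Xx' [_ [l _ <-] <-]] <-]|hx]; last by apply: UA; exact: uspan_cc.
have [b' hb'] := nz_res nz l.
pose w := x' + (l - beta b') * y.
have Xw : X w by case: iX => _ XD _; apply: XD => //; exact: hy.
have -> : x' + idfun l * y = w + beta b' * y by rewrite /w /=; ring.
have -> : u (w + beta b' * y) = (u (w + beta b' * y) - u w - u (beta b' * y)) +
   (u w + (u (beta b' * y) - beta b' ^+ p * u y)) + beta b' ^+ p * u y by ring.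
exists (u (w + beta b' * y) - u w - u (beta b' * y) +
   (u w + (u (beta b' * y) - beta b' ^+ p * u y))).
  case: sU => _ UD _; apply: (UD _ _); first exact: uspan_cc.
  by apply: UD; [exact: uspan_in|exact: uspan_cc].
by exists (beta b' ^+ p * u y) => //; exists (b' ^+ p) => //; rewrite rmorphXn.
Qed.

Lemma uspan_bnd X N l : idl L X -> ext iota (ipow M N) `<=` X -> bnd (idl L) X setT l ->
  bnd (subm beta) (uspan X) (uspan setT) (p ^ d * l).
Proof.
elim: l X => [|l IH] X iX MX b.
  rewrite muln0; apply: bnd0; apply: uspan_mono => x _; apply: contrapT => nXx.
  have nE : X <> setT by move=> E; apply: nXx; rewrite E.
  by have := b 1%N (LchainS (Lchain0 iX (fun _ => id)) (submT _) (fun _ _ => I) nE).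
have [[z nXz]|XT] := pselect (exists z, ~ X z); last first.
  apply: (@bndW _ _ _ _ 0%N) => //; apply: bnd0; apply: uspan_mono => x _.
  by apply: contrapT => nXx; apply: XT; exists x.
have [y [nXy hy]] : exists y, ~ X y /\ forall x, ext iota M x -> X (x * y).
    apply: (ext_socle iX nXz (N := N)) => a ha; apply: (idlMr _ iX); apply: MX; exact: ext_in.
  pose Y := addset X (cyc idfun y).
  have iY : idl L Y by apply: submA => //; exact: cyc_subm.
  have XY : X `<=` Y by apply: addset_subl; case: (cyc_subm idfun y).
  have bY : bnd (idl L) Y setT l.
    apply: (bnd_step iX iY XY _ b) => E; apply: nXy; rewrite E.
    by apply: addset_subr; [case: iX|exact: cyc_id].
  rewrite mulnS; apply: (subm_bndD (Y := uspan Y)); try exact: uspan_subm.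
  + exact: uspan_mono.
  + exact: uspan_mono.
  + exact: uspan_step.
  + by apply: IH => //; exact: subset_trans XY.
Qed.

(* Applying u to a composition series of L / b_e: each simple factor produces a cyclic
   B-module killed by the x_i^p, of length at most p^d. *)
Lemma frob_recurrence c (G : nat -> set L) :
  (forall e x, G e x -> exists z, x = z ^+ (p ^ n)) ->
  (forall e x, G e x -> G e.+1 (x ^+ p)) ->
  (forall e, ext iota (ipow M (c * p ^ e)) `<=` isp (G e)) ->
  exists C, forall e, (lam (addset (isp (G e.+1)) cc) <=
    p ^ d * lam (addset (isp (G e)) cc) + C * (p ^ e.+1) ^ d.-1)%N.
Proof.
move=> Gq Gp MG; have [C hC] := small_len nz nA lM c g0 d0; exists C => e.
pose X e := addset (isp (G e)) cc.
have iX e' : idl L (X e') by apply: submA => //; exact: sspan_subm.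
have GX e' : isp (G e') `<=` X e' by apply: addset_subl; case: icc.
have cX e' : cc `<=` X e'.
  by apply: addset_subr; case: (sspan_subm idfun (G e')).
have MX e' : ext iota (ipow M (c * p ^ e')) `<=` X e' by exact: subset_trans (GX e').
have UX : uspan (X e) `<=` X e.+1.
  apply: sspan_least; first exact: idl_subm.
  move=> _ [[x hx <-]|/cX //].
  (* [u] is not [L]-linear; quantifying over [l] makes [Z] an ideal. The generators [G e] are
     [p^n]-th powers, which leave [u] as their [p]-th powers. *)
  pose Z := [set x | forall l, X e.+1 (u (l * x))].
  have iZ : idl L Z.
    split=> [l|x1 x2 h1 h2 l|a x1 h1 l].
    - by rewrite mulr0; apply: cX; apply: ucc; case: icc.
    - rewrite mulrDr; have -> : u (l * x1 + l * x2) =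
        (u (l * x1 + l * x2) - u (l * x1) - u (l * x2)) + (u (l * x1) + u (l * x2)) by ring.
      by case: (iX e.+1) => _ XD _; apply: (XD _ _); [exact: cX|apply: XD].
    - by rewrite mulrA.
  suff : Z x by move/(_ 1); rewrite mul1r.
  have XZ : X e `<=` Z.
    apply: addset_least; first exact: (subm_sgrp iZ).
      apply: (sspan_least iZ) => x1 hx1 l; have [z Ez] := Gq _ _ hx1.
      rewrite mulrC Ez.
      have -> : u (z ^+ (p ^ n) * l) = (u (z ^+ (p ^ n) * l) - (z ^+ (p ^ n)) ^+ p * u l) +
        (z ^+ (p ^ n)) ^+ p * u l by ring.
      case: (iX e.+1) => _ XD _; apply: XD; first exact: cX.
      by apply: (idlMr _ (iX _)); apply: GX; apply: sub_sspan; rewrite -Ez; exact: Gp.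
    by move=> x1 hx1 l; apply: cX; apply: ucc; exact: (idlM _ icc).
  exact: XZ.
(* The image of [u] generically spans [L]: the part [D / X e.+1] is bounded through [uspan setT],
   and the part above [D] is killed by [g] and falls under [small_len]. *)
pose D := addset (X e.+1) (cyc idfun (beta g)).
have iD : idl L D by apply: submA => //; exact: cyc_subm.
have XD : X e.+1 `<=` D by apply: addset_subl; case: (cyc_subm idfun (beta g)).
have fX := ext_fin nz nA lM (iX e.+1) (MX e.+1).
rewrite -/(X _) -/(X _) (subm_lenD (Y := D) _ _ _ _ _ fX) // leq_add //.
  apply: (@len_le _ (idl L)) => //.
  apply: (@bnd_family _ (subm beta) (idl L)); first by move=> W; exact: idl_subm.
  have b := uspan_bnd (iX e) (MX e) (ext_fin nz nA lM (iX e) (MX e)).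
  have b' : bnd (subm beta) (X e.+1 `&` uspan setT) (uspan setT) (p ^ d * lam (X e)).
    apply: bnd_sub b _ _ _ => //; last exact: uspan_subm.
    by move=> x hx; split; [exact: UX|exact: (uspan_mono _ hx)].
  have sX := idl_subm (iX e.+1).
  apply: bnd_sub (bnd_addset sX (uspan_subm _) b') _ _ _ => //.
    apply: addset_mono => // _ [l _ <-]; rewrite mulrC; exact: uS.
  by apply: submA => //; exact: uspan_subm.
apply: (hC e.+1 D setT) => //; first exact: subset_trans XD.
move=> y _; apply: addset_subr; first by case: (iX e.+1).
by exists y => //; rewrite mulrC.
Qed.

End FrobeniusCount.

(** * Weak Artin-Rees and disjoint ideals in the completion *)

Section WeakArtinRees.
Variables (A : comNzRingType) (M : set A).
Hypothesis nA : fin_gen A.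

Lemma colon_powS (h : set A) x m n : idl A h -> (m <= n)%N ->
  colon h (x ^+ m) `<=` colon h (x ^+ n).
Proof.
by move=> ih /subnK <- a; rewrite /colon /= exprD -mulrA; exact: (idlM _ ih).
Qed.

(* Weak Artin-Rees: an ideal h maximal with h /\ c = M^k c contains a power of M, because a power
   of each element of M can be added to h. *)
Lemma weak_artin_rees c k : idl A M -> idl A c ->
  exists n, forall x, ipow M n x -> c x -> imul (ipow M k) c x.
Proof.
move=> iM ic; pose Mc := imul (ipow M k) c.
have iMc : idl A Mc by exact: imul_idl.
have [h [ih [Mch hc] hmax]] := noeth_max nA (P := fun h => Mc `<=` h /\ (forall x, h x -> c x -> Mc x))
  iMc (conj (fun _ => id) (fun _ hx _ => hx)).
have pw x : M x -> exists n, h (x ^+ n).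
  move=> Mx.
  have [X [iX [n EX] Xmax]] := noeth_max nA (P := fun X => exists n, X = colon h (x ^+ n))
    (colon_idl (x ^+ 0) ih) (ex_intro _ 0%N erefl).
  have stable m : (n <= m)%N -> colon h (x ^+ m) `<=` X.
    move=> nm; apply: (Xmax _ (colon_idl _ ih)); first by exists m.
    by rewrite EX; exact: colon_powS.
  (* For [y = y1 + x^n a] in [c], both [x^k y] and [x^k y1] lie in [h], hence so does [x^(n+k) a].
     Stability of the colon ideals gives [x^n a] in [h], so [y] is in [h]. *)
  exists n; pose h' := addset h (cyc idfun (x ^+ n)).
  have ih' : idl A h' by apply: submA => //; exact: cyc_subm.
  have hh' : h `<=` h' by apply: addset_subl; case: (cyc_subm idfun (x ^+ n)).
  apply: (hmax h' ih' _ hh').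
    split=> [y /Mch/hh' //|y [y1 hy1 [_ [a _ <-] Ey]] cy].
    apply: hc => //; rewrite -Ey; case: (ih) => _ hD _; apply: hD => //=.
    rewrite mulrC; suff : X a by rewrite EX.
    apply: (stable (n + k)%N); first exact: leq_addr.
    have hxy : h (x ^+ k * y) by apply: Mch; apply: imul_in => //; exact: ipowX.
    rewrite /colon /= addnC exprD -mulrA.
    have -> : x ^+ k * (x ^+ n * a) = x ^+ k * y - x ^+ k * y1 by rewrite -Ey /=; ring.
    by case: (subm_sgrp ih) => _; apply => //; exact: (idlM _ ih).
  by apply: addset_subr; [case: ih|exact: cyc_id].
have [t Et] := nA iM.
have [n hn] : exists n, ipow M n `<=` h.
  rewrite Et; apply: (rad_fg ih) => g gt; apply: pw; rewrite Et; exact: sub_sspan.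
by exists n => x /hn; exact: hc.
Qed.

End WeakArtinRees.

(** While more than [size s * q.-1] factors remain, some generator occurs [q] times and its [q]-th
    power can be extracted; the number of factors allows [k] extractions. *)
Lemma ipow_frob (A : comNzRingType) (s : seq A) q k : (0 < q)%N ->
  ipow (isp [set` s]) (q * k + size s * q) `<=`
  isp [set y ^+ q | y in ipow (isp [set` s]) k].
Proof.
move=> q0; set I := isp [set` s] => z /ipow_gens hz.
have iS := sspan_subm idfun [set y ^+ q | y in ipow I k].
apply: (sspan_least iS _ hz) => _ [t [st ts ->]].
suff [y [r [hy ->]]] : exists y r, ipow I k y /\ \prod_(x <- t) x = y ^+ q * r.
  by apply: (idlMr _ iS); apply: sub_sspan; exists y.
have {st} : (q * k + size s * q <= size t)%N by rewrite st.
elim: k t ts {iS hz z} => [|k IH] t ts ht.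
  by exists 1, (\prod_(x <- t) x); rewrite expr1n mul1r.
have [|g [t' [gs tt' Et ->]]] := pigeonhole (k := q.-1) ts; first by nia.
have [y [r [hy ->]]] : exists y r, ipow I k y /\ \prod_(x <- t') x = y ^+ q * r.
  by apply: IH => [x /tt'/ts|]; last nia.
exists (g * y), r; split; first by apply: imul_in => //; exact: sub_sspan.
by rewrite prednK // exprMn mulrA.
Qed.

Section ExtDisjoint.
Variables (A L : comNzRingType) (M : set A) (d p : nat) (iota : {rmorphism A -> L}).
Variables (B : idomainType) (beta : {rmorphism B -> L}) (us : seq L) (Xs : seq B).
Hypothesis nz : normalization M d p iota beta us Xs.
Hypotheses (nA : fin_gen A) (iM : idl A M).

(** An approximation [r] of [x] in [A] is both [al + m1] and [be + m2]; weak Artin-Rees splits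
    [al - be] into parts of [a] and [b] inside [M^k]. As [a] and [b] meet in 0, [al] itself is in
    [M^k], so [x] lies in every extended power of [M]. *)
Lemma ext_disjoint a b : idl A a -> idl A b -> (forall x, a x -> b x -> x = 0) ->
  forall x, ext iota a x -> ext iota b x -> x = 0.
Proof.
move=> ia ib ab0 x ax bx; apply: (nz_sep nz) => k.
have iab : idl A (addset a b) by exact: submA.
have [n0 hn0] := weak_artin_rees nA k iM iab; pose n := (n0 + k)%N.
have hn y : ipow M n y -> addset a b y -> imul (ipow M k) (addset a b) y.
  by move=> hy; apply: hn0; apply: ipow_anti hy; exact: leq_addr.
have [r hr] := nz_dense nz n x.
have mem c : idl A c -> ext iota c x -> addset c (ipow M n) r.
  move=> ic cx; have iA := submA ic (ipow_idl M n).
  apply: (nz_contr nz iA (N := n)); first by apply: addset_subr; case: ic.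
  rewrite -/(ext iota _) (ext_add iota ic (ipow_idl M n)).
  exists x => //; exists (- (x - iota r)); first exact: sgrpN (subm_sgrp (ext_idl _ _)) hr.
  by rewrite opprB addrCA subrr addr0.
have [al aal [m1 hm1 Er1]] := mem a ia ax; have [be bbe [m2 hm2 Er2]] := mem b ib bx.
have im := ipow_idl M k.
have isum : imul (ipow M k) (addset a b) `<=` addset (a `&` ipow M k) (b `&` ipow M k).
  have i1 := submI ia im; have i2 := submI ib im; have i12 := submA i1 i2.
  apply: sspan_least => // _ [m hm [_ [a1 ha [b1 hb <-]] <-]].
  exists (m * a1); first by split; [exact: (idlM _ ia)|exact: (idlMr _ im)].
  exists (m * b1); first by split; [exact: (idlM _ ib)|exact: (idlMr _ im)].
  by rewrite mulrDr.
have [al' [ha' hm'] [be' [hb' hm''] E]] : addset (a `&` ipow M k) (b `&` ipow M k) (al - be).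
  apply: isum; apply: hn.
    have -> : al - be = m2 - m1.
      by apply/eqP; rewrite subr_eq addrAC -subr_eq opprK Er1 addrC Er2.
    by case: (subm_sgrp (ipow_idl M n)) => _; apply.
  by exists al => //; exists (- be) => //; exact: sgrpN (subm_sgrp ib) bbe.
have Eal : al = al'.
  apply/eqP; rewrite -subr_eq0; apply/eqP; apply: ab0.
    by case: (subm_sgrp ia) => _; apply.
  have -> : al - al' = be + be'.
    by apply/eqP; rewrite subr_eq -addrA [be' + _]addrC E addrC subrK.
  by case: (ib) => _ bD _; apply: bD.
have hk : (k <= n)%N by exact: leq_addl.
have hr' : ipow M k r.
  rewrite -Er1 Eal; case: (im) => _ mD _; apply: mD => //.
  exact: ipow_anti hk _ hm1.
rewrite -[x](subrK (iota r)); case: (ext_idl iota (ipow M k)) => _ eD _; apply: eD.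
  exact: (@ext_mono _ _ iota _ _ (@ipow_anti _ M _ _ hk) _ hr).
exact: ext_in.
Qed.

End ExtDisjoint.

(** * The ideals a_e and their approximations b_e *)

Section Asymptotics.
Variables (A : comNzRingType) (M I J : set A) (p c : nat) (k : nat -> nat).
Hypotheses (nA : fin_gen A) (lM : loc M) (p0 : (0 < p)%N).
Hypotheses (iI : idl A I) (iJ : idl A J).
Hypotheses (MI : ipow M c `<=` I) (MJ : ipow M c `<=` J).
Hypothesis kS : forall e, (k e.+1 <= p * k e)%N.
Hypothesis kD : forall e n, (p ^ n * k e <= k (e + n) + p ^ n)%N.

(** The ideal [a_e], with [k e] in place of [ceil(s p^e)]; the rounding enters only through [kS] and
    [kD]. *)
Definition hid e : set A := addset (ipow I (k e)) (isp [set x ^+ (p ^ e) | x in J]).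

(** Generators of [b_e]. Being [p^n]-th powers, they act on the generic module through [E]. *)
Definition hgen n e : set A :=
  [set y ^+ (p ^ n) | y in ipow I (k e)] `|` [set y ^+ (p ^ n * p ^ e) | y in J].

Lemma hid_idl e : idl A (hid e).
Proof. by apply: submA; [exact: ipow_idl|exact: sspan_subm]. Qed.

Lemma ipow_expr m n x : ipow I m x -> ipow I (n * m) (x ^+ n).
Proof.
by move=> hx; elim: n => [|n IH] //; rewrite exprS mulSn; exact: ipowM.
Qed.

Lemma k_mul n e : (k (e + n) <= p ^ n * k e)%N.
Proof.
elim: n => [|n IH]; first by rewrite addn0 mul1n.
rewrite addnS (leq_trans (kS _)) // expnS -mulnA leq_mul2l IH orbT //.
Qed.

Lemma hgen_pow n e x : hgen n e x -> hgen n e.+1 (x ^+ p).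
Proof.
case=> [[y hy <-]|[y hy <-]].
  left; exists (y ^+ p); last by rewrite -!exprM mulnC.
  by apply: (ipow_anti (kS e)); exact: ipow_expr.
by right; exists y => //; rewrite -exprM -mulnA [(p ^ e * p)%N]mulnC -expnS.
Qed.

Lemma hgen_hid n e : hgen n e `<=` hid (e + n).
Proof.
have iS := sspan_subm idfun [set x ^+ (p ^ (e + n)) | x in J].
move=> _ [[y hy <-]|[y hy <-]].
  apply: addset_subl; first by case: iS.
  by apply: (ipow_anti (k_mul n e)); exact: ipow_expr.
apply: addset_subr; first by case: (ipow_idl I (k (e + n))).
by rewrite -expnD addnC; apply: sub_sspan; exists y.
Qed.

Lemma hgen_ipow n : exists c1, forall e, ipow M (c1 * p ^ e) `<=` isp (hgen n e).
Proof.
have [iM _ _] := lM; have [t Et] := nA iM.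
exists (size t * (c * p ^ n)).+1 => e.
apply: subset_trans (_ : ipow M (size t * (c * p ^ n * p ^ e)).+1 `<=` _).
  apply: ipow_anti; have : (0 < p ^ e)%N by rewrite expn_gt0 p0.
  by nia.
rewrite Et; apply: rad_bound; first exact: sspan_subm.
move=> g gt; apply: sub_sspan; right; exists (g ^+ c); last by rewrite -exprM mulnA.
by apply: MJ; apply: ipowX; rewrite Et; exact: sub_sspan.
Qed.

Lemma hid_ipow : exists c1, forall e, ipow M (c1 * p ^ e) `<=` hid e.
Proof.
have [c1 h] := hgen_ipow 0; exists c1 => e; apply: subset_trans (h e) _.
by rewrite -{2}[e]addn0; apply: (sspan_least (hid_idl _)); exact: hgen_hid.
Qed.

(* Pigeonhole: a product of many generators of I is a p^n-th power of a long product, up to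
   boundedly many factors. *)
Lemma hid_hgen n : exists N, forall e x z, hid (e + n) x -> ipow M N z -> isp (hgen n e) (z * x).
Proof.
have [s Es] := nA iI; have q0 : (0 < p ^ n)%N by rewrite expn_gt0 p0.
have [iM _ _] := lM; have [t Et] := nA iM.
pose m := (p ^ n + size s * p ^ n)%N.
exists (size t * (c * m)).+1 => e x z hx hz; have iG := sspan_subm idfun (hgen n e).
have hz' : ipow I m z.
  move: hz; rewrite {1}Et; apply: (rad_bound (ipow_idl I m)) => g gt.
  by rewrite exprM; apply: ipowX; apply: MI; apply: ipowX; rewrite Et; exact: sub_sspan.
case: hx => x1 hx1 [x2 hx2 <-]; rewrite mulrDr.
case: (iG) => _ gD _; apply: gD.
  have : ipow I (p ^ n * k e + size s * p ^ n) (z * x1).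
    apply: ipow_anti (ipowM hz' hx1).
    by have := kD e n; rewrite /m; lia.
  rewrite Es => /(ipow_frob q0); apply: sspan_mono => _ [y hy <-].
  by left; exists y => //; rewrite Es.
apply: (idlM _ iG); apply: (sspan_least iG _ hx2) => _ [y hy <-].
by apply: sub_sspan; right; exists y => //; rewrite -expnD addnC.
Qed.

End Asymptotics.

Section LengthAsymptotics.
Variables (A : comNzRingType) (M I J : set A) (p c : nat) (k : nat -> nat).
Hypotheses (nA : fin_gen A) (lM : loc M) (p0 : (0 < p)%N).
Hypotheses (iI : idl A I) (iJ : idl A J).
Hypotheses (MI : ipow M c `<=` I) (MJ : ipow M c `<=` J).
Hypothesis kS : forall e, (k e.+1 <= p * k e)%N.
Hypothesis kD : forall e n, (p ^ n * k e <= k (e + n) + p ^ n)%N.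
Variables (d : nat) (L : comNzRingType) (iota : {rmorphism A -> L}).
Variables (B : idomainType) (beta : {rmorphism B -> L}) (us : seq L) (Xs : seq B).
Hypothesis nz : normalization M d p iota beta us Xs.
Hypothesis d0 : (0 < d)%N.

Local Notation aa := (hid I J p k).
Local Notation gg := (hgen I J p k).

Definition hlen (cc : set A) e : nat := lam (addset (aa e) cc).

Lemma hgen_unit n : exists2 g, g != 0 & forall e x,
  ext iota (aa (e + n)) x -> ext iota (isp (gg n e)) (beta g * x).
Proof.
have [N hN] := hid_hgen J nA lM p0 iI MI kD n.
(* Positive dimension provides a variable of [B]; its [N]-th power is a nonzero multiplier that lies
   in the extension of [M^N] and does not depend on [e]. *)
have [X XX] : exists X, X \in Xs.
  by case: (Xs) (nz_size nz) d0 => [<-|X s _ _] //; exists X; exact: mem_head.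
exists (X ^+ N) => [|e x hx]; first by rewrite expf_neq0 // (nz_ne0 nz XX).
rewrite rmorphXn; have := ext_pow (N := N) (nz_in nz XX) => hX.
by apply: (extM _ hX hx) => a b ha hb; exact: hN.
Qed.

Lemma ext_hgen n e : ext iota (isp (gg n e)) = isp (iota @` gg n e).
Proof.
apply/seteqP; split; last first.
  by apply: ext_mono; exact: sub_sspan.
apply: sspan_least; first exact: sspan_subm.
move=> _ [x hx <-]; have iX := sspan_subm idfun (iota @` gg n e).
suff : isp (gg n e) `<=` iota @^-1` (isp (iota @` gg n e)) by apply.
apply: sspan_least; first exact: idl_preimage.
by move=> y hy; apply: sub_sspan; exists y.
Qed.

Lemma hlen_ext cc e : idl A cc -> hlen cc e = lam (addset (ext iota (aa e)) (ext iota cc)).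
Proof.
move=> icc; have [c1 hc1] := hid_ipow I nA lM p0 MJ kS.
have ia : idl A (aa e) by exact: hid_idl.
rewrite -(ext_add iota ia icc) (lam_ext nz nA lM (N := (c1 * p ^ e)%N)) //.
  exact: submA.
by apply: subset_trans (hc1 e) _; apply: addset_subl; case: icc.
Qed.

Lemma hlen_near cc : idl A cc -> exists n w C, forall e,
  [/\ (w e.+1 <= p ^ d * w e + C * (p ^ e.+1) ^ d.-1)%N,
      (hlen cc (e + n) <= w e + C * (p ^ e) ^ d.-1)%N &
      (w e <= hlen cc (e + n) + C * (p ^ e) ^ d.-1)%N].
Proof.
move=> icc; have iC := ext_idl iota cc.
have [n [c' [u [g [g1 [ic' Cc' [g0 g10] sat [uD uZ uF uc uS]]]]]]] :=
  frobenius_lift (nz_gen nz) (nz_char nz) iC.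
pose G e := iota @` gg n e.
have [c1 hc1] := hgen_ipow I k nA lM p0 MJ n.
have MG e : ext iota (ipow M (c1 * p ^ e)) `<=` isp (G e).
  by rewrite /G -ext_hgen; apply: ext_mono.
have Gq e x : G e x -> exists z, x = z ^+ (p ^ n).
  move=> [_ [[y _ <-]|[y _ <-]] <-]; first by exists (iota y); rewrite rmorphXn.
  by exists (iota (y ^+ (p ^ e))); rewrite -rmorphXn -exprM mulnC.
have Gp e x : G e x -> G e.+1 (x ^+ p).
  move=> [y hy <-]; exists (y ^+ p); last by rewrite rmorphXn.
  exact: hgen_pow.
have [C1 hC1] := frob_recurrence nz nA lM d0 ic' g0 uD uZ uF uc uS Gq Gp MG.
have [g2 g20 hg2] := hgen_unit n.
have [C2 hC2] := small_len nz nA lM c1 g20 d0.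
have [C3 hC3] := small_len nz nA lM c1 g10 d0.
exists n, (fun e => lam (addset (isp (G e)) c')), (C1 + C2 + C3)%N => e.
pose ea := ext iota (aa (e + n)).
have iE : idl L ea by exact: ext_idl.
(* [Y1] and [Y3] both lie in [Y2], with subquotients killed by [g2] and [g1]; so their colengths
   differ by [O(p^(e(d-1)))]. *)
pose Y1 := addset (isp (G e)) c'; pose Y2 := addset ea c'; pose Y3 := addset ea (ext iota cc).
have iG : idl L (isp (G e)) by exact: sspan_subm.
have i1 : idl L Y1 by exact: submA.
have i2 : idl L Y2 by exact: submA.
have i3 : idl L Y3 by exact: submA.
have GE : isp (G e) `<=` ea.
  by apply: sspan_mono; apply: image_subset; exact: hgen_hid.
have Y12 : Y1 `<=` Y2 by apply: addset_mono.
have Y32 : Y3 `<=` Y2 by apply: addset_mono.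
have M1 : ext iota (ipow M (c1 * p ^ e)) `<=` Y1.
  by apply: subset_trans (MG e) _; apply: addset_subl; case: ic'.
have M3 : ext iota (ipow M (c1 * p ^ e)) `<=` Y3.
  by apply: subset_trans (MG e) _; apply: subset_trans GE _; apply: addset_subl; case: iC.
have l1 : (len (idl L) Y1 Y2 <= C2 * (p ^ e) ^ d.-1)%N.
  apply: hC2 => // _ [x hx [y hy <-]]; rewrite mulrDr.
  exists (beta g2 * x); first by rewrite /G -ext_hgen; exact: hg2.
  by exists (beta g2 * y) => //; exact: (idlM _ ic').
have l3 : (len (idl L) Y3 Y2 <= C3 * (p ^ e) ^ d.-1)%N.
  apply: hC3 => // _ [x hx [y hy <-]]; rewrite mulrDr.
  exists (beta g1 * x); first exact: (idlM _ iE).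
  by exists (beta g1 * y) => //; exact: sat.
have E1 := subm_lenD i1 i2 Y12 (submT _) (fun _ _ => Logic.I) (ext_fin nz nA lM i1 M1).
have E3 := subm_lenD i3 i2 Y32 (submT _) (fun _ _ => Logic.I) (ext_fin nz nA lM i3 M3).
rewrite (hlen_ext _ icc) -/ea -/Y3 -/Y1.
split.
- by apply: leq_trans (hC1 e) _; rewrite leq_add2l leq_mul2r -addnA leq_addr orbT.
- by nia.
- by nia.
Qed.

Lemma hlen_additive a b : idl A a -> idl A b -> (forall x, a x -> b x -> x = 0) ->
  exists n C, forall e,
  (hlen a (e + n) + hlen b (e + n) <= hlen [set 0%R] (e + n) + hlen (addset a b) (e + n) /\
   hlen [set 0%R] (e + n) + hlen (addset a b) (e + n) <=
     hlen a (e + n) + hlen b (e + n) + C * (p ^ e) ^ d.-1)%N.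
Proof.
move=> ia ib ab0; have [iM _ _] := lM.
have [ea0 eb0] := (ext_idl iota a, ext_idl iota b).
have [n [g [g0 hg]]] := separated_ideals (nz_gen nz) (nz_char nz) ea0 eb0
  (ext_disjoint nz nA iM ia ib ab0).
have [g2 g20 hg2] := hgen_unit n.
have [c1 hc1] := hid_ipow I nA lM p0 MJ kS.
have g30 : g * g2 != 0 by rewrite mulf_neq0.
have [C hC] := small_len nz nA lM (c1 * p ^ n) g30 d0.
exists n, C => e.
have i0 : idl A [set 0] by split=> // [x y -> ->|r x ->] /=; rewrite ?addr0 ?mulr0.
have iab := submA ia ib.
rewrite !hlen_ext // (ext_add iota ia ib).
pose ea := ext iota (aa (e + n)).
have iE : idl L ea by exact: ext_idl.
have E0 : ext iota [set 0] = [set 0].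
  apply/seteqP; split=> [|x ->]; last by case: (ext_idl iota [set 0]).
  apply: sspan_least; last by move=> _ [x -> <-]; rewrite rmorph0.
  by split=> // [x y -> ->|r x ->] /=; rewrite ?addr0 ?mulr0.
have -> : addset (ext iota (aa (e + n))) (ext iota [set 0]) = ea.
  rewrite E0; apply/seteqP; split=> [_ [x hx [y -> <-]]|x hx]; first by rewrite addr0.
  by exists x => //; exists 0 => //; rewrite addr0.
rewrite -/ea; pose X := addset ea (ext iota a); pose Y := addset ea (ext iota b).
have iX : idl L X by exact: submA.
have iY : idl L Y by exact: submA.
have iI' := submI iX iY.
have EX : ea `<=` X by apply: addset_subl; case: ea0.
have EY : ea `<=` Y by apply: addset_subl; case: eb0.
have EI : ea `<=` X `&` Y by move=> x hx; split; [exact: EX|exact: EY].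
have -> : addset ea (addset (ext iota a) (ext iota b)) = addset X Y.
  apply/seteqP; split.
    move=> _ [x hx [_ [y hy [z hz <-]] <-]]; exists (x + y); first by exists x => //; exists y.
    by exists z; [exists 0; [case: iE|exists z => //; rewrite add0r]|rewrite addrA].
  move=> _ [_ [x hx [y hy <-]] [_ [x' hx' [z hz <-]] <-]].
  exists (x + x'); first by case: iE => _ + _; apply.
  by exists (y + z); [exists y => //; exists z|rewrite addrACA].
have ME : ext iota (ipow M (c1 * p ^ n * p ^ e)) `<=` ea.
  by apply: ext_mono; rewrite -mulnA -expnD addnC; exact: hc1.
have fE := ext_fin nz nA lM iE ME.
have fI := ext_fin nz nA lM iI' (subset_trans ME EI).
(* An element of the intersection is [x1 + al = x2 + be]. Then [al - be] lies in [ea], [g2] moves it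
   into the ideal of [p^n]-th powers, and [g] separates [al] from [be] there. *)
have lI : (len (idl L) ea (X `&` Y) <= C * (p ^ e) ^ d.-1)%N.
  apply: hC => // x [[x1 hx1 [al hal E1]] [x2 hx2 [be hbe E2]]].
  rewrite rmorphM -E1 mulrDr; case: (iE) => _ eD _; apply: eD; first exact: (idlM _ iE).
  have Gx : isp (iota @` gg n e) (beta g2 * al + - (beta g2 * be)).
    have -> : beta g2 * al + - (beta g2 * be) = beta g2 * (x2 - x1).
      by rewrite -mulrBr; congr (_ * _); apply/eqP; rewrite subr_eq addrAC eq_sym subr_eq E2 addrC E1.
    rewrite -ext_hgen; apply: hg2; by case: (subm_sgrp iE) => _; apply.
  have Gq x' : (iota @` gg n e) x' -> exists z, x' = z ^+ (p ^ n).
    move=> [_ [[y _ <-]|[y _ <-]] <-]; first by exists (iota y); rewrite rmorphXn.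
    by exists (iota (y ^+ (p ^ e))); rewrite -rmorphXn -exprM mulnC.
  rewrite -mulrA.
  have : isp (iota @` gg n e) (beta g * (beta g2 * al)).
    apply: (hg _ Gq _ _ _ _ Gx); first exact: (idlM _ ea0).
    by apply: (sgrpN (subm_sgrp eb0)); exact: (idlM _ eb0).
  apply: sspan_least => // _ [y hy <-]; apply: ext_in; exact: hgen_hid hy.
have E1 := subm_lenD iE iI' EI (submT _) (fun _ _ => Logic.I) fE.
have E2 : (lam X + lam Y = lam (X `&` Y) + lam (addset X Y))%N.
  exact: (len_modular (@subm_sgrp _ _ _) (@submI _ _ _) (@submA _ _ _) iX iY (submT _) fI).
move: lI E1 E2; rewrite -/X -/Y.
move: (len _ ea (X `&` Y)) (lam ea) (lam X) (lam Y) (lam (addset X Y)) (lam (X `&` Y)) => l1 l2 l3 l4 l5 l6.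
by lia.
Qed.

End LengthAsymptotics.

(** * The fiber product *)

Section ModuleLength.
Variables (A : comNzRingType) (V : lmodType A) (th : A -> V).
Hypothesis thD : forall x y, th (x + y) = th x + th y.
Hypothesis thZ : forall a x, th (a * x) = a *: th x.
Hypothesis th_surj : forall v, exists x, th x = v.

Lemma submoduleP (N : set V) : submodule N <->
  [/\ N 0, forall u v, N u -> N v -> N (u + v) & forall a v, N v -> N (a *: v)].
Proof.
split=> [[/set_mem N0 Nl]|[N0 ND NZ]].
  split=> // [u v hu hv|a v hv].
    by rewrite -[u]scale1r; apply/set_mem/Nl; exact: mem_set.
  by rewrite -[_ *: _]addr0; apply/set_mem/Nl; exact: mem_set.
split; first exact: mem_set.
by move=> a u v /set_mem hu /set_mem hv; apply/mem_set/ND => //; exact: NZ.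
Qed.

Lemma th0 : th 0 = 0.
Proof. by apply/eqP; have /eqP := thD 0 0; rewrite addr0 -subr_eq0 opprD addNKr oppr_eq0. Qed.

Lemma thN x : th (- x) = - th x.
Proof. by apply/eqP; rewrite -addr_eq0 -thD addNr th0. Qed.

(** The modules of the theorem are all cyclic over the fiber product, so their lengths become
    colengths of ideals. *)
Lemma length_lam : length V = lam [set x | th x = 0].
Proof.
rewrite /length /len; congr nat_max; apply/seteqP; split=> n /=.
  move=> [N [N1 N2]].
  have h : lchain (idl A) [set x | th x = 0] n (th @^-1` N n).
    apply: (seq_lchain (N := fun i => th @^-1` N i)).
    - move=> i /N1/submoduleP[N0 ND NZ]; split; rewrite /preimage /=.
      + by rewrite th0.
      + by move=> x y; rewrite thD; exact: ND.
      + by move=> a x; rewrite thZ; exact: NZ.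
    - move=> i /N2[h1 h2]; split=> [x|h]; first exact: h1.
      by apply: h2 => v; have [x <-] := th_surj v; exact: h.
    - by move=> x; rewrite /preimage /= => ->; have /submoduleP[] := N1 0%N (leq0n _).
  by apply: lchain_widen h (submT _) _.
move=> /lchain_seq[N [N1 N2 N0 _]]; exists (fun i => th @` N i); split=> i hi.
  have [Ni0 ND NZ] := N1 i hi; apply/submoduleP; split.
  - by exists 0 => //; exact: th0.
  - by move=> _ _ [x hx <-] [y hy <-]; exists (x + y); [exact: ND|exact: thD].
  - by move=> a _ [x hx <-]; exists (a * x); [exact: NZ|exact: thZ].
have [h1 h2] := N2 i hi; split; first exact: image_subset.
move=> h; apply: h2 => x hx.
have [y hy E] : (th @` N i) (th x) by apply: h; exists x.
have [_ ND _] := N1 i (ltnW hi).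
rewrite -[x](subrK y); apply: (ND _ _) => //.
have ker j : (j <= n)%N -> [set x | th x = 0] `<=` N j.
  elim: j => [|j IH] hj //; apply: subset_trans (IH (ltnW hj)) _.
  by have [] := N2 j hj.
by apply: (ker i (ltnW hi)); rewrite /= thD thN E subrr.
Qed.

End ModuleLength.

Lemma length_mod_quot (A : comNzRingType) (V : lmodType A) (th : A -> V) (a : set A) :
  (forall x y, th (x + y) = th x + th y) -> (forall b x, th (b * x) = b *: th x) ->
  (forall v, exists x, th x = v) -> idl A a ->
  length (mod_quot a V) = lam (addset a [set x | th x = 0]).
Proof.
move=> thD thZ ts ia; set X := [set x *: v | x in a & v in [set: V]].
have sX : Defs.span X = th @` a.
  have [a0 aD aM] := ia.
  apply/seteqP; split=> [v hv|_ [x hx <-]].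
    apply: hv; split; last first.
      by move=> _ [x hx [w _ <-]]; have [y <-] := ts w; exists (x * y); [exact: (idlMr _ ia)|].
    apply/submoduleP; split.
    - by exists 0 => //; exact: (th0 thD).
    - by move=> _ _ [x hx <-] [y hy <-]; exists (x + y); [exact: aD|exact: thD].
    - by move=> b _ [x hx <-]; exists (b * x); [exact: aM|exact: thZ].
  move=> N [_ XN]; apply: XN; exists x => //; exists (th 1) => //.
  by rewrite -thZ mulr1.
pose Q := Quotient.quot (span_pred X).
pose q x : quot_mod X := (\pi_Q (th x))%qT.
have q0 x : q x = 0 <-> addset a [set x | th x = 0] x.
  have -> : (q x = 0) <-> Defs.span X (th x).
    rewrite /q -[0 in X in X <-> _](raddf0 (\pi_Q)%qT).
    split=> [/eqP|h]; [|apply/eqP]; rewrite -Quotient.idealrBE subr0 /span_pred.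
      by move/set_mem.
    exact: mem_set.
  rewrite sX; split=> [[y hy E]|[y hy [z z0 <-]]].
    exists y => //; exists (x - y); last by rewrite addrC subrK.
    by rewrite /= thD (thN thD) E subrr.
  by exists y => //; rewrite thD z0 addr0.
rewrite (@length_lam A (quot_mod X) q).
- by congr (len _ _ _); apply/seteqP; split=> x /q0.
- by move=> x y; rewrite /q thD raddfD.
- by move=> b x; rewrite /q thZ -quot_scale_pi.
- move=> v; have [x Ex] := ts (generic_quotient.repr (v : Q)); exists x.
  by rewrite /q Ex generic_quotient.reprK.
Qed.

Lemma idl_image (A C : comNzRingType) (f : {rmorphism A -> C}) Y :
  (forall y, exists x, f x = y) -> idl A Y -> idl C (f @` Y).
Proof.
move=> fs [Y0 YD YM]; split; first by exists 0 => //; exact: rmorph0.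
  by move=> _ _ [x hx <-] [y hy <-]; exists (x + y); [exact: YD|exact: rmorphD].
move=> a _ [x hx <-]; have [b <-] := fs a.
by exists (b * x); [exact: YM|exact: rmorphM].
Qed.

Lemma idl_ker (A C : comNzRingType) (f : {rmorphism A -> C}) : idl A [set x | f x = 0].
Proof.
split=> /= [|x y x0 y0|a x x0]; first exact: rmorph0.
  by rewrite rmorphD x0 y0 addr0.
by rewrite rmorphM x0 mulr0.
Qed.

Lemma primary_pow (A : comNzRingType) (M Q : set A) : fin_gen A -> idl A M -> primary_to M Q ->
  idl A Q /\ exists c, ipow M c `<=` Q.
Proof.
move=> nA iM [/idealr_closedP[iQ _] _ rQ]; split=> //; have [t Et] := nA _ iM.
rewrite Et; apply: (rad_fg iQ) => g gt.
by have : radical Q g by rewrite rQ Et; exact: sub_sspan.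
Qed.

(** Lift generators of the image of [X] under [f], then of the image under [g] of the part of [X]
    killed by [f]; joint injectivity shows that they generate [X]. *)
Lemma fin_gen_pair (P R S : comNzRingType) (f : {rmorphism P -> R}) (g : {rmorphism P -> S}) :
  (forall y, exists x, f x = y) -> (forall y, exists x, g x = y) ->
  (forall x, f x = 0 -> g x = 0 -> x = 0) -> fin_gen R -> fin_gen S -> fin_gen P.
Proof.
move=> fs gs fg0 nR nS X iX; have [X0 XD XM] := iX.
have img (C : comNzRingType) (h : {rmorphism P -> C}) (Y : set P) :
    (forall y, exists x, h x = y) -> fin_gen C -> idl P Y ->
    exists t : seq P, (forall x, x \in t -> Y x) /\
      forall x, Y x -> exists2 z, isp [set` t] z & h x = h z.
  move=> hs nC iY; have iY' := idl_image hs iY.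
  have [s Es] := nC _ iY'.
  have [t [tY st]] : exists t : seq P, (forall x, x \in t -> Y x) /\ map h t = s.
    have : forall y, y \in s -> (h @` Y) y by move=> y ys; rewrite Es; exact: sub_sspan.
    elim: s {Es} => [|y s IH] hs'; first by exists [::].
    have [|t [tY <-]] := IH; first by move=> z zs; apply: hs'; rewrite inE zs orbT.
    have [x hx <-] := hs' y (mem_head _ _).
    by exists (x :: t); split=> // z; rewrite inE => /orP[/eqP ->|/tY].
  exists t; split=> // x hx.
  have : isp [set` s] (h x) by rewrite -Es; exists x.
  have iT := sspan_subm idfun [set` t].
  suff : isp [set` s] `<=` h @` isp [set` t] by move=> sub /sub[z hz E]; exists z.
  apply: sspan_least; first exact: idl_image.
  by move=> y; rewrite /= -st => /mapP[z zt ->]; exists z => //; exact: sub_sspan.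
have [t1 [t1X h1]] := img R f X fs nR iX.
have iK : idl P (X `&` [set x | f x = 0]).
  by apply: submI => //; exact: idl_ker.
have [t2 [t2X h2]] := img S g _ gs nS iK.
exists (t1 ++ t2); apply/seteqP; split; last first.
  by apply: sspan_least => // x; rewrite /= mem_cat => /orP[/t1X|/t2X[]].
move=> x hx; have [z hz Ez] := h1 x hx.
have tX : isp [set` t1] `<=` X by apply: sspan_least.
have Kz : (X `&` [set x | f x = 0]) (x - z).
  by split; [case: (subm_sgrp iX) => _; apply => //; exact: tX|rewrite /= rmorphB Ez subrr].
have [w hw Ew] := h2 _ Kz.
have Kw : f w = 0.
  suff : isp [set` t2] `<=` [set x | f x = 0] by exact.
  by apply: sspan_least => [|y /t2X[]]; first exact: idl_ker.
have E : x - z = w.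
  apply/eqP; rewrite -subr_eq0; apply/eqP; apply: fg0; last by rewrite rmorphB Ew subrr.
  by rewrite rmorphB Kw subr0; case: Kz.
have -> : x = z + w by rewrite -E addrC subrK.
case: (sspan_subm idfun [set` (t1 ++ t2)]) => _ + _; apply.
  by apply: (sspan_mono _ hz) => y; rewrite /= mem_cat => ->.
by apply: (sspan_mono _ hw) => y; rewrite /= mem_cat orbC => ->.
Qed.

(** If [f b] inverted [f x] with [x] in [M], the unit [1 - b x] would map to 0. So membership in [M]
    can be tested in the target, where different local rings are compared. *)
Lemma loc_surj (A B : comNzRingType) (f : {rmorphism A -> B}) (M : set A) :
  (forall y, exists x, f x = y) -> loc M ->
  forall x, M x <-> ~ exists y, y * f x = 1.
Proof.
move=> fs [iM M1 u] x; split=> [Mx [y hy]|nu].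
  have [b Eb] := fs y; have nM : ~ M (1 - b * x).
    move=> h; apply: M1; rewrite -[1](subrK (b * x)).
    by case: (iM) => _ MD MZ; apply: MD => //; exact: MZ.
  have [c hc] := u _ nM; have : f (c * (1 - b * x)) = 1 by rewrite hc rmorph1.
  rewrite rmorphM rmorphB rmorph1 rmorphM Eb hy subrr mulr0 => /eqP.
  by rewrite eq_sym oner_eq0.
by apply: contrapT => /u[b hb]; apply: nu; exists (f b); rewrite -rmorphM hb rmorph1.
Qed.

(** Powers of [MC] are covered by images of powers of [M], so [growth] on [C] applies, with the
    dimension of [C] as exponent. *)
Lemma quotient_small (A C : comNzRingType) (f : {rmorphism A -> C}) (M : set A) (MC : set C) :
  (forall y, exists x, f x = y) -> fin_gen A -> loc M -> fin_gen C -> loc MC ->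
  exists D, forall X N, idl A X -> ipow M N `<=` X ->
    (lam (addset X [set x | f x = 0%R]) <= D * N ^ krull_dim C)%N.
Proof.
move=> fs nA lM nC lC; have [D hD] := growth nC lC.
have fM x : MC x -> exists2 y, M y & f y = x.
  have [y <-] := fs x => hx; exists y => //; apply/(loc_surj fs lM) => -[z hz].
  by have [iC C1 _] := lC; apply: C1; rewrite -hz; exact: (idlM _ iC).
have fpow N : ipow MC N `<=` f @` ipow M N.
  elim: N => [|N IH] /=; first by move=> x _; have [y <-] := fs x; exists y.
  apply: sspan_least; first exact: (idl_image fs (imul_idl _ _)).
  move=> _ [x /fM[a Ma <-] [y /IH[b hb <-] <-]].
  by exists (a * b); [exact: imul_in|exact: rmorphM].
exists D => X N iX NX; set Y := addset X _.
have iK := idl_ker f.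
have iY : idl A Y by exact: submA.
apply: len_le => //.
apply: (@bnd_img _ _ (idl A) (idl C) (f : {additive A -> C})).
- exact: subm_sgrp.
- by move=> W; exact: idl_image.
- by move=> x x0; apply: addset_subr => //; case: iX.
- apply: bnd_sub (hD N) _ _ _ => //.
  apply: subset_trans (fpow N) _; apply: image_subset; apply: subset_trans NX _.
  by apply: addset_subl; case: iK.
Qed.

Section FiberProductLocal.
Variables (R S T : comNzRingType) (k : fieldType) (mR : set R) (mS : set S).
Variables (eR : {rmorphism R -> T}) (eS : {rmorphism S -> T}).
Hypothesis eR_surj : forall t, exists r, eR r = t.
Hypothesis eS_surj : forall t, exists r, eS r = t.
Local Notation P := (fiber_prod eR eS).

Lemma fiberP (r : R) (s : S) : eR r = eS s -> exists x : P, fiber_fst eR eS x = r /\ fiber_snd eR eS x = s.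
Proof.
move=> E; have h : (r, s) \in fiber_pred eR eS by rewrite inE /= E.
by exists (FiberProd h).
Qed.

Lemma fiber_eq (x : P) : eR (fiber_fst eR eS x) = eS (fiber_snd eR eS x).
Proof. by case: x => -[r s] /= h; apply/eqP; move: h; rewrite inE. Qed.

Lemma fiber_inj (x y : P) : fiber_fst eR eS x = fiber_fst eR eS y ->
  fiber_snd eR eS x = fiber_snd eR eS y -> x = y.
Proof.
by case: x y => -[r s] h [[r' s'] h'] /= E1 E2; apply: val_inj; rewrite /= E1 E2.
Qed.

Lemma fst_surj r : exists x : P, fiber_fst eR eS x = r.
Proof. by have [s hs] := eS_surj (eR r); have [x [hx _]] := fiberP (esym hs); exists x. Qed.

Lemma snd_surj s : exists x : P, fiber_snd eR eS x = s.
Proof. by have [r hr] := eR_surj (eS s); have [x [_ hx]] := fiberP hr; exists x. Qed.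

Lemma base_surj t : exists x : P, fiber_base eR eS x = t.
Proof. by have [r <-] := eR_surj t; have [x <-] := fst_surj r; exists x. Qed.

Lemma fiber_fin_gen : fin_gen R -> fin_gen S -> fin_gen P.
Proof.
apply: (fin_gen_pair (f := fiber_fst eR eS) (g := fiber_snd eR eS)).
- exact: fst_surj.
- exact: snd_surj.
- by move=> x x1 x2; apply: fiber_inj; rewrite ?rmorph0.
Qed.

Lemma fiber_loc : loc mR -> loc mS -> loc (fiber_fst eR eS @^-1` mR).
Proof.
move=> lR lS; have [iR R1 uR] := lR; have [iS S1 uS] := lS.
split; [exact: idl_preimage|by move=> h; apply: R1; rewrite -(rmorph1 (fiber_fst eR eS))|].
move=> x hx; have [b hb] := uR _ hx.
(* The two components have the same image in [T], which is a unit because the first component is; so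
   the second is not in [mS]. *)
have [c hc] : exists c, c * fiber_snd eR eS x = 1.
  apply: uS => /(loc_surj eS_surj lS); apply; exists (eR b).
  by rewrite -fiber_eq -rmorphM hb rmorph1.
have [y [y1 y2]] : exists y : P, fiber_fst eR eS y = b /\ fiber_snd eR eS y = c.
  apply: fiberP; rewrite -[eR b]mulr1 -(rmorph1 eS) -hc rmorphM -fiber_eq.
  by rewrite [eS c * _]mulrC mulrA -rmorphM hb rmorph1 mul1r.
by exists y; apply: fiber_inj; rewrite rmorphM rmorph1 ?y1 ?y2.
Qed.

Lemma maximal_loc (A : comNzRingType) (M m : set A) : loc M -> maximal_ideal m -> m = M.
Proof.
move=> lM [/idealr_closedP[im m1] mmax]; have [iM M1 _] := lM.
have [|//|MT] := mmax M _ (loc_proper lM im m1); first exact/idlP.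
by case: M1; rewrite MT.
Qed.

End FiberProductLocal.

(** * Limits *)

Section Density.
Variables (K : realType) (p d : nat).
Hypotheses (p1 : (1 < p)%N) (d0 : (0 < d)%N).

Definition density (f : nat -> nat) (e : nat) : K := (f e)%:R / p%:R ^+ (e * d).

Let p0 : (0 : K) < p%:R. Proof. by rewrite ltr0n ltnW. Qed.
Let pX n : (0 : K) < p%:R ^+ n. Proof. exact: exprn_gt0. Qed.

Lemma cvg_error (C : nat) : (fun e => C%:R / p%:R ^+ e : K) @ \oo --> (0 : K).
Proof.
have : geometric (C%:R : K) p%:R^-1 @ \oo --> (0 : K).
  apply: cvg_geometric; rewrite ger0_norm ?invr_ge0 ?ler0n // invf_lt1 // ltr1n //.
by apply: cvg_trans; apply: near_eq_cvg; near=> e; rewrite /geometric /= exprVn.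
Unshelve. all: by end_near. Qed.

Lemma error_bound (C e m : nat) : (m <= C * (p ^ e) ^ d.-1)%N ->
  m%:R / p%:R ^+ (e * d) <= C%:R / p%:R ^+ e :> K.
Proof.
move=> h; rewrite ler_pdivrMr // mulrAC ler_pdivlMr // -natrX -natrM -natrX -natrM ler_nat.
rewrite (leq_trans (leq_mul h (leqnn _))) // -mulnA leq_mul2l -expnSr prednK // expnM.
by rewrite leqnn orbT.
Qed.

Lemma density_squeeze u v n C :
  (forall e, (v (e + n) <= u (e + n) <= v (e + n) + C * (p ^ e) ^ d.-1)%N) ->
  (fun e => density u e - density v e) @ \oo --> (0 : K).
Proof.
move=> h; rewrite -(cvg_shiftn n).
apply: (squeeze_cvgr (f := fun=> 0) (h := fun e => C%:R / p%:R ^+ e)); last 2 first.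
- exact: cvg_cst.
- exact: cvg_error.
near=> e; have /andP[h1 h2] := h e.
rewrite /density /= -mulrBl -natrB //; apply/andP; split; first by rewrite divr_ge0 ?ler0n // ltW.
apply: (le_trans _ (error_bound (C := C) (e := e) (m := u (e + n)%N - v (e + n)%N) _)); last lia.
rewrite ler_wpM2l // lef_pV2 ?posrE // ler_weXn2l ?ler1n ?(ltnW p1) //.
by rewrite leq_mul2r leq_addr orbT.
Unshelve. all: by end_near. Qed.

(** [w e / p^(ed) + C / p^e] is nonincreasing, because [2 C / p^(e+1) <= C / p^e]. So [w] has a
    density, and [f] shifted by [n] follows it up to the factor [p^(-nd)]. *)
Lemma density_cvg f n w C :
  (forall e, [/\ (w e.+1 <= p ^ d * w e + C * (p ^ e.+1) ^ d.-1)%N,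
      (f (e + n) <= w e + C * (p ^ e) ^ d.-1)%N &
      (w e <= f (e + n) + C * (p ^ e) ^ d.-1)%N]) ->
  cvgn (density f).
Proof.
move=> h; pose a e := density w e + C%:R / p%:R ^+ e.
have aS : cvgn a.
  apply: nonincreasing_is_cvgn; last first.
    exists 0 => _ [e _ <-]; by rewrite /a addr_ge0 // divr_ge0 ?ler0n // ltW.
  apply/nonincreasing_seqP => e; have [h1 _ _] := h e.
  have e1 : (w e.+1)%:R / p%:R ^+ (e.+1 * d) <= density w e + C%:R / p%:R ^+ e.+1 :> K.
    have := h1; rewrite -leq_subLR => /error_bound h2.
    have h3 : (w e.+1)%:R <= (p ^ d * w e)%:R + (w e.+1 - p ^ d * w e)%:R :> K.
      by rewrite -natrD ler_nat; lia.
    have := ler_wpM2r (x := (p%:R ^+ (e.+1 * d))^-1) _ h3; rewrite invr_ge0 ltW // => /(_ isT).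
    move/le_trans; apply; rewrite mulrDl lerD //.
    by rewrite /density natrM mulSn exprD natrX -mulf_div divff ?mul1r // gt_eqF.
  apply: le_trans (lerD e1 (lexx _)) _; rewrite /a -addrA lerD2l -mulr2n.
  have -> : C%:R / p%:R ^+ e = C%:R / p%:R ^+ e.+1 * p%:R :> K.
    by rewrite exprS invfM [p%:R^-1 * _]mulrC mulrA divfK // gt_eqF.
  by rewrite -[_ *+ 2]mulr_natr ler_wpM2l ?ler_nat // divr_ge0 ?ler0n // ltW.
have rS : cvgn (density w).
  have -> : density w = (fun e => a e - C%:R / p%:R ^+ e).
    by apply/funext => e; rewrite /a addrK.
  apply: is_cvgB => //; apply/cvg_ex; exists 0; exact: cvg_error.
have dS : (fun e => (f (e + n)%N)%:R / p%:R ^+ (e * d) - density w e) @ \oo --> (0 : K).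
  apply: (squeeze_cvgr (f := fun e => - (C%:R / p%:R ^+ e)) (h := fun e => C%:R / p%:R ^+ e)).
  - near=> e; have [_ h2 h3] := h e; rewrite /density -mulrBl; apply/andP; split.
      have := h3; rewrite -leq_subLR => /error_bound h4.
      rewrite lerNl -mulNr opprB; apply: le_trans h4; apply: ler_wpM2r; first by rewrite invr_ge0 ltW.
      by rewrite lerBlDl -natrD ler_nat; lia.
    have := h2; rewrite -leq_subLR => /error_bound h4.
    apply: le_trans h4; apply: ler_wpM2r; first by rewrite invr_ge0 ltW.
    by rewrite lerBlDl -natrD ler_nat; lia.
  - rewrite -[0]oppr0; apply: cvgN; exact: cvg_error.
  - exact: cvg_error.
apply/cvg_ex; exists ((p%:R ^+ (n * d))^-1 * (0 + limn (density w))).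
rewrite -(cvg_shiftn n).
have -> : [sequence density f (e + n)%N]_e =
    (fun e => (p%:R ^+ (n * d))^-1 * (((f (e + n)%N)%:R / p%:R ^+ (e * d) - density w e) + density w e)).
  by apply/funext => e; rewrite subrK /density /= mulnDl exprD invfM [in LHS]mulrA [RHS]mulrC.
apply: cvgMr; apply: cvgD => //.
Unshelve. all: by end_near. Qed.

End Density.

Section Ceil.
Variables (K : realType) (p : nat) (s : K).
Hypotheses (p1 : (1 < p)%N) (s0 : 0 < s).

Definition hceil e := `|Num.ceil (s * p%:R ^+ e)|%N.

Lemma hceilE e : (hceil e)%:Z = Num.ceil (s * p%:R ^+ e).
Proof.
rewrite /hceil gez0_abs // ceil_ge0 (@lt_trans _ _ 0) ?ltrN10 // mulr_gt0 // exprn_gt0 //.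
by rewrite ltr0n ltnW.
Qed.

Lemma hceilS e : (hceil e.+1 <= p * hceil e)%N.
Proof.
have : ((hceil e.+1)%:Z <= (p * hceil e)%:Z)%R.
  rewrite hceilE ceil_le_int exprS mulrCA PoszM intrM hceilE.
  by rewrite ler_pM2l ?ceil_ge // ltr0n ltnW.
by [].
Qed.

Lemma hceilD e n : (p ^ n * hceil e <= hceil (e + n) + p ^ n)%N.
Proof.
suff : ((p ^ n * hceil e)%N%:R < (hceil (e + n) + p ^ n)%N%:R :> K) by rewrite ltr_nat => /ltnW.
have pn : (0 : K) < p%:R ^+ n by rewrite exprn_gt0 // ltr0n ltnW.
have h1 : (hceil e)%:R < s * p%:R ^+ e + 1.
  have := ceilB1_lt (s * p%:R ^+ e); rewrite -hceilE intrB ltrBlDr; exact.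
have h2 : s * p%:R ^+ (e + n) <= (hceil (e + n))%:R.
  by have := ceil_ge (s * p%:R ^+ (e + n)); rewrite -hceilE.
rewrite natrM natrD natrX; apply: lt_le_trans (_ : p%:R ^+ n * (s * p%:R ^+ e + 1) <= _).
  by rewrite ltr_pM2l.
by rewrite mulrDr mulr1 lerD2r; apply: le_trans h2; rewrite exprD mulrCA [p%:R ^+ n * _]mulrC.
Qed.

End Ceil.

Section HFunctionLimit.
Variables (K : realType) (A : comNzRingType) (kf : fieldType) (f : {rmorphism A -> kf}).
Variables (M I J : set A) (p : nat) (s : K).
Hypotheses (pA : p \in [pchar A]) (nA : fin_gen A) (lM : loc M).
Hypotheses (fM : forall x, M x <-> f x = 0) (f_surj : forall y, exists x, f x = y).
Hypotheses (hI : primary_to M I) (hJ : primary_to M J) (s0 : 0 < s).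
Hypothesis d0 : (0 < krull_dim A)%N.

Definition hcount (cc : set A) : nat -> nat := hlen I J p (hceil p s) cc.
Definition hlim (cc : set A) : K := limn (density K p (krull_dim A) (hcount cc)).

Lemma primary_common : exists c, [/\ idl A I, idl A J, ipow M c `<=` I & ipow M c `<=` J].
Proof.
have [iM _ _] := lM.
have [iI [c1 h1]] := primary_pow nA iM hI; have [iJ [c2 h2]] := primary_pow nA iM hJ.
exists (c1 + c2)%N; split=> //.
  by apply: subset_trans h1; apply: ipow_anti; exact: leq_addr.
by apply: subset_trans h2; apply: ipow_anti; exact: leq_addl.
Qed.

Lemma h_idealE e : h_ideal p s I J e = hid I J p (hceil p s) e.
Proof. by rewrite /h_ideal ideal_addE ideal_powE /frobenius_pow ideal_spanE. Qed.

Lemma h_functionE (V : lmodType A) (th : A -> V) :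
  (forall x y, th (x + y) = th x + th y) -> (forall b x, th (b * x) = b *: th x) ->
  (forall v, exists x, th x = v) -> h_function p s I J V = hlim [set x | th x = 0].
Proof.
move=> thD thZ ts; rewrite /h_function /hlim; congr (limn _); apply/funext => e.
rewrite h_idealE (length_mod_quot thD thZ ts) //; exact: hid_idl.
Qed.

Let p1 : (1 < p)%N. Proof. by case/andP: pA => /prime_gt1. Qed.
Let p0 : (0 < p)%N. Proof. exact: ltnW. Qed.

Lemma hcount_cvg cc : idl A cc -> cvgn (density K p (krull_dim A) (hcount cc)).
Proof.
move=> icc; have [c [iI iJ MI MJ]] := primary_common.
have [L [iota [B [beta [us [Xs nz]]]]]] := normalization_exists pA nA lM fM f_surj.
have [n [w [C h]]] := hlen_near nA lM p0 iI MI MJ (hceilS p1 s0) (hceilD p1 s0) nz d0 icc.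
exact: (@density_cvg K p (krull_dim A) p1 d0 (hcount cc) n w C h).
Qed.

Lemma hlim_additive a b : idl A a -> idl A b -> (forall x, a x -> b x -> x = 0) ->
  hlim [set 0] + hlim (addset a b) = hlim a + hlim b.
Proof.
move=> ia ib ab0; have [c [iI iJ MI MJ]] := primary_common.
have [L [iota [B [beta [us [Xs nz]]]]]] := normalization_exists pA nA lM fM f_surj.
have [n [C h]] := hlen_additive nA lM p0 iI MI MJ (hceilS p1 s0) (hceilD p1 s0) nz d0 ia ib ab0.
have i0 : idl A [set 0] by split=> // [x y -> ->|r x ->] /=; rewrite ?addr0 ?mulr0.
have iab := submA ia ib.
have dD g1 g2 : density K p (krull_dim A) (fun e => g1 e + g2 e)%N =
    density K p (krull_dim A) g1 + density K p (krull_dim A) g2.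
  by apply/funext => e; rewrite /density natrD mulrDl.
pose u e := (hcount [set 0%R] e + hcount (addset a b) e)%N.
pose v e := (hcount a e + hcount b e)%N.
have huv e : (v (e + n) <= u (e + n) <= v (e + n) + C * (p ^ e) ^ (krull_dim A).-1)%N.
  by apply/andP; exact: h.
have E := cvg_lim (@Rhausdorff K) (@density_squeeze K p (krull_dim A) p1 d0 u v n C huv).
apply/eqP; rewrite -subr_eq0 /hlim -!limD; try exact: hcount_cvg.
rewrite -!dD -limB; first by rewrite -E.
  by rewrite dD; apply: is_cvgD; exact: hcount_cvg.
by rewrite dD; apply: is_cvgD; exact: hcount_cvg.
Qed.

Lemma hlim_small (C : comNzRingType) (MC : set C) (g : {rmorphism A -> C}) :
  (forall y, exists x, g x = y) -> fin_gen C -> loc MC -> (krull_dim C < krull_dim A)%N ->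
  hlim [set x | g x = 0] = 0.
Proof.
move=> gs nC lC dC; have [c [iI iJ MI MJ]] := primary_common.
have [D hD] := quotient_small gs nA lM nC lC.
have [c1 hc1] := hid_ipow I nA lM p0 MJ (hceilS p1 s0).
(* Written with shift 0 and the zero sequence, the shape that [density_squeeze] expects. *)
have h e : (0 <= hcount [set x | g x = 0%R] (e + 0) <=
    0 + D * c1 ^ krull_dim C * (p ^ e) ^ (krull_dim A).-1)%N.
  rewrite addn0 add0n leq0n /=; apply: leq_trans (hD _ _ (hid_idl _ _ _ _ _) (hc1 e)) _.
  rewrite expnMn mulnA leq_mul2l; apply/orP; right.
  by rewrite leq_pexp2l ?expn_gt0 ?p0 // -ltnS prednK.
have := @density_squeeze K p (krull_dim A) p1 d0 _ (fun=> 0%N) 0 _ h.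
move=> /(cvg_lim (@Rhausdorff K)) <-; congr (limn _); apply/funext => e.
by rewrite /density mul0r subr0.
Qed.

End HFunctionLimit.

Theorem theorem3p1 (K : realType) (k : fieldType)
    (R S T : comNzRingType) (mR : set R) (mS : set S) (mT : set T)
    (locR : noetherian_local mR k) (locS : noetherian_local mS k)
    (locT : noetherian_local mT k)
    (p : nat) (hpR : p \in [pchar R]) (hpS : p \in [pchar S])
    (eR : {rmorphism R -> T}) (eS : {rmorphism S -> T})
    (eR_surj : forall t, exists r, eR r = t)
    (eS_surj : forall t, exists r, eS r = t)
    (hdim : (0 < krull_dim R)%N)
    (m : set (fiber_prod eR eS)) (hm : maximal_ideal m)
    (I J : set (fiber_prod eR eS))
    (hI : primary_to m I) (hJ : primary_to m J)
    (s : K) (hs : 0 < s) :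
  let h (N : lmodType (fiber_prod eR eS)) : K := h_function p s I J N in
  let hP := h (fiber_prod eR eS)^o in
  let hR := h (restrict_scalars (fiber_fst eR eS)) in
  let hS := h (restrict_scalars (fiber_snd eR eS)) in
  let hT := h (restrict_scalars (fiber_base eR eS)) in
  [/\ krull_dim R = krull_dim S /\ krull_dim S = krull_dim T ->
        hP = hR + hS - hT,
      krull_dim R = krull_dim S /\ (krull_dim T < krull_dim S)%N ->
        hP = hR + hS
    & (krull_dim S < krull_dim R)%N /\ (krull_dim T < krull_dim S)%N ->
        hP = hR].
Proof.
have [nR lR [fR [fRs fRm]]] := noetherian_localP locR.
have [nS lS _] := noetherian_localP locS.
have [nT lT _] := noetherian_localP locT.
pose P := fiber_prod eR eS.
have nP : fin_gen P := fiber_fin_gen eR_surj eS_surj nR nS.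
have lP := fiber_loc eR eS_surj lR lS; have Em := maximal_loc lP hm.
rewrite -Em in lP.
have pP : p \in [pchar P].
  apply/andP; split; first by case/andP: hpR.
  by apply/eqP; apply: fiber_inj; rewrite !rmorph0 !rmorph_nat ?(pcharf0 hpR) ?(pcharf0 hpS).
pose f : {rmorphism P -> k} := fR \o fiber_fst eR eS.
have fs y : exists x, f x = y.
  by have [r <-] := fRs y; have [x <-] := fst_surj eR eS_surj r; exists x.
have fm x : m x <-> f x = 0 by rewrite Em; exact: fRm.
have dP := krull_dim_surj nP lP (fst_surj eR eS_surj).
have d0 : (0 < krull_dim P)%N by exact: leq_trans dP.
pose hl (cc : set P) := hlim I J p s cc.
pose a := [set x | fiber_fst eR eS x = 0]; pose b := [set x | fiber_snd eR eS x = 0].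
have ia : idl P a by exact: idl_ker.
have ib : idl P b by exact: idl_ker.
have ab0 x : a x -> b x -> x = 0 by move=> ax bx; apply: fiber_inj; rewrite rmorph0.
have ab : addset a b = [set x | fiber_base eR eS x = 0].
  apply/seteqP; split=> [_ [x ax [y by' <-]]|x x0].
    rewrite /= rmorphD; change (eR (fiber_fst eR eS x) + eR (fiber_fst eR eS y) = 0).
    by rewrite (ax : fiber_fst eR eS x = 0) fiber_eq (by' : fiber_snd eR eS y = 0) !rmorph0 addr0.
  have [y [y1 y2]] : exists y : P, fiber_fst eR eS y = 0 /\ fiber_snd eR eS y = fiber_snd eR eS x.
    by apply: fiberP; rewrite rmorph0 -fiber_eq.
  exists y => //; exists (x - y); last by rewrite addrC subrK.
  by change (fiber_snd eR eS (x - y) = 0); rewrite rmorphB y2 subrr.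
have add := hlim_additive pP nP lP fm fs hI hJ hs d0 ia ib ab0.
have small C := @hlim_small K P m I J p s pP nP lP hI hJ hs d0 C.
move=> h hP hR hS hT.
have EP : hP = hl [set 0] by apply: (@h_functionE _ _ _ _ _ _ P^o id) => // v; exists v.
have ER : hR = hl a by apply: h_functionE => // v; exact: fst_surj.
have ES : hS = hl b by apply: h_functionE => // v; exact: snd_surj.
have ET : hT = hl (addset a b).
  rewrite ab; apply: (@h_functionE _ _ _ _ _ _ (restrict_scalars (fiber_base eR eS)) (fiber_base eR eS)).
  - exact: rmorphD.
  - exact: rmorphM.
  - exact: (base_surj eR_surj eS_surj).
(* Lengths are all divided by the same [p^(e dim P)], so this covers every case; the dimensions only
   decide which of [hS] and [hT] vanish. *)
have E : hP + hT = hR + hS by rewrite EP ER ES ET.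
have zT : (krull_dim T < krull_dim P)%N -> hT = 0.
  by rewrite ET ab; apply: small lT => //; exact: (base_surj eR_surj eS_surj).
have zS : (krull_dim S < krull_dim P)%N -> hS = 0.
  by rewrite ES; apply: small lS => //; exact: snd_surj.
split=> [_|[RS TS]|[SR TS]].
- by rewrite -E addrK.
- by rewrite -E zT ?addr0 // (leq_trans TS) // -RS.
- have SP := leq_trans SR dP.
  by rewrite -[hR]addr0 -(zS SP) -E (zT (ltn_trans TS SP)) addr0.
Qed.
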